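(* The problem $\mathrm{HITTINGSET\text{-}CLASSES}$ is complete for the class $\mathsf{APEPP}$ under $\mathsf{P}^{\mathsf{NP}}$-reductions; indeed, $\mathsf{P}/\mathsf{P}^{\mathsf{NP}}$-reductions suffice.
   Context: $\mathrm{Ckt}(n,d,s)$ = algebraic circuits over $\mathbb{Z}$ (straight-line programs with variables, plugged integer constants, $+$, $\times$) with at most $n$ indeterminates, maximum syntactic individual degree (over variables and parameters; max at $+$, sum at $\times$) at most $d$, representation size at most $s$. $S_q=\{0,\ldots,q-1\}$; $|q|$ is the binary length of $q$. A description of a class of at most $2^m$ algebraic circuits $\mathscr{G}\subseteq\mathrm{Ckt}(n,d,s)$ is a Boolean circuit with $m$ inputs and $s$ outputs syntactically guaranteed to output (codes of) circuits in $\mathrm{Ckt}(n,d,s)$ (e.g., outputting a trivial circuit for the zero polynomial when its output is not in $\mathrm{Ckt}(n,d,s)$); $\mathscr{G}$ is its range. A hitting set for $\mathscr{G}$ over $S_q$ of size at most $r$ is a tuple $(\overline{h}_1,\ldots,\overline{h}_r)\in(S_q^n)^r$ such that every $P\in\mathscr{G}$ that is nonzero at some point of $\mathbb{Z}^n$ is nonzero at some $\overline{h}_i$. $\mathrm{HITTINGSET\text{-}CLASSES}$: given $n,d,s,q,r,m$ in unary with $q\ge 2nd$ and $r>m+n|q|$, and a description of a class $\mathscr{G}$ of at most $2^m$ algebraic circuits in $\mathrm{Ckt}(n,d,s)$, find a hitting set for $\mathscr{G}$ over $S_q$ of size at most $r$. $\mathrm{EMPTY}$ (Range Avoidance): given a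 Boolean circuit $C$ with $m$ inputs and $m+1$ outputs, find $y\in\{0,1\}^{m+1}$ not in the range of $C$; $\mathsf{APEPP}$ is the class of total search problems reducible to $\mathrm{EMPTY}$. A reduction from search problem $A$ to $B$ is a pair of maps: a forward map sending instances $x$ of $A$ to instances $f(x)$ of $B$, and a backward map sending any solution $y$ of $f(x)$ to a solution of $x$; it is a $\mathsf{P}/\mathsf{P}^{\mathsf{NP}}$-reduction if the forward map is polynomial-time computable and the backward map is computable by a polynomial-time machine with an NP oracle. *)

(* Defs.v *)
From mathcomp Require Import all_boot all_order all_algebra.

Set Implicit Arguments.
Unset Strict Implicit.
Unset Printing Implicit Defensive.

Import GRing.Theory Num.Theory.

(** * Machines

   Oracle machines with finitely many work tapes, in structured form.  A
   register is a binary stack, that is, a one-way infinite tape with its head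
   on the top symbol; a two-way tape is a pair of stacks.  Every instruction
   acts on one top symbol and costs one step; an oracle query costs one step
   and replaces the query word by the answer bit. *)

Definition bits := seq bool.
Definition language := bits -> Prop.
Definition store := nat -> bits.

Definition update (s : store) (i : nat) (w : bits) : store :=
  fun j => if j == i then w else s j.

Inductive cmd :=
  | Skip
  | Push of nat & bool
  | Pop of nat
  | Query of nat
  | Seq of cmd & cmd
  | Case of nat & cmd & cmd & cmd (* empty / top is false / top is true *)
  | While of nat & cmd.           (* loop as long as the register is nonempty *)

Inductive exec (O : language) : cmd -> store -> store -> nat -> Prop :=
  | ExecSkip s : exec O Skip s s 1
  | ExecPush s i b : exec O (Push i b) s (update s i (b :: s i)) 1
  | ExecPop s i : exec O (Pop i) s (update s i (behead (s i))) 1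
  | ExecQueryYes s i : O (s i) -> exec O (Query i) s (update s i [:: true]) 1
  | ExecQueryNo s i : ~ O (s i) -> exec O (Query i) s (update s i [:: false]) 1
  | ExecSeq c1 c2 s s1 s2 t1 t2 :
      exec O c1 s s1 t1 -> exec O c2 s1 s2 t2 ->
      exec O (Seq c1 c2) s s2 (t1 + t2)
  | ExecCase i c0 cF cT s s1 t :
      exec O (match s i with [::] => c0 | b :: _ => if b then cT else cF end)
        s s1 t ->
      exec O (Case i c0 cF cT) s s1 t.+1
  | ExecWhileStop i c s : s i = [::] -> exec O (While i c) s s 1
  | ExecWhileStep i c s s1 s2 t1 t2 :
      s i <> [::] -> exec O c s s1 t1 -> exec O (While i c) s1 s2 t2 ->
      exec O (While i c) s s2 (t1 + t2).+1.

(** * Polynomial time, NP, and the class P^NP of functions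

   [k] is the number of arguments, initially in registers [0 .. k-1] (all
   other registers being empty); the result is left in register [0].  Every
   polynomial is dominated by some [n ^ e + e]. *)

Definition polytime_oracle (O : language) (k : nat) (f : seq bits -> bits) :=
  exists c e, forall xs : seq bits, size xs = k ->
    exists s t, [/\ exec O c (nth [::] xs) s t,
                    s 0 = f xs
                  & t <= size (flatten xs) ^ e + e].

(* Queries to the empty oracle are always answered by [false], so that they
   are of no use. *)
Definition polytime : nat -> (seq bits -> bits) -> Prop :=
  polytime_oracle (fun _ => False).

Definition NP (L : language) :=
  exists V e, polytime 2 V /\
    forall x, L x <->
      exists2 w : bits, size w <= size x ^ e + e & V [:: x; w] = [:: true].

Definition polytimeNP (k : nat) (f : seq bits -> bits) :=
  exists2 L, NP L & polytime_oracle L k f.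

(** * Search problems and reductions *)

Record search_problem := SearchProblem {
  instance : bits -> Prop;
  solution : bits -> bits -> Prop
}.

Definition total (A : search_problem) :=
  forall x, instance A x -> exists y, solution A x y.

Definition reducible (F G : nat -> (seq bits -> bits) -> Prop)
    (A B : search_problem) :=
  exists f g, [/\ F 1 f, G 2 g &
    forall x, instance A x ->
      instance B (f [:: x]) /\
      forall y, solution B (f [:: x]) y -> solution A x (g [:: x; y])].

Definition PNP_reducible := reducible polytimeNP polytimeNP.
Definition P_PNP_reducible := reducible polytime polytimeNP.

Definition complete_for (red : search_problem -> search_problem -> Prop)
    (K : search_problem -> Prop) (A : search_problem) :=
  K A /\ forall B, K B -> red B A.

(** * Self-delimiting (prefix-free) binary codes *)

(* Length of the binary representation; [binlen 0 = 0]. *)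
Definition binlen (k : nat) : nat := up_log 2 k.+1.

(* Least significant bit first. *)
Definition binary (k : nat) : bits :=
  mkseq (fun i => odd (k %/ 2 ^ i)) (binlen k).

Definition list_code (T : Type) (code : T -> bits) (xs : seq T) : bits :=
  flatten [seq true :: code x | x <- xs] ++ [:: false].

Definition unary_code (k : nat) : bits := nseq k true ++ [:: false].
Definition nat_code (k : nat) : bits :=
  list_code (fun b : bool => [:: b]) (binary k).
Definition int_code (z : int) : bits := (z < 0)%R :: nat_code `|z|%N.

(** * Straight-line programs

   A program is a list of gates; a gate refers to earlier gates by their
   positions. *)

Definition slp_values (G T : Type) (step : seq T -> G -> T) (gs : seq G) :
    seq T :=
  foldl (fun vs g => rcons vs (step vs g)) [::] gs.

Definition slp_wf (G : Type) (gate_wf : nat -> G -> bool) (gs : seq G) : bool :=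
  all (fun pg => gate_wf pg.1 pg.2) (zip (iota 0 (size gs)) gs).

(** ** Boolean circuits *)

Inductive bgate :=
  | BInput of nat
  | BConst of bool
  | BNot of nat
  | BAnd of nat & nat
  | BOr of nat & nat.

Record bcircuit := BCircuit { bgates : seq bgate; boutputs : seq nat }.

Definition bstep (x : bits) (vs : seq bool) (g : bgate) : bool :=
  match g with
  | BInput i => nth false x i
  | BConst b => b
  | BNot j => ~~ nth false vs j
  | BAnd j k => nth false vs j && nth false vs k
  | BOr j k => nth false vs j || nth false vs k
  end.

Definition beval (C : bcircuit) (x : bits) : bits :=
  [seq nth false (slp_values (bstep x) (bgates C)) j | j <- boutputs C].

Definition bgate_wf (m p : nat) (g : bgate) : bool :=
  match g with
  | BInput i => i < m
  | BConst _ => true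
  | BNot j => j < p
  | BAnd j k | BOr j k => (j < p) && (k < p)
  end.

(* [C] has [m] inputs and [k] outputs. *)
Definition bcircuit_wf (m k : nat) (C : bcircuit) : bool :=
  [&& slp_wf (bgate_wf m) (bgates C),
      size (boutputs C) == k
    & all (fun j => j < size (bgates C)) (boutputs C)].

Definition bgate_code (g : bgate) : bits :=
  match g with
  | BInput i => [:: false; false; false] ++ nat_code i
  | BConst b => [:: false; false; true; b]
  | BNot j => [:: false; true; false] ++ nat_code j
  | BAnd j k => [:: false; true; true] ++ nat_code j ++ nat_code k
  | BOr j k => [:: true; false; false] ++ nat_code j ++ nat_code k
  end.

Definition bcircuit_code (C : bcircuit) : bits :=
  list_code bgate_code (bgates C) ++ list_code nat_code (boutputs C).

(** ** Algebraic circuits over the integers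

   The input gates are variables and parameters; [aparams] lists the integer
   constants plugged for the parameters.  The output is the last gate, and
   the program without gates computes the zero polynomial. *)

Inductive agate :=
  | AVar of nat
  | AParam of nat
  | AAdd of nat & nat
  | AMul of nat & nat.

Record acircuit := ACircuit { aparams : seq int; agates : seq agate }.

Definition azero : acircuit := ACircuit [::] [::].

Definition astep (ps a : seq int) (vs : seq int) (g : agate) : int :=
  match g with
  | AVar i => nth 0%R a i
  | AParam i => nth 0%R ps i
  | AAdd j k => (nth 0 vs j + nth 0 vs k)%R
  | AMul j k => (nth 0 vs j * nth 0 vs k)%R
  end.

Definition aeval (C : acircuit) (a : seq int) : int :=
  last 0%R (slp_values (astep (aparams C) a) (agates C)).

(* Syntactic degree in the variable [i], for [inl i], or in the parameter
   [i], for [inr i]. *)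
Definition degree_step (l : nat + nat) (vs : seq nat) (g : agate) : nat :=
  match g with
  | AVar i => inl i == l
  | AParam i => inr i == l
  | AAdd j k => maxn (nth 0 vs j) (nth 0 vs k)
  | AMul j k => nth 0 vs j + nth 0 vs k
  end.

Definition adegree (l : nat + nat) (C : acircuit) : nat :=
  last 0 (slp_values (degree_step l) (agates C)).

Definition agate_wf (n k p : nat) (g : agate) : bool :=
  match g with
  | AVar i => i < n
  | AParam i => i < k
  | AAdd i j | AMul i j => (i < p) && (j < p)
  end.

Definition agate_code (g : agate) : bits :=
  match g with
  | AVar i => [:: false; false] ++ nat_code i
  | AParam i => [:: false; true] ++ nat_code i
  | AAdd i j => [:: true; false] ++ nat_code i ++ nat_code j
  | AMul i j => [:: true; true] ++ nat_code i ++ nat_code j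
  end.

Definition acircuit_code (C : acircuit) : bits :=
  list_code int_code (aparams C) ++ list_code agate_code (agates C).

Definition Ckt (n d s : nat) (C : acircuit) : Prop :=
  [/\ slp_wf (agate_wf n (size (aparams C))) (agates C),
      forall l, adegree l C <= d
    & size (acircuit_code C) <= s].

(** * Classes of algebraic circuits and hitting sets *)

(* A word stands for the circuit of [Ckt n d s] whose code is a prefix of it
   (the rest is padding up to length [s]; there is at most one such circuit),
   and for the trivial circuit for the zero polynomial if there is none. *)
Definition denotes (n d s : nat) (w : bits) (P : acircuit) : Prop :=
  (Ckt n d s P /\ prefix (acircuit_code P) w) \/
  (P = azero /\
   ~ exists P', Ckt n d s P' /\ prefix (acircuit_code P') w).

Definition described_class (n d s m : nat) (D : bcircuit) (P : acircuit) :
    Prop :=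
  exists x : m.-tuple bool, denotes n d s (beval D x) P.

Definition hitting_set (n q r : nat) (G : acircuit -> Prop)
    (H : r.-tuple (n.-tuple 'I_q)) : Prop :=
  forall P, G P ->
    (exists a : n.-tuple int, aeval P a <> 0%R) ->
    exists i : 'I_r,
      aeval P [seq Posz (nat_of_ord h) | h <- tnth H i] <> 0%R.

Definition hitting_set_code (n q r : nat) (H : r.-tuple (n.-tuple 'I_q)) :
    bits :=
  flatten [seq flatten [seq nat_code (nat_of_ord c) | c <- tval h]
          | h <- tval H].

Record hitting_set_input := HittingSetInput {
  hs_n : nat; hs_d : nat; hs_s : nat; hs_q : nat; hs_r : nat; hs_m : nat;
  hs_D : bcircuit
}.

Definition hitting_set_input_code (I : hitting_set_input) : bits :=
  flatten [seq unary_code k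
          | k <- [:: hs_n I; hs_d I; hs_s I; hs_q I; hs_r I; hs_m I]]
  ++ bcircuit_code (hs_D I).

(* [0 < hs_q I] only matters when [n * d = 0]: there must be a tuple at all. *)
Definition hitting_set_input_valid (I : hitting_set_input) : Prop :=
  [/\ 0 < hs_q I, 2 * hs_n I * hs_d I <= hs_q I,
      hs_m I + hs_n I * binlen (hs_q I) < hs_r I
    & bcircuit_wf (hs_m I) (hs_s I) (hs_D I)].

Definition HITTINGSET_CLASSES : search_problem := {|
  instance x := exists I,
    hitting_set_input_valid I /\ x = hitting_set_input_code I;
  solution x y := exists (I : hitting_set_input)
      (H : (hs_r I).-tuple ((hs_n I).-tuple 'I_(hs_q I))),
    [/\ x = hitting_set_input_code I,
        hitting_set
          (described_class (hs_n I) (hs_d I) (hs_s I) (hs_m I) (hs_D I)) H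
      & y = hitting_set_code H]
|}.

(** * Range avoidance and the class APEPP *)

Definition EMPTY_code (m : nat) (C : bcircuit) : bits :=
  unary_code m ++ bcircuit_code C.

Definition EMPTY : search_problem := {|
  instance x := exists m C, bcircuit_wf m m.+1 C /\ x = EMPTY_code m C;
  solution x y := exists m C,
    [/\ x = EMPTY_code m C, size y = m.+1
      & forall z : m.-tuple bool, beval C z <> y]
|}.

Definition APEPP (red : search_problem -> search_problem -> Prop)
    (A : search_problem) : Prop :=
  total A /\ red A EMPTY.

(* Main.v *)
(* Hitting sets from range avoidance (a Schwartz-Zippel encoding).  If all of [r]
   points of [S_q ^ n] are roots of a nonzero circuit of the class, then they can
   be recovered from the index of the circuit ([m] bits), a nonroot with
   coordinates at most [d] ([n (|q| - 1)] bits), and, for every root, its place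
   among the at most [d] roots on an axis-parallel line found by a hybrid argument
   ([n d q ^ (n - 1) <= q ^ n / 2] possibilities).  As [r > m + n |q|], this is
   shorter than the list of points, so every string outside the range of the
   decoder is a hitting set.

   Range avoidance from hitting sets.  Iterating [C] stretches [m] bits to
   [r |q|] bits, read as points [h_1, ..., h_r] of [S_q].  The univariate
   polynomials [(X - h_1) ... (X - h_r)] arising in this way form a class all of
   whose hitting sets lie outside the range of the iterated circuit; unwinding
   the iteration with an NP oracle then leads to a string outside the range of
   [C].

   Both forward maps have to output circuits for polynomial-time functions;
   these come from a generic simulation of machines by circuits. *)

Require Import Defs.
From mathcomp Require Import all_boot all_order all_algebra.
From mathcomp Require Import zify.
From Stdlib Require Import FunctionalExtensionality Classical ClassicalEpsilon.

Set Implicit Arguments.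
Unset Strict Implicit.
Unset Printing Implicit Defensive.

(** * Structured machines *)

(** The obstacle is that both reductions speak of concrete machines. A calculus of functions on
    tree-coded data ([pt]) is closed under the usual programming constructs, and every map is
    written as an ordinary function and then shown to lie in it. Numbers are unary there, which
    suits the unary parameters; anything exponentially large is a word of bits, handled modulo a
    power of two. Circuit values are such large numbers. Because individual degrees are bounded in
    the parameters as well as in the variables, they have polynomially many bits, so a zero test is
    an evaluation modulo a large power of two. Every factor one half in the count of roots saves a
    bit, [r] bits in all. They pay for the circuit index, the nonroot, the extra output bit of range
    avoidance and one bit of rounding. Since [q] need not be a power of two, points are read as
    base-[q] digits of a word, and the remaining quotient is encoded as well. Hardness under
    reductions whose forward map uses an NP oracle is a composition: the backward map recomputes the
    intermediate instance, so its oracle is a join of all oracles involved. *)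

Definition stx (a b c d : bits) (s : store) : store := fun i =>
  match i with 0 => a | 1 => b | 2 => c | 3 => d | i.+4 => s i end.
Definition nost : store := fun _ => [::].
Notation st w := (stx w [::] [::] [::] nost).

Lemma updx0 a b c d s w : update (stx a b c d s) 0 w = stx w b c d s.
Proof. by apply: functional_extensionality => -[|[|[|[|i]]]]. Qed.
Lemma updx1 a b c d s w : update (stx a b c d s) 1 w = stx a w c d s.
Proof. by apply: functional_extensionality => -[|[|[|[|i]]]]. Qed.
Lemma updx2 a b c d s w : update (stx a b c d s) 2 w = stx a b w d s.
Proof. by apply: functional_extensionality => -[|[|[|[|i]]]]. Qed.
Lemma updx3 a b c d s w : update (stx a b c d s) 3 w = stx a b c w s.
Proof. by apply: functional_extensionality => -[|[|[|[|i]]]]. Qed.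
Lemma updx4 a b c d s i w :
  update (stx a b c d s) i.+4 w = stx a b c d (update s i w).
Proof. by apply: functional_extensionality => -[|[|[|[|j]]]]. Qed.
Lemma upd_id s i : update s i (s i) = s.
Proof.
apply: functional_extensionality => j; rewrite /update.
by case: eqP => // ->.
Qed.
Definition updx := (updx0, updx1, updx2, updx3, updx4).

Section Runs.
Variable O : language.

Definition runs c s s' n := exists2 t, exec O c s s' t & t <= n.

Lemma runs_le c s s' n m : runs c s s' n -> n <= m -> runs c s s' m.
Proof. by case=> t h ht hm; exists t => //; apply: leq_trans ht hm. Qed.
Lemma runs_skip s : runs Skip s s 1.
Proof. by exists 1 => //; constructor. Qed.
Lemma runs_push i b s : runs (Push i b) s (update s i (b :: s i)) 1.
Proof. by exists 1 => //; constructor. Qed.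
Lemma runs_pop i s : runs (Pop i) s (update s i (behead (s i))) 1.
Proof. by exists 1 => //; constructor. Qed.
Lemma runs_seq c1 c2 s s1 s2 n1 n2 : runs c1 s s1 n1 -> runs c2 s1 s2 n2 ->
  runs (Seq c1 c2) s s2 (n1 + n2).
Proof.
by case=> t1 h1 l1 [t2 h2 l2]; exists (t1 + t2); [apply: ExecSeq h1 h2 | lia].
Qed.
Lemma runs_case i c0 cF cT s s' n :
  runs (match s i with [::] => c0 | b :: _ => if b then cT else cF end) s s' n ->
  runs (Case i c0 cF cT) s s' n.+1.
Proof. by case=> t h l; exists t.+1 => //; constructor. Qed.
Lemma runs_stop i c s : s i = [::] -> runs (While i c) s s 1.
Proof. by move=> h; exists 1 => //; constructor. Qed.
Lemma runs_loop i c s s1 s2 n1 n2 : s i <> [::] -> runs c s s1 n1 ->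
  runs (While i c) s1 s2 n2 -> runs (While i c) s s2 (n1 + n2).+1.
Proof.
move=> h [t1 h1 l1] [t2 h2 l2]; exists (t1 + t2).+1; last lia.
exact: ExecWhileStep h h1 h2.
Qed.

Fixpoint seqs (cs : seq cmd) : cmd :=
  match cs with [::] => Skip | [:: c] => c | c :: cs => Seq c (seqs cs) end.

Definition move i j := While i (Case i Skip
  (Seq (Pop i) (Push j false)) (Seq (Pop i) (Push j true))).

Lemma runs_move i j s : i <> j ->
  runs (move i j) s
    (update (update s i [::]) j (catrev (s i) (s j))) (4 * size (s i) + 1).
Proof.
move=> /eqP ij; move E: (s i) => w; elim: w s E => [|b w IH] s' E.
  by rewrite /= -E !upd_id; apply: runs_stop.
have IH' := IH (update (update s' i w) j (b :: s' j)).
have -> : 4 * size (b :: w) + 1 = (3 + (4 * size w + 1)).+1 by rewrite /=; lia.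
apply: runs_loop; first by rewrite E.
  apply: runs_case; rewrite E.
  have H : forall b0, runs (Seq (Pop i) (Push j b0)) s'
       (update (update s' i w) j (b0 :: s' j)) 2.
    move=> b0; apply: (@runs_seq _ _ _ _ _ 1 1); first exact: runs_pop.
    rewrite E /=.
    have -> : s' j = update s' i w j by rewrite /update eq_sym (negbTE ij).
    exact: runs_push.
  by case: (b) (H b).
have := IH'; rewrite {1}/update (negbTE ij) /update eqxx => /(_ erefl).
rewrite eqxx /= => {IH IH'}.
set s1 := (X in runs _ _ X _); set s2 := (X in _ -> runs _ _ X _).
suff -> : s1 = s2 by [].
apply: functional_extensionality => k; rewrite /s1 /s2.
by case: eqP => // _; case: eqP.
Qed.

Lemma runs_moveE i j s s' n : i <> j ->
  s' = update (update s i [::]) j (catrev (s i) (s j)) ->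
  4 * size (s i) + 1 <= n -> runs (move i j) s s' n.
Proof. by move=> ij -> hn; apply: runs_le hn; apply: runs_move. Qed.

Lemma runs_clear i s :
  runs (While i (Pop i)) s (update s i [::]) (2 * size (s i) + 1).
Proof.
move E: (s i) => w; elim: w s E => [|b w IH] s' E.
  by rewrite /= -E upd_id; apply: runs_stop.
have -> : 2 * size (b :: w) + 1 = (1 + (2 * size w + 1)).+1 by rewrite /=; lia.
apply: runs_loop; [by rewrite E | exact: runs_pop | rewrite E /=].
have := IH (update s' i w); rewrite {1}/update eqxx => /(_ erefl).
set s1 := (X in runs _ _ X _); set s2 := (X in _ -> runs _ _ X _).
suff -> : s1 = s2 by [].
by apply: functional_extensionality => k; rewrite /s1 /s2 /update; case: eqP.
Qed.

End Runs.

(** * Tree codes *)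

(** Preorder codes of binary trees delimit themselves: counting the pending subtrees is enough to
    find the end of a code on a stack. All data are therefore coded as trees. *)
Inductive tree := Leaf | Node of tree & tree.

Fixpoint tcode (t : tree) : bits :=
  match t with
  | Leaf => [:: false]
  | Node l r => true :: tcode l ++ tcode r
  end.

(** Register 2 counts in unary the subtrees still to be read: a leaf removes one, an inner node
    replaces one by two. The code ends up reversed in register 1. *)
Definition scan := Seq (Push 2 true) (While 2 (seqs [:: Pop 2;
  Case 0 Skip (seqs [:: Pop 0; Push 1 false])
    (seqs [:: Pop 0; Push 1 true; Push 2 true; Push 2 true])])).

Lemma runs_eq O c s s1 s2 n : runs O c s s1 n -> s1 = s2 -> runs O c s s2 n.
Proof. by move=> h <-. Qed.
(** The statement takes the rest of the run as a hypothesis, for an arbitrary remaining counter [c],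
    so that at a node the induction hypotheses for the two subtrees chain directly. *)
Lemma runs_scan_loop O t r b c d s s' n :
  runs O (While 2 (seqs [:: Pop 2;
     Case 0 Skip (seqs [:: Pop 0; Push 1 false])
    (seqs [:: Pop 0; Push 1 true; Push 2 true; Push 2 true])]))
    (stx r (catrev (tcode t) b) c d s) s' n ->
  runs O (While 2 (seqs [:: Pop 2;
     Case 0 Skip (seqs [:: Pop 0; Push 1 false])
    (seqs [:: Pop 0; Push 1 true; Push 2 true; Push 2 true])]))
    (stx (tcode t ++ r) b (true :: c) d s) s' (n + 7 * size (tcode t)).
Proof.
set W := While _ _.
elim: t r b c n => [|t1 IH1 t2 IH2] r b c n H.
  apply: (@runs_le _ _ _ _ (4 + n).+1); last by rewrite /=; lia.
  refine (runs_loop _ _ H) => //=.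
  apply: (@runs_seq _ _ _ _ _ _ 1 3); first exact: runs_pop.
  rewrite !updx /=; apply: runs_case => /=.
  apply: runs_eq; first by apply: (@runs_seq _ _ _ _ _ _ 1 1); [exact: runs_pop| exact: runs_push].
  by rewrite !updx.
apply: (@runs_le _ _ _ _ (6 + (n + 7 * size (tcode t2) + 7 * size (tcode t1))).+1);
  last by rewrite /= size_cat; lia.
apply: (@runs_loop _ _ _ _ (stx (tcode t1 ++ tcode t2 ++ r) (true :: b)
    [:: true, true & c] d s)) => //.
  apply: (@runs_seq _ _ _ _ _ _ 1 5); first exact: runs_pop.
  rewrite !updx /=; apply: runs_case => /=.
  apply: runs_eq; first by do 3 (refine (@runs_seq _ _ _ _ _ _ 1 _ _ _);
    [by first [exact: runs_pop|exact: runs_push]|]); exact: runs_push.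
  by rewrite !updx /= -catA.
apply: IH1; apply: IH2; move: H; by rewrite /= !catrevE rev_cat -catA.
Qed.

Lemma runs_scan O t r b d s :
  runs O scan (stx (tcode t ++ r) b [::] d s)
    (stx r (catrev (tcode t) b) [::] d s) (7 * size (tcode t) + 2).
Proof.
apply: (@runs_le _ _ _ _ (1 + (1 + 7 * size (tcode t)))); last lia.
apply: runs_seq; first exact: runs_push.
by rewrite updx; apply: runs_scan_loop; apply: runs_stop.
Qed.

Definition drop_top := Seq scan (While 1 (Pop 1)).
Definition swap_top := seqs [:: scan; move 1 3; scan; move 3 2; move 2 0; move 1 0].
Definition dup_top := seqs [:: scan;
  While 1 (Case 1 Skip (seqs [:: Pop 1; Push 0 false; Push 3 false])
                       (seqs [:: Pop 1; Push 0 true; Push 3 true]));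
  move 3 2; move 2 0].

Lemma runs_drop O t r :
  runs O drop_top (st (tcode t ++ r)) (st r) (9 * size (tcode t) + 3).
Proof.
apply: (@runs_le _ _ _ _ ((7 * size (tcode t) + 2) + (2 * size (tcode t) + 1))); last lia.
apply: runs_seq; first exact: runs_scan.
apply: runs_le; last first.
  apply: leqnn.
apply: runs_le.
  by apply: runs_eq; [exact: runs_clear | rewrite !updx].
by rewrite /= catrevE cats0 size_rev.
Qed.

Lemma runs_swap O t1 t2 r :
  runs O swap_top (st (tcode t1 ++ tcode t2 ++ r)) (st (tcode t2 ++ tcode t1 ++ r))
    (20 * (size (tcode t1) + size (tcode t2)) + 10).
Proof.
set n1 := size (tcode t1); set n2 := size (tcode t2).
apply: (@runs_le _ _ _ _ ((7 * n1 + 2) + ((4 * n1 + 1) + ((7 * n2 + 2) +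
   ((4 * n1 + 1) + ((4 * n1 + 1) + (4 * n2 + 1))))))); last lia.
apply: runs_seq; first exact: runs_scan.
apply: runs_seq; first apply: runs_moveE => //; rewrite ?updx /= ?catrevE ?cats0 ?size_rev //.
rewrite /= revK.
apply: runs_seq; first exact: runs_scan.
apply: runs_seq; first apply: runs_moveE => //; rewrite ?updx /= ?catrevE ?cats0 ?size_rev //.
apply: runs_seq; first apply: runs_moveE => //; rewrite ?updx /= ?catrevE ?cats0 ?size_rev //.
rewrite /= revK.
apply: runs_moveE => //; rewrite ?updx /= ?catrevE ?cats0 ?size_rev //.
by rewrite revK.
Qed.

Lemma runs_dup O t r :
  runs O dup_top (st (tcode t ++ r)) (st (tcode t ++ tcode t ++ r))
    (30 * size (tcode t) + 10).
Proof.
set n1 := size (tcode t).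
apply: (@runs_le _ _ _ _ ((7 * n1 + 2) + ((5 * n1 + 1) + ((4 * n1 + 1) + (4 * n1 + 1))))); last lia.
apply: runs_seq; first exact: runs_scan.
apply: runs_seq.
  rewrite catrevE cats0 /n1 -(size_rev (tcode t)).
  have H : forall w a d, runs O (While 1 (Case 1 Skip (seqs [:: Pop 1; Push 0 false; Push 3 false])
                       (seqs [:: Pop 1; Push 0 true; Push 3 true])))
     (stx a w [::] d nost) (stx (catrev w a) [::] [::] (catrev w d) nost) (5 * size w + 1).
    elim=> [|b w IH] a d; first exact: runs_stop.
    have -> : 5 * size (b :: w) + 1 = (4 + (5 * size w + 1)).+1 by rewrite /=; lia.
    refine (runs_loop _ _ (IH _ _)) => //; apply: runs_case => /=.
    by case: b; apply: runs_eq; do ?[refine (@runs_seq _ _ _ _ _ _ 1 _ _ _);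
     [by first [exact: runs_pop|exact: runs_push]|]| exact: runs_push]; rewrite ?updx.
  exact: H.
rewrite !catrevE revK cats0.
apply: runs_seq; first apply: runs_moveE => //; rewrite ?updx /= ?catrevE ?cats0 ?size_rev //.
apply: runs_moveE => //; rewrite ?updx /= ?catrevE ?cats0 ?size_rev //.
by rewrite revK.
Qed.

(** * Polynomial bounds *)

Definition pw k n := (n + 2) ^ k.
(** Powers of [n + 2] are monotone, positive and at least [2 ^ k], so sums, products, constants and
    compositions are all absorbed into a single exponent. *)
Definition pb (p : nat -> nat) := exists k, forall n, p n <= pw k n.

Lemma pw_mono k m n : m <= n -> pw k m <= pw k n.
Proof. by move=> h; rewrite /pw; case: k => // k; rewrite leq_exp2r // leq_add2r. Qed.
Lemma pw_gt0 k n : 0 < pw k n.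
Proof. by rewrite expn_gt0 addn2. Qed.
Lemma pb_pw k : pb (pw k). Proof. by exists k. Qed.
Lemma pb_le p q : pb q -> (forall n, p n <= q n) -> pb p.
Proof. by case=> k h h'; exists k => n; apply: leq_trans (h' n) (h n). Qed.
Lemma pb_id : pb id.
Proof. by exists 1 => n; rewrite /pw expn1 /=; lia. Qed.
Lemma pb_const c : pb (fun _ => c).
Proof.
exists c => n; rewrite /pw; apply: leq_trans (ltnW (ltn_expl c (ltnSn 1))) _.
by case: c => // c; rewrite leq_exp2r // addn2.
Qed.
Lemma pb_add p q : pb p -> pb q -> pb (fun n => p n + q n).
Proof.
case=> k h [l h']; exists (k + l + 1) => n; apply: leq_trans (leq_add (h n) (h' n)) _.
rewrite /pw !expnD expn1; have := pw_gt0 k n; have := pw_gt0 l n; rewrite /pw; nia.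
Qed.
Lemma pb_mul p q : pb p -> pb q -> pb (fun n => p n * q n).
Proof.
by case=> k h [l h']; exists (k + l) => n; rewrite /pw expnD leq_mul.
Qed.
Lemma pb_comp p q : pb p -> pb q -> pb (fun n => p (q n)).
Proof.
case=> k h [l h']; exists ((l + 2) * k) => n; apply: leq_trans (h _) _.
rewrite {2}/pw expnM -/(pw _ _); case: k {h} => // k; rewrite leq_exp2r //.
apply: leq_trans (leq_add (h' n) (leqnn 2)) _.
rewrite /pw expnD; have := pw_gt0 l n; rewrite /pw; nia.
Qed.
Lemma pb_pwc k q : pb q -> pb (fun n => pw k (q n)).
Proof. exact: pb_comp (pb_pw k). Qed.
Lemma pb_S q : pb q -> pb (fun n => (q n).+1).
Proof. by move=> h; apply: (pb_le (pb_add h (pb_const 1))) => n; lia. Qed.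
Lemma pb_exp p k : pb p -> pb (fun n => p n ^ k).
Proof. by move=> h; apply: (pb_le (pb_pwc k h)) => n; case: k => // k; rewrite /pw leq_exp2r // leq_addr. Qed.
Lemma pb_poly p : pb p -> exists e, forall n, p n <= n ^ e + e.
Proof.
(* For [n >= 2] the bound follows from [n + 2 <= n ^ 2], whence the exponent [2 * k]; the summand
   [3 ^ k] takes care of [n <= 1]. *)
case=> k h; exists (2 * k + 3 ^ k) => n; apply: leq_trans (h n) _.
have k3 : 0 < 3 ^ k by rewrite expn_gt0.
have [n2|n1] := leqP 2 n; last first.
  apply: leq_trans (_ : 3 ^ k <= _); last lia.
  by rewrite /pw; case: k {h k3} => // k; rewrite leq_exp2r //; lia.
apply: leq_trans (_ : n ^ (2 * k) <= _).
  by rewrite expnM /pw; case: k {h k3} => // k; rewrite leq_exp2r //; nia.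
by apply: leq_trans (leq_addr _ _); rewrite leq_pexp2l; lia.
Qed.
Lemma poly_pb e : pb (fun n => n ^ e + e).
Proof. exact: pb_add (pb_exp _ pb_id) (pb_const _). Qed.

Ltac pbt := solve [repeat first [ exact: pb_id | exact: pb_const | exact: pb_pw | assumption
  | simple apply pb_S | simple apply pb_add
  | simple apply pb_mul | simple apply pb_pwc | simple apply pb_exp]].

(** * Data types and their tree codes *)

Structure encType := EncType { sort :> Type; enc : sort -> tree }.

(** Unary, and the same tree as a list of [n] units, so that loops over numbers are loops over
    lists. Time bounds are polynomial in the value of a number; binary numbers travel as lists of
    booleans. *)
Definition enc_nat n := iter n (Node Leaf) Leaf.
Canonical nat_enc := EncType enc_nat.
Canonical bool_enc := EncType (fun b : bool => if b then Node Leaf Leaf else Leaf).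
Canonical unit_enc := EncType (fun _ : unit => Leaf).
Canonical prod_enc (E F : encType) :=
  EncType (fun p : E * F => Node (enc p.1) (enc p.2)).
Fixpoint enc_list (E : encType) (s : seq E) : tree :=
  if s is x :: s then Node (enc x) (enc_list s) else Leaf.
Canonical seq_enc (E : encType) := EncType (@enc_list E).

Definition code (E : encType) (a : E) := tcode (enc a).
Definition sz (E : encType) (a : E) := size (code a).

Lemma sz_gt0 (E : encType) (a : E) : 0 < sz a.
Proof. by rewrite /sz /code; case: enc. Qed.
Lemma code_pair (E F : encType) (a : E) (b : F) :
  code (a, b) = true :: code a ++ code b.
Proof. by []. Qed.
Lemma code_cons (E : encType) (a : E) s : code (a :: s) = true :: code a ++ code s.
Proof. by []. Qed.
Lemma sz_pair (E F : encType) (a : E) (b : F) : sz (a, b) = (sz a + sz b).+1.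
Proof. by rewrite /sz code_pair /= size_cat. Qed.
Lemma sz_cons (E : encType) (a : E) s : sz (a :: s) = (sz a + sz s).+1.
Proof. by rewrite /sz code_cons /= size_cat. Qed.
Lemma sz_nil (E : encType) : sz ([::] : seq E) = 1. Proof. by []. Qed.
Lemma sz_fst (E F : encType) (p : E * F) : sz p.1 < sz p.
Proof. by case: p => a b; rewrite sz_pair /=; lia. Qed.
Lemma sz_nat n : sz n = 2 * n + 1.
Proof. by elim: n => // n IH; have -> : sz n.+1 = (sz n).+2 by []; lia. Qed.
Lemma sz_bool (b : bool) : sz b <= 3. Proof. by case: b. Qed.
Lemma sz_cat (E : encType) (s1 s2 : seq E) : sz (s1 ++ s2) + 1 = sz s1 + sz s2.
Proof.
elim: s1 => [|x s IH]; first by rewrite cat0s sz_nil addnC.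
by rewrite cat_cons !sz_cons; lia.
Qed.
Lemma sz_rcons (E : encType) (s : seq E) x : sz (rcons s x) = sz s + sz x + 1.
Proof. by have := sz_cat s [:: x]; rewrite cats1 sz_cons sz_nil; lia. Qed.
Lemma size_sz (E : encType) (s : seq E) : 2 * size s < sz s.
Proof. by elim: s => //= x s; rewrite sz_cons; have := sz_gt0 x; lia. Qed.
Lemma sz_seq (E : encType) (s : seq E) m : (forall x, List.In x s -> sz x <= m) ->
  sz s <= size s * m.+1 + 1.
Proof.
elim: s => //= x s IH H; rewrite sz_cons.
have := H x (or_introl erefl); have := IH (fun y h => H y (or_intror h)); lia.
Qed.

(** Each step pushes at most one symbol; a query may add one symbol to an empty register. *)
Lemma exec_size O c s s' t : exec O c s s' t -> forall i, size (s' i) <= size (s i) + t.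
Proof.
elim=> {c s s' t} //=; rewrite /update.
- by move=> *; lia.
- by move=> s i b j; case: eqP => [->|_] /=; lia.
- by move=> s i j; case: eqP => [->|_] /=; rewrite ?size_behead; lia.
- by move=> s i _ j; case: eqP => [->|_] /=; lia.
- by move=> s i _ j; case: eqP => [->|_] /=; lia.
- by move=> c1 c2 s s1 s2 t1 t2 _ h1 _ h2 j; have := h1 j; have := h2 j; lia.
- by move=> i c0 cF cT s s1 t _ h j; have := h j; lia.
- by move=> i c s _ j; lia.
- by move=> i c s s1 s2 t1 t2 _ _ h1 _ h2 j; have := h1 j; have := h2 j; lia.
Qed.

(** * The calculus of polynomial-time functions *)

Section PT.
Variable O : language.

(* The argument is on top of the stack held in register 0; what lies below is untouched, so programs compose without any allocation of registers. *)
Definition pt (E F : encType) (f : E -> F) := exists c k, forall (a : E) rest,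
  runs O c (st (code a ++ rest)) (st (code (f a) ++ rest)) (pw k (sz a)).

Lemma pt_mk (E F : encType) (f : E -> F) c p : pb p -> (forall (a : E) rest,
  runs O c (st (code a ++ rest)) (st (code (f a) ++ rest)) (p (sz a))) -> pt f.
Proof. by case=> k hk h; exists c, k => a r; apply: runs_le (h a r) (hk _). Qed.

(** The running time bounds the growth of the stack, hence the size of the result. Without this,
    time bounds would not compose. *)
Lemma pt_sz (E F : encType) (f : E -> F) : pt f ->
  exists2 k, True & forall a, sz (f a) <= pw k (sz a).
Proof.
case=> c [k h].
have [k' h'] : pb (fun n => n + pw k n) by pbt.
exists k' => // a; apply: leq_trans (h' _).
have [t /exec_size/(_ 0) /= e l] := h a [::].
by move: e; rewrite !cats0 -/(sz a) -/(sz (f a)) => e; apply: leq_trans e _; rewrite leq_add2l.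
Qed.

Lemma pt_ext (E F : encType) (f g : E -> F) : (forall a, f a = g a) -> pt f -> pt g.
Proof. by move=> e [c [k h]]; exists c, k => a r; rewrite -e. Qed.

Lemma pt_id (E : encType) : pt (fun e : E => e).
Proof. by apply: (pt_mk (c := Skip) (pb_const 1)) => a r; apply: runs_skip. Qed.

(** A mere change of type costs nothing: the machine does nothing at all. *)
Lemma pt_cast (E F : encType) (f : E -> F) : (forall a, enc (f a) = enc a) -> pt f.
Proof.
move=> h; apply: (pt_mk (c := Skip) (pb_const 1)) => a r.
by rewrite /code h; apply: runs_skip.
Qed.

Lemma pt_comp (E F G : encType) (f : E -> F) (g : F -> G) :
  pt f -> pt g -> pt (fun e => g (f e)).
Proof.
move=> hf; have [l _ hl] := pt_sz hf; case: hf => c [k h] [c' [k' h']].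
apply: (pt_mk (c := Seq c c') (p := fun n => pw k n + pw k' (pw l n))); first by pbt.
move=> a r; apply: runs_seq (h _ _) _.
exact: runs_le (h' _ _) (pw_mono _ (hl _)).
Qed.

Fixpoint pushes (w : bits) :=
  if w is b :: w then Seq (pushes w) (Push 0 b) else Skip.
Lemma runs_pushes w r : runs O (pushes w) (st r) (st (w ++ r)) (size w + 1).
Proof.
elim: w => [|b w IH]; first exact: runs_skip.
apply: (@runs_le _ _ _ _ ((size w + 1) + 1)); last by rewrite /=; lia.
by apply: runs_seq; [exact: IH | apply: runs_eq; [exact: runs_push | rewrite updx0]].
Qed.

Lemma runs_push0 b r : runs O (Push 0 b) (st r) (st (b :: r)) 1.
Proof. by apply: runs_eq; [exact: runs_push | rewrite updx0]. Qed.
Lemma runs_pop0 b r : runs O (Pop 0) (st (b :: r)) (st r) 1.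
Proof. by apply: runs_eq; [exact: runs_pop | rewrite updx0]. Qed.

Lemma pt_const (E F : encType) (b : F) : pt (fun _ : E => b).
Proof.
apply: (pt_mk (c := Seq drop_top (pushes (code b)))
  (p := fun n => 9 * n + 3 + (sz b + 1))); first by pbt.
by move=> a r; apply: runs_seq; [exact: runs_drop | exact: runs_pushes].
Qed.

(** The argument is duplicated, [g] runs on the upper copy, the two codes are swapped, and [f] runs
    on the other copy; the node symbol in front then turns the two codes into that of a pair. *)
Lemma pt_pair (E F G : encType) (f : E -> F) (g : E -> G) :
  pt f -> pt g -> pt (fun e => (f e, g e)).
Proof.
move=> [c [k h]] hg; have [l _ hl] := pt_sz hg; case: hg => c' [k' h'].
apply: (pt_mk (c := seqs [:: dup_top; c'; swap_top; c; Push 0 true])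
  (p := fun n => (30 * n + 10) + (pw k' n + ((20 * (pw l n + n) + 10)
      + (pw k n + 1))))); first by pbt.
move=> a r; rewrite code_pair.
apply: runs_seq; first exact: runs_dup.
apply: runs_seq; first exact: h'.
apply: runs_seq; first by apply: runs_le; [exact: runs_swap | rewrite leq_add2r leq_mul2l /= leq_add2r hl].
apply: runs_seq; first exact: h.
by rewrite cat_cons -catA; apply: runs_push0.
Qed.

Lemma pt_fst0 (E F : encType) : pt (fun p : E * F => p.1).
Proof.
apply: (pt_mk (c := seqs [:: Pop 0; swap_top; drop_top])
  (p := fun n => 1 + ((20 * n + 10) + (9 * n + 3)))); first by pbt.
move=> [a b] r; rewrite code_pair sz_pair cat_cons -catA.
apply: runs_seq; first exact: runs_pop0.
apply: runs_seq; first by apply: runs_le; [exact: runs_swap | rewrite /sz /code; lia].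
by apply: runs_le; [exact: runs_drop | rewrite /sz /code; lia].
Qed.
Lemma pt_snd0 (E F : encType) : pt (fun p : E * F => p.2).
Proof.
apply: (pt_mk (c := seqs [:: Pop 0; drop_top])
  (p := fun n => 1 + (9 * n + 3))); first by pbt.
move=> [a b] r; rewrite code_pair sz_pair cat_cons -catA.
apply: runs_seq; first exact: runs_pop0.
by apply: runs_le; [exact: runs_drop | rewrite /sz /code; lia].
Qed.
Lemma pt_fst (G E F : encType) (g : G -> E * F) : pt g -> pt (fun e => (g e).1).
Proof. by move=> h; apply: pt_comp h (pt_fst0 _ _). Qed.
Lemma pt_snd (G E F : encType) (g : G -> E * F) : pt g -> pt (fun e => (g e).2).
Proof. by move=> h; apply: pt_comp h (pt_snd0 _ _). Qed.

Lemma pt_comp2 (E A B C : encType) (f : A -> B -> C) (g : E -> A) (h : E -> B) :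
  pt (fun p : A * B => f p.1 p.2) -> pt g -> pt h -> pt (fun e => f (g e) (h e)).
Proof. by move=> hf hg hh; apply: (pt_comp (pt_pair hg hh) hf). Qed.
Lemma pt_comp3 (E A B C D : encType) (f : A -> B -> C -> D) (g : E -> A) (h : E -> B) (i : E -> C) :
  pt (fun p : A * (B * C) => f p.1 p.2.1 p.2.2) -> pt g -> pt h -> pt i ->
  pt (fun e => f (g e) (h e) (i e)).
Proof. by move=> hf hg hh hi; apply: (pt_comp (pt_pair hg (pt_pair hh hi)) hf). Qed.
(* A nonempty list has the code of the pair of its head and tail. *)
Lemma pt_case0 (E X F : encType) (f0 : E -> F) (f1 : E -> X -> seq X -> F) :
  pt f0 -> pt (fun q : E * (X * seq X) => f1 q.1 q.2.1 q.2.2) ->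
  pt (fun p : seq X * E => match p.1 with [::] => f0 p.2 | x :: s => f1 p.2 x s end).
Proof.
move=> [c [k h]] [c' [k' h']].
apply: (pt_mk (c := Seq (Pop 0) (Case 0 Skip (Seq (Pop 0) c)
   (seqs [:: swap_top; Push 0 true; c'])))
  (p := fun n => 1 + ((1 + pw k n) + (20 * n + 10 + (1 + pw k' n))).+1)); first by pbt.
move=> [[|x s] e] r; rewrite code_pair sz_pair cat_cons -catA /=.
  apply: runs_seq; first exact: runs_pop0.
  apply: runs_case; apply: runs_le.
    by apply: runs_seq; [exact: runs_pop0 | exact: h].
  by apply: leq_trans (leq_addr _ _); rewrite leq_add2l pw_mono //; lia.
apply: runs_seq; first exact: runs_pop0.
apply: runs_case; apply: (@runs_le _ _ _ _ (20 * (sz (x :: s) + sz e).+1 + 10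
  + (1 + pw k' (sz (e, (x, s)))))).
  apply: runs_seq; first by apply: runs_le;
    [exact: (runs_swap _ (enc (x :: s)) (enc e)) | rewrite /sz /code; lia].
  apply: runs_seq; first exact: runs_push0.
  by have := h' (e, (x, s)) r; rewrite code_pair cat_cons -catA.
apply: leq_trans (leq_addl _ _); rewrite !leq_add2l pw_mono // !sz_pair !sz_cons; lia.
Qed.

Lemma pt_case (E X F : encType) (l : E -> seq X) (f0 : E -> F) (f1 : E -> X -> seq X -> F) :
  pt l -> pt f0 -> pt (fun q : E * (X * seq X) => f1 q.1 q.2.1 q.2.2) ->
  pt (fun e => match l e with [::] => f0 e | x :: s => f1 e x s end).
Proof.
by move=> hl h0 h1; apply: (pt_comp (pt_pair hl (pt_id E)) (pt_case0 h0 h1)).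
Qed.

Lemma pt_ncase (E F : encType) (l : E -> nat) (f0 : E -> F) (f1 : E -> nat -> F) :
  pt l -> pt f0 -> pt (fun q : E * nat => f1 q.1 q.2) ->
  pt (fun e => match l e with 0 => f0 e | n.+1 => f1 e n end).
Proof.
move=> hl h0 h1.
have hu : pt (fun e => nseq (l e) tt).
  by apply: pt_comp hl (pt_cast _) => n; elim: n => //= n ->.
have hs : pt (fun s : seq unit => size s) by apply: pt_cast; elim=> //= x s ->; case: x.
have h1' : pt (fun q : E * (unit * seq unit) => f1 q.1 (size q.2.2)).
  apply: (pt_comp (f := fun q : E * (unit * seq unit) => (q.1, size q.2.2)) _ h1).
  apply: pt_pair; first exact: pt_fst0.
  exact: pt_comp (pt_snd (pt_snd0 _ _)) hs.
apply: pt_ext (pt_case (f1 := fun e _ s => f1 e (size s)) hu h0 h1') => e.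
by case: (l e) => //= n; rewrite size_nseq.
Qed.

Lemma pt_if (E F : encType) (b : E -> bool) (f g : E -> F) :
  pt b -> pt f -> pt g -> pt (fun e => if b e then f e else g e).
Proof.
move=> hb hf hg.
have hu : pt (fun e => nseq (b e) tt) by apply: (pt_comp (g := fun b : bool => nseq b tt) hb); apply: pt_cast => -[].
apply: pt_ext (pt_case (f1 := fun e _ _ => f e) hu hg _); first by move=> e; case: (b e).
exact: pt_comp (pt_fst0 _ _) hf.
Qed.

Lemma pt_cons (E X : encType) (f : E -> X) (g : E -> seq X) :
  pt f -> pt g -> pt (fun e => f e :: g e).
Proof.
move=> hf hg; apply: (pt_comp (pt_pair hf hg) (g := fun p => p.1 :: p.2)).
exact: pt_cast.
Qed.

Lemma pt_S (E : encType) (f : E -> nat) : pt f -> pt (fun e => (f e).+1).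
Proof.
move=> hf; apply: (pt_comp (pt_pair (pt_const _ tt) hf) (g := fun p => p.2.+1)).
by apply: pt_cast => -[[] n].
Qed.

(** Repeating a polynomial-time step may square the size of the accumulator every time, which is why
    a common polynomial bound on all intermediate accumulators is required. *)
Lemma pt_foldl (E S X : encType) (step : E -> S -> X -> S) (ini : E -> S) (l : E -> seq X) :
  pt l -> pt ini -> pt (fun q : (E * S) * X => step q.1.1 q.1.2 q.2) ->
  (exists2 p, pb p & forall e k, sz (foldl (step e) (ini e) (take k (l e))) <= p (sz e)) ->
  pt (fun e => foldl (step e) (ini e) (l e)).
Proof.
move=> hl hi hs [p hp hsz].
pose St := prod_enc (seq_enc X) (prod_enc E S).
pose f (s : seq X * (E * S)) : St :=
  match s.1 with [::] => ([::], s.2) | x :: l' => (l', (s.2.1, step s.2.1 s.2.2 x)) end.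
have hf : pt f.
  apply: (@pt_case0 _ _ _ (fun u => ([::], u)) (fun u x l' => (l', (u.1, step u.1 u.2 x)))).
    by apply: pt_pair (pt_const _ _) (pt_id _).
  apply: pt_pair; first by apply: pt_snd (pt_snd (pt_id _)).
  apply: pt_pair; first by apply: pt_fst (pt_fst (pt_id _)).
  apply: (pt_comp (f := fun q : (E * S) * (X * seq X) => (q.1, q.2.1)) _ hs).
  by apply: pt_pair; [apply: pt_fst (pt_id _) | apply: pt_fst (pt_snd (pt_id _))].
have [kl _ hkl] := pt_sz hl.
case: hf => c [k h].
(* Register 1 holds the loop flag, raised again only if the remaining list was nonempty. The pair
   symbol is removed just to look at the first symbol of the list code, and then put back. *)
pose body := seqs [:: Pop 1; Pop 0; Case 0 Skip (Push 0 true)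
   (seqs [:: Push 0 true; c; Push 1 true])].
pose T n := pw k (pw kl n + (n + p n).+1).+1.
have loop : forall e r,
   runs O (While 1 body) (stx (code (l e, (e, ini e)) ++ r) [:: true] [::] [::] nost)
     (st (code ([::] : seq X, (e, foldl (step e) (ini e) (l e))) ++ r))
     (((T (sz e) + 6) * (size (l e)).+1) + 1).
  move=> e r.
  have H m : m <= size (l e) -> runs O (While 1 body)
     (stx (code (drop (size (l e) - m) (l e), (e, foldl (step e) (ini e) (take (size (l e) - m) (l e)))) ++ r) [:: true] [::] [::] nost)
     (st (code ([::] : seq X, (e, foldl (step e) (ini e) (l e))) ++ r))
     (((T (sz e) + 6) * m.+1) + 1).
    elim: m => [|m IH] hm.
      rewrite subn0 drop_size take_size muln1.
      apply: (@runs_le _ _ _ _ (4 + 1).+1); last lia.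
      apply: (@runs_loop _ _ _ _ (st (code ([::] : seq X, (e, foldl (step e) (ini e) (l e))) ++ r)));
        [by [] | | exact: runs_stop].
      apply: (@runs_seq _ _ _ _ _ _ 1 3); first exact: runs_pop.
      rewrite updx /=; apply: (@runs_seq _ _ _ _ _ _ 1 2); first exact: runs_pop0.
      by apply: runs_case; apply: runs_push0.
    have lt : size (l e) - m.+1 < size (l e) by lia.
    have /IH {}IH : m <= size (l e) by lia.
    case: (l e) hm lt IH (hsz e (size (l e) - m.+1)) (hkl e) => [//|x0 l0]; move: (x0 :: l0) => {l0} L hm lt IH hsz' hkl'.
    apply: (@runs_le _ _ _ _ ((T (sz e) + 5) + ((T (sz e) + 6) * m.+1 + 1)).+1); last lia.
    refine (runs_loop _ _ IH) => //.
    rewrite (drop_nth x0 lt).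
    have -> : (size L - m.+1).+1 = size L - m by lia.
    apply: (@runs_le _ _ _ _ (1 + (1 + (1 + (T (sz e) + 1)).+1))); last lia.
    apply: runs_seq; first exact: runs_pop.
    rewrite updx /=; apply: runs_seq; first exact: runs_pop0.
    apply: runs_case => /=.
    apply: runs_seq; first exact: runs_push0.
    set acc := foldl _ _ (take _ _) in hsz' *.
    pose s0 : seq X * (E * S) := (nth x0 L (size L - m.+1) :: drop (size L - m) L, (e, acc)).
    apply: (@runs_seq _ _ _ _ (st (code (f s0) ++ r))).
      apply: runs_le (h s0 r) _; apply: pw_mono; rewrite !sz_pair.
      apply: leq_trans (_ : sz (drop (size L - m.+1) L) + (sz e + sz acc).+1 < _).
        by rewrite (drop_nth x0 lt); have -> : (size L - m.+1).+1 = size L - m by lia.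
      rewrite ltnS; apply: leq_add; last by rewrite ltnS leq_add2l.
      apply: leq_trans hkl'.
      by have := sz_cat (take (size L - m.+1) L) (drop (size L - m.+1) L); rewrite cat_take_drop; have := sz_gt0 (take (size L - m.+1) L); lia.
    apply: runs_eq; first exact: runs_push.
    rewrite updx /f /s0 /=; do 3 f_equal.
    have -> : size L - m = (size L - m.+1).+1 by lia.
    by rewrite (take_nth x0 lt) -cats1 foldl_cat.
  by have := H (size (l e)) (leqnn _); rewrite subnn drop0 take0.
have hstate : pt (fun e => (l e, (e, ini e))) by apply: pt_pair hl (pt_pair (pt_id _) hi).
suff hloop : pt (fun e => ([::] : seq X, (e, foldl (step e) (ini e) (l e)))).
  exact: pt_snd (pt_snd hloop).
case: hstate => c1 [k1 h1].
apply: (pt_mk (c := Seq c1 (Seq (Push 1 true) (While 1 body)))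
  (p := fun n => pw k1 n + (1 + ((T n + 6) * (pw kl n).+1 + 1)))).
  by rewrite /T; pbt.
move=> e r; apply: runs_seq (h1 e r) _.
apply: runs_seq; first by apply: runs_eq; [exact: runs_push | rewrite updx].
apply: runs_le (loop e r) _.
rewrite leq_add2r leq_mul2l ltnS; apply/orP; right.
by have := size_sz (l e); have := hkl e; lia.
Qed.

End PT.

(** * Calling given machines from the calculus, and exporting from it *)

Fixpoint shift (c : cmd) : cmd :=
  match c with
  | Skip => Skip
  | Push i b => Push i.+4 b
  | Pop i => Pop i.+4
  | Query i => Query i.+4
  | Seq c1 c2 => Seq (shift c1) (shift c2)
  | Case i c0 c1 c2 => Case i.+4 (shift c0) (shift c1) (shift c2)
  | While i c => While i.+4 (shift c)
  end.

Fixpoint bound_reg (c : cmd) : nat :=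
  match c with
  | Skip => 0
  | Push i _ | Pop i | Query i => i.+1
  | Seq c1 c2 => maxn (bound_reg c1) (bound_reg c2)
  | Case i c0 c1 c2 => maxn i.+1 (maxn (bound_reg c0) (maxn (bound_reg c1) (bound_reg c2)))
  | While i c => maxn i.+1 (bound_reg c)
  end.

(** Registers 0 to 3 belong to the calculus (the stack and scratch space); a given machine is run in
    the registers from 4 on. *)
Lemma exec_shift O c s s' t a b p q : exec O c s s' t ->
  exec O (shift c) (stx a b p q s) (stx a b p q s') t.
Proof.
elim=> {c s s' t} /=; rewrite -?updx4.
- by move=> *; constructor.
- by move=> s i b0; rewrite -updx4; apply: ExecPush.
- by move=> s i; rewrite -updx4; apply: ExecPop.
- by move=> s i h; rewrite -updx4; apply: ExecQueryYes.
- by move=> s i h; rewrite -updx4; apply: ExecQueryNo.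
- by move=> *; apply: ExecSeq; eauto.
- move=> i c0 cF cT s s1 t _ IH; apply: ExecCase => /=.
  by case: (s i) IH => // -[].
- by move=> i c s h; apply: ExecWhileStop.
- by move=> i c s s1 s2 t1 t2 h _ IH1 _ IH2; apply: ExecWhileStep IH1 IH2.
Qed.

(** Only finitely many registers can be dirty after a call, so they can all be cleared by a fixed
    command. *)
Lemma exec_frame O c s s' t : exec O c s s' t ->
  forall j, bound_reg c <= j -> s' j = s j.
Proof.
elim=> {c s s' t} //=; rewrite /update.
- by move=> s i b j h; case: eqP => // e; lia.
- by move=> s i j h; case: eqP => // e; lia.
- by move=> s i _ j h; case: eqP => // e; lia.
- by move=> s i _ j h; case: eqP => // e; lia.
- by move=> c1 c2 s s1 s2 t1 t2 _ h1 _ h2 j h; rewrite h2 ?h1 //; lia.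
- move=> i c0 cF cT s s1 t _ IH j h; apply: IH.
  by case: (s i) => [|[] _]; lia.
- by move=> i c s s1 s2 t1 t2 _ _ h1 _ h2 j h; rewrite h2 // h1 //; lia.
Qed.

Lemma size_bits (l : bits) : size l <= sz l.
Proof. by have h : 2 * size l < sz l := size_sz l; lia. Qed.

Section Conversions.
Variable O : language.

(** Inside a list code the booleans [false] and [true] are the trees [Leaf] and [Node Leaf Leaf],
    that is, one and three symbols. They are replaced by single bits, in reverse order in register
    1. *)
Definition to_raw := Seq (Push 2 true) (While 2 (seqs [:: Pop 2;
  Case 0 Skip (Pop 0) (seqs [:: Pop 0;
    Case 0 Skip (seqs [:: Pop 0; Push 1 false])
      (seqs [:: Pop 0; Pop 0; Pop 0; Push 1 true]);
    Push 2 true])])).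

Lemma runs_to_raw (l : bits) r w d s :
  runs O to_raw (stx (code l ++ r) w [::] d s) (stx r (catrev l w) [::] d s)
    (10 * size l + 10).
Proof.
apply: (@runs_le _ _ _ _ (1 + (10 * size l + 5))); last lia.
apply: runs_seq; first exact: runs_push.
rewrite updx; elim: l w => [|b l IH] w.
  apply: (@runs_le _ _ _ _ (3 + 1).+1); last by [].
  refine (runs_loop _ _ (runs_stop _ _ _)) => //.
  apply: (@runs_seq _ _ _ _ _ _ 1 2); first exact: runs_pop.
  rewrite updx /=; apply: runs_case; apply: runs_eq; first exact: runs_pop.
  by rewrite updx.
apply: (@runs_le _ _ _ _ (9 + (10 * size l + 5)).+1); last by rewrite /=; lia.
refine (runs_loop _ _ (IH _)) => //.
apply: (@runs_seq _ _ _ _ _ _ 1 8); first exact: runs_pop.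
rewrite updx /=; apply: runs_case => /=.
apply: (@runs_seq _ _ _ _ _ _ 1 6); first exact: runs_pop.
rewrite updx /= -catA; case: b => /=.
- apply: (@runs_seq _ _ _ _ _ _ 5 1).
    apply: runs_case => /=.
    do 3 (apply: (@runs_seq _ _ _ _ _ _ 1 _); [exact: runs_pop| rewrite updx /=]).
    exact: runs_push.
  by rewrite !updx; apply: runs_eq; [exact: runs_push | rewrite !updx].
- apply: (@runs_seq _ _ _ _ _ _ 3 3).
    apply: runs_case => /=.
    apply: (@runs_seq _ _ _ _ _ _ 1 _); [exact: runs_pop| rewrite updx /=].
    exact: runs_push.
  rewrite !updx; apply: (@runs_le _ _ _ _ 1) => //.
  by apply: runs_eq; [exact: runs_push | rewrite !updx].
Qed.

Definition from_raw i := Seq (Push 0 false) (While i (Case i Skip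
  (seqs [:: Pop i; Push 0 false; Push 0 true])
  (seqs [:: Pop i; Push 0 false; Push 0 false; Push 0 true; Push 0 true]))).

Lemma runs_from_raw i s s' (l : bits) : i <> 0 -> s i = rev l ->
  s' = update (update s i [::]) 0 (code l ++ s 0) ->
  runs O (from_raw i) s s' (10 * size l + 5).
Proof.
move=> i0 h ->; apply: (@runs_le _ _ _ _ (1 + (10 * size l + 1))); last lia.
apply: runs_seq; first exact: runs_push.
set W := While _ _.
have H : forall w l' s1, s1 i = rev w ->
   runs O W (update s1 0 (code l' ++ s 0))
     (update (update s1 i [::]) 0 (code (w ++ l') ++ s 0)) (10 * size w + 1).
  elim/last_ind => [|w b IH] l' s1 e.
    have -> : update s1 i [::] = s1 by have <- : s1 i = [::] := e; rewrite upd_id.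
    apply: runs_stop.
    by rewrite /update; move/eqP: i0 => /negbTE ->.
  rewrite size_rcons; apply: (@runs_le _ _ _ _ (6 + (10 * size w + 1)).+1); last lia.
  rewrite rev_rcons in e.
  have ei x : update s1 0 x i = b :: rev w.
    by rewrite /update; move/eqP: i0 => /negbTE ->.
  have /IH H : update s1 i (rev w) i = rev w by rewrite /update eqxx.
  have -> : update s1 i [::] = update (update s1 i (rev w)) i [::].
    by apply: functional_extensionality => j; rewrite /update; case: eqP.
  rewrite cat_rcons; refine (runs_loop _ _ (H (b :: l'))); first by rewrite ei.
  apply: runs_case; rewrite ei.
  have comm x y : update (update s1 0 x) i y = update (update s1 i y) 0 x.
    apply: functional_extensionality => j; rewrite /update.
    by case: eqP => // ->; move/eqP: i0 => /negbTE ->.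
  have upp s2 x y : update (update s2 0 x) 0 y = update s2 0 y.
    by apply: functional_extensionality => j; rewrite /update; case: eqP.
  have u0 s2 x : update s2 0 x 0 = x by [].
  case: b {e H} ei => ei; apply: (@runs_seq _ _ _ _ _ _ 1 4); try exact: runs_pop;
    rewrite ei /= comm.
  - apply: runs_eq; first by do 3 (apply: (@runs_seq _ _ _ _ _ _ 1 _); first exact: runs_push);
      exact: runs_push.
    by rewrite !(upp, u0).
  - apply: (@runs_le _ _ _ _ 2) => //.
    apply: runs_eq; first by apply: (@runs_seq _ _ _ _ _ _ 1 _); first exact: runs_push;
      exact: runs_push.
    by rewrite !(upp, u0).
by have := H l [::] s h; rewrite cats0.
Qed.

Definition clear_regs R :=
  foldr (fun j c => Seq (While j.+4 (Pop j.+4)) c) Skip (iota 0 R).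

Lemma runs_clear_iota w m js s : (forall j, size (s j) <= m) ->
  runs O (foldr (fun j c => Seq (While j.+4 (Pop j.+4)) c) Skip js)
    (stx w [::] [::] [::] s)
    (stx w [::] [::] [::] (fun j => if j \in js then [::] else s j))
    ((2 * m + 1) * size js + 1).
Proof.
elim: js s => [|j js IH] s hm /=.
  by rewrite muln0; apply: runs_eq (runs_skip _ _) _; f_equal; apply: functional_extensionality.
apply: (@runs_le _ _ _ _ ((2 * m + 1) + ((2 * m + 1) * size js + 1))); last lia.
apply: runs_seq.
  by apply: runs_le; [exact: runs_clear | rewrite leq_add2r leq_mul2l /= hm].
rewrite updx; apply: runs_eq.
  by apply: IH => k; rewrite /update; case: eqP.
f_equal; apply: functional_extensionality => k; rewrite inE /update.
by case: (k == j); case: (k \in js).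
Qed.

Definition call_cost R m t := t + (14 * (m + t) + 6 + ((2 * (m + t) + 1) * R + 1)).
Lemma call_cost_mono R m t t' : t <= t' -> call_cost R m t <= call_cost R m t'.
Proof. by move=> h; rewrite /call_cost; nia. Qed.

(** The result of the shifted machine lies in register 4. It is re-encoded on the stack, and every
    register that may have been touched is emptied so that later calls start from a clean store. *)
Lemma runs_call c s s' t r R m : exec O c s s' t ->
  bound_reg c <= R -> (forall j, R <= j -> s j = [::]) ->
  (forall j, size (s j) <= m) ->
  runs O (seqs [:: shift c; move 4 1; from_raw 1; clear_regs R])
    (stx r [::] [::] [::] s) (st (code (s' 0) ++ r))
    (call_cost R m t).
Proof.
move=> h hc hR hm.
rewrite /call_cost; have hs j : size (s' j) <= m + t.
  by apply: leq_trans (exec_size h j) _; rewrite leq_add2r.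
apply: (@runs_le _ _ _ _ (t + ((4 * (m + t) + 1) + ((10 * (m + t) + 5) + ((2 * (m + t) + 1) * R + 1))))); last lia.
apply: runs_seq; first by exists t; [exact: exec_shift h|].
apply: runs_seq; first by apply: runs_moveE; [by []|rewrite !updx|rewrite /= leq_add2r leq_mul2l /= hs].
rewrite /= catrevE cats0; apply: runs_seq.
  apply: runs_le; first by apply: (@runs_from_raw _ _ _ (s' 0)); [| |rewrite !updx].
  by rewrite leq_add2r leq_mul2l /= hs.
rewrite /=; apply: runs_eq.
  apply: runs_le; first apply: runs_clear_iota (m + t) (iota 0 R) _ _.
    by move=> j; rewrite /update; case: eqP.
  by rewrite size_iota.
f_equal; apply: functional_extensionality => j; rewrite mem_iota /= add0n.
case: ltnP => // Rj; rewrite /update; case: eqP => // _.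
by rewrite (exec_frame h) ?hR //; apply: leq_trans hc Rj.
Qed.

Lemma pt_import1 f : polytime_oracle O 1 f -> pt O (fun x : bits => f [:: x]).
Proof.
case=> c [e H]; pose R := (bound_reg c).+2.
pose q n := n ^ e + e; have hq : pb q by apply: poly_pb.
have qm m n : m <= n -> q m <= q n.
  by move=> h; rewrite /q leq_add2r; case: (e) => // e'; rewrite leq_exp2r.
set b := call_cost R.
apply: (pt_mk (c := seqs [:: to_raw; move 1 4;
    seqs [:: shift c; move 4 1; from_raw 1; clear_regs R]])
  (p := fun n => (10 * n + 10) + ((4 * n + 1) + b n (q n)))).
  by case: hq => k hq; apply: (pb_le (q := fun n => (10 * n + 10) + ((4 * n + 1) + b n (pw k n))));
    [rewrite /b /call_cost; pbt | move=> n; rewrite !leq_add2l; apply: call_cost_mono].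
move=> x r; have hx : @size bool x <= sz x := size_bits x.
have [s [t [h h0 ht]]] := H [:: x] erefl.
apply: runs_seq; first by apply: runs_le; [exact: runs_to_raw | lia].
apply: runs_seq; first apply: runs_moveE => //; rewrite ?updx //=.
  by rewrite catrevE cats0 size_rev; lia.
rewrite /= !catrevE !cats0 revK.
have -> : update nost 0 x = nth [::] [:: x].
  by apply: functional_extensionality => -[|j] //; rewrite /= nth_nil.
rewrite -h0; apply: runs_le; first apply: (runs_call (R := R) (m := sz x) r h).
- by rewrite /R; lia.
- by move=> -[|j] //= _; rewrite nth_nil.
- by move=> -[|j] //=; rewrite nth_nil.
have : t <= q (sz x).
  by apply: leq_trans ht _; rewrite /= cats0; apply: qm.
exact: call_cost_mono.
Qed.

Lemma pt_import2 f : polytime_oracle O 2 f ->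
  pt O (fun p : bits * bits => f [:: p.1; p.2]).
Proof.
(* The two extra registers make sure that the argument registers are cleared even if the machine
   does not mention them. *)
case=> c [e H]; pose R := (bound_reg c).+2.
pose q n := n ^ e + e; have hq : pb q by apply: poly_pb.
have qm m n : m <= n -> q m <= q n.
  by move=> h; rewrite /q leq_add2r; case: (e) => // e'; rewrite leq_exp2r.
set b := call_cost R.
apply: (pt_mk (c := seqs [:: Pop 0; to_raw; move 1 4; to_raw; move 1 5;
    seqs [:: shift c; move 4 1; from_raw 1; clear_regs R]])
  (p := fun n => 1 + ((10 * n + 10) + ((4 * n + 1) + ((10 * n + 10) + ((4 * n + 1) +
          b n (q n))))))).
  by case: hq => k hq; apply: (pb_le (q := fun n => 1 + ((10 * n + 10) + ((4 * n + 1)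
    + ((10 * n + 10) + ((4 * n + 1) + b n (pw k n)))))));
    [rewrite /b /call_cost; pbt | move=> n; rewrite !leq_add2l; apply: call_cost_mono].
move=> [x y] r; have hx : @size bool x <= sz x := size_bits x.
have hy : @size bool y <= sz y := size_bits y.
rewrite sz_pair; set m := (sz x + sz y).+1.
have [s [t [h h0 ht]]] := H [:: x; y] erefl.
apply: runs_seq; first exact: runs_pop.
rewrite updx /= -catA.
apply: runs_seq; first by apply: runs_le; [exact: (runs_to_raw x) | rewrite /m; lia].
apply: runs_seq; first apply: runs_moveE => //; rewrite ?updx //=.
  by rewrite catrevE cats0 size_rev /m; lia.
rewrite /= !catrevE !cats0 revK.
apply: runs_seq; first by apply: runs_le; [exact: (runs_to_raw y) | rewrite /m; lia].
apply: runs_seq; first apply: runs_moveE => //; rewrite ?updx //=.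
  by rewrite catrevE cats0 size_rev /m; lia.
rewrite /= !catrevE !cats0 revK.
have -> : update (update nost 0 x) 1 y = nth [::] [:: x; y].
  by apply: functional_extensionality => -[|[|j]] //; rewrite /= nth_nil.
rewrite -h0; apply: runs_le; first apply: (runs_call (R := R) (m := m) r h).
- by rewrite /R; lia.
- by move=> -[|[|j]] //= _; rewrite nth_nil.
- by move=> -[|[|j]] //=; rewrite ?nth_nil //; rewrite /m; lia.
have : t <= q m.
  by apply: leq_trans ht _; apply: qm; rewrite /= cats0 size_cat /m; lia.
exact: call_cost_mono.
Qed.

Lemma sz_bits (l : bits) : sz l <= 4 * size l + 1.
Proof. by elim: l => // b l; rewrite sz_cons /=; have := sz_bool b; lia. Qed.

Lemma pt_export1 (f : bits -> bits) : pt O f ->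
  polytime_oracle O 1 (fun xs => f (nth [::] xs 0)).
Proof.
move=> hf; have [l _ hl] := pt_sz hf; case: hf => c [k h].
pose p n := (4 * n + 1) + ((10 * n + 5) + (pw k (4 * n + 1) + ((10 * pw l (4 * n + 1) + 10) + (4 * pw l (4 * n + 1) + 1)))).
have [e he] : exists e, forall n, p n <= n ^ e + e by apply: pb_poly; rewrite /p; pbt.
exists (seqs [:: move 0 1; from_raw 1; c; to_raw; move 1 0]), e => -[|x []] //= _.
rewrite cats0.
suff [t h1 ht] : runs O (seqs [:: move 0 1; from_raw 1; c; to_raw; move 1 0])
    (nth [::] [:: x]) (st (f x)) (p (size x)).
  by exists (st (f x)), t; split=> //; apply: leq_trans ht (he _).
have -> : nth [::] [:: x] = st x.
  by apply: functional_extensionality => -[|[|[|[|j]]]] //=; rewrite nth_nil.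
apply: runs_seq; first by apply: runs_moveE; [by []|rewrite !updx|].
rewrite /= catrevE cats0.
apply: runs_seq; first by apply: (@runs_from_raw _ _ _ x); [| |rewrite !updx].
rewrite /=; apply: runs_seq; first by apply: runs_le (h x _) _; apply: pw_mono; apply: sz_bits.
have hfx : size (f x) <= pw l (4 * size x + 1).
  apply: leq_trans (_ : sz (f x) <= _); first exact: size_bits.
  by apply: leq_trans (hl _) (pw_mono _ (sz_bits _)).
apply: runs_seq; first by apply: runs_le; [exact: runs_to_raw| lia].
apply: runs_moveE; [by []|rewrite !updx|rewrite /= catrevE cats0 size_rev; lia].
by rewrite /= !catrevE !cats0 revK.
Qed.

Lemma pt_export2 (f : bits * bits -> bits) : pt O f ->
  polytime_oracle O 2 (fun xs => f (nth [::] xs 0, nth [::] xs 1)).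
Proof.
move=> hf; have [l _ hl] := pt_sz hf; case: hf => c [k h].
pose p n := (4 * n + 1) + ((4 * n + 1) + ((10 * n + 5) + ((10 * n + 5) + (1 + (pw k (4 * n + 3) + ((10 * pw l (4 * n + 3) + 10) + (4 * pw l (4 * n + 3) + 1))))))).
have [e he] : exists e, forall n, p n <= n ^ e + e by apply: pb_poly; rewrite /p; pbt.
pose prg := seqs [:: move 0 2; move 1 3; from_raw 3; from_raw 2; Push 0 true; c; to_raw; move 1 0].
exists prg, e => -[|x [|y []]] //= _.
rewrite cats0 size_cat.
suff [t h1 ht] : runs O prg (nth [::] [:: x; y]) (st (f (x, y))) (p (size x + size y)).
  by exists (st (f (x, y))), t; split=> //; apply: leq_trans ht (he _).
have -> : nth [::] [:: x; y] = stx x y [::] [::] nost.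
  by apply: functional_extensionality => -[|[|[|[|j]]]] //=; rewrite nth_nil.
apply: runs_seq; first by apply: runs_moveE; [by []|rewrite !updx|rewrite /=; lia].
apply: runs_seq; first by apply: runs_moveE; [by []|rewrite !updx|rewrite /=; lia].
rewrite /= !catrevE !cats0.
apply: runs_seq; first by apply: (@runs_le _ _ _ _ (10 * size y + 5)); [apply: (@runs_from_raw _ _ _ y); [| |rewrite !updx]|lia].
apply: runs_seq; first by apply: (@runs_le _ _ _ _ (10 * size x + 5)); [apply: (@runs_from_raw _ _ _ x); [| |rewrite !updx]|lia].
rewrite /=; apply: runs_seq; first exact: runs_push.
have hxy : sz (x, y) <= 4 * (size x + size y) + 3.
  by rewrite sz_pair; have := sz_bits x; have := sz_bits y; lia.
rewrite updx /=; apply: runs_seq.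
  by have := h (x, y) [::]; rewrite code_pair cat_cons -catA => hh; apply: runs_le hh _; apply: pw_mono.
have hfx : size (f (x, y)) <= pw l (4 * (size x + size y) + 3).
  apply: leq_trans (_ : sz (f (x, y)) <= _); first exact: size_bits.
  by apply: leq_trans (hl _) (pw_mono _ hxy).
apply: runs_seq; first by apply: runs_le; [exact: runs_to_raw| lia].
apply: runs_moveE; [by []|rewrite !updx|rewrite /= catrevE cats0 size_rev; lia].
by rewrite /= !catrevE !cats0 revK.
Qed.

(** Classical decision of the oracle as a boolean, so that functions with oracle access can be
    written as ordinary functions. *)
Definition ask (w : bits) : bool := excluded_middle_informative (O w).
Lemma askP w : reflect (O w) (ask w).
Proof. by rewrite /ask; case: excluded_middle_informative => h; constructor. Qed.

Lemma pt_ask : pt O ask.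
Proof.
apply: (pt_mk (c := seqs [:: to_raw; move 1 3; Query 3; Case 3 Skip
    (seqs [:: Pop 3; Push 0 false])
    (seqs [:: Pop 3; Push 0 false; Push 0 false; Push 0 true])])
  (p := fun n => (10 * n + 10) + ((4 * n + 1) + (1 + 5)))); first by pbt.
move=> w r; have hw : @size bool w <= sz w := size_bits w.
apply: runs_seq; first by apply: runs_le; [exact: runs_to_raw | lia].
apply: runs_seq; first by apply: runs_moveE; [by []|rewrite !updx|rewrite /= catrevE cats0 size_rev; lia].
rewrite /= !catrevE !cats0 revK.
case: askP => hO.
  apply: runs_seq; first by exists 1 => //; apply: ExecQueryYes.
  rewrite updx; apply: runs_case => /=.
  apply: runs_eq; first by apply: (@runs_seq _ _ _ _ _ _ 1 3); [exact: runs_pop|];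
    do 2 (apply: (@runs_seq _ _ _ _ _ _ 1 _); first exact: runs_push); exact: runs_push.
  by rewrite !updx.
apply: runs_seq; first by exists 1 => //; apply: ExecQueryNo.
rewrite updx; apply: runs_case => /=; apply: (@runs_le _ _ _ _ 2) => //.
apply: runs_eq; first by apply: (@runs_seq _ _ _ _ _ _ 1 1); [exact: runs_pop| exact: runs_push].
by rewrite !updx.
Qed.

End Conversions.

(* [ptt] peels off the head symbol of the function; the hooks are redefined as more functions become available. *)
Ltac pt_pre := fail.
Ltac pt_hook0 := fail.
Ltac pt_hook1 := fail.
Ltac pt_hook2 := fail.
Ltac pt_hook3 := fail.
Ltac pt_hook4 := fail.
Ltac pt1 :=
  cbv beta delta [bits];
  lazymatch goal with
  | |- pt _ (fun _ => _) => idtac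
  | |- pt ?O ?f => change (pt O (fun e => f e)); cbv beta
  end;
  match goal with
  | H : ?P |- ?P => exact H
  | H : pt _ ?f |- pt _ ?f => exact H
  | H : pt _ ?f |- pt _ (fun e => ?f e) => exact H
  | |- pt _ (fun e => e) => simple apply pt_id
  | |- pt _ (fun e => ?b) => simple apply pt_const
  | |- pt _ (fun e => fst (@?g e)) => simple apply pt_fst
  | |- pt _ (fun e => snd (@?g e)) => simple apply pt_snd
  | |- pt _ (fun e => (@?f e, @?g e)) => simple apply pt_pair
  | |- pt _ (fun e => @?f e :: @?g e) => simple apply pt_cons
  | |- pt _ (fun e => (@?f e).+1) => simple apply pt_S
  | H : pt _ ?f |- pt _ (fun e => ?f (@?g e)) => simple apply (pt_comp (f := g) (g := f))
  | H : forall x, pt _ (?f x) |- pt _ (fun e => ?f ?x (@?g e)) => simple apply (pt_comp (f := g) (g := f x))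
  | H : pt _ (fun p => ?f p.1 p.2) |- pt _ (fun e => ?f (@?g e) (@?h e)) =>
      simple apply (pt_comp2 (f := f))
  | H : pt _ (fun p => ?f p.1.1 p.1.2 p.2) |- pt _ (fun e => ?f (@?g e) (@?h e) (@?i e)) =>
      simple apply (pt_comp (f := fun e => (g e, h e, i e)) (g := fun p => f p.1.1 p.1.2 p.2))
  | H : pt _ (fun p => ?f p.1 p.2.1 p.2.2) |- pt _ (fun e => ?f (@?g e) (@?h e) (@?i e)) =>
      simple apply (pt_comp3 (f := f))
  | _ => first [pt_pre | pt_hook0 | pt_hook1 | pt_hook2 | pt_hook3 | pt_hook4 | simple apply pt_if | simple apply pt_case | simple apply pt_ncase]
  end.
Ltac ptt := repeat pt1.

(** Bounds that depend on the argument itself and not only on its size: they may mention components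
    of it, such as lengths of lists computed from it. *)
Definition bd (E : encType) (h : E -> nat) := exists k, forall e, h e <= pw k (sz e).

Section Bounds.
Variable E : encType.
Implicit Types h g : E -> nat.

Lemma bd_le h g : bd g -> (forall e, h e <= g e) -> bd h.
Proof. by case=> k H l; exists k => e; apply: leq_trans (l e) (H e). Qed.
Lemma bd_pb p : pb p -> bd (fun e : E => p (sz e)).
Proof. by case=> k H; exists k => e; apply: H. Qed.
Lemma bd_comp p h : pb p -> {homo p : m n / m <= n} -> bd h -> bd (fun e => p (h e)).
Proof.
move=> hp hm [k H]; apply: (bd_le (g := fun e => p (pw k (sz e)))).
  by apply: (bd_pb (p := fun n => p (pw k n))); apply: pb_comp hp (pb_pw k).
by move=> e; apply: hm.
Qed.
Lemma bd_const c : bd (fun _ : E => c).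
Proof. exact: bd_pb (pb_const c). Qed.
Lemma bd_add h g : bd h -> bd g -> bd (fun e => h e + g e).
Proof.
case=> k H [l G]; apply: (bd_le (g := fun e => pw k (sz e) + pw l (sz e))).
  by apply: (bd_pb (p := fun n => pw k n + pw l n)); pbt.
by move=> e; apply: leq_add.
Qed.
Lemma bd_mul h g : bd h -> bd g -> bd (fun e => h e * g e).
Proof.
case=> k H [l G]; apply: (bd_le (g := fun e => pw k (sz e) * pw l (sz e))).
  by apply: (bd_pb (p := fun n => pw k n * pw l n)); pbt.
by move=> e; apply: leq_mul.
Qed.
Lemma bd_S h : bd h -> bd (fun e => (h e).+1).
Proof. by move=> H; apply: (bd_le (bd_add H (bd_const 1))) => e; lia. Qed.
Lemma bd_pw k h : bd h -> bd (fun e => pw k (h e)).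
Proof. by apply: (bd_comp (p := pw k) (pb_pw k)) => m n; apply: pw_mono. Qed.
Lemma bd_self : bd (fun e : E => sz e).
Proof. exact: bd_pb pb_id. Qed.

Variable O : language.
Lemma bd_sz (F : encType) (f : E -> F) : pt O f -> bd (fun e => sz (f e)).
Proof. by move=> /pt_sz[k _ H]; exists k. Qed.
Lemma bd_nat (f : E -> nat) : pt O f -> bd f.
Proof. by move=> /bd_sz h; apply: bd_le h _ => e; rewrite sz_nat; lia. Qed.
Lemma bd_size (F : encType) (f : E -> seq F) : pt O f -> bd (fun e => size (f e)).
Proof. by move=> /bd_sz h; apply: bd_le h _ => e; have := size_sz (f e); lia. Qed.
End Bounds.

Ltac bdt := repeat first
  [ assumption | exact: bd_const | exact: bd_self
  | simple apply bd_S | simple apply bd_add | simple apply bd_mul | simple apply bd_pw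
  | match goal with
    | |- bd (fun e => sz (@?f e)) => eapply (bd_sz (f := f)); solve [ptt]
    | |- bd (fun e => size (@?f e)) => eapply (bd_size (f := f)); solve [ptt]
    | |- bd _ => eapply bd_nat; solve [ptt]
    end ].

(** * A library of polynomial-time functions on lists and numbers *)

Section Lib.
Variable O : language.
Local Notation pt := (pt O).

Lemma pt_foldl_bd (E S X : encType) (step : E -> S -> X -> S) (ini : E -> S) (l : E -> seq X) :
  pt l -> pt ini -> pt (fun q : (E * S) * X => step q.1.1 q.1.2 q.2) ->
  (exists2 B : E -> nat, bd B &
    forall e k, sz (foldl (step e) (ini e) (take k (l e))) <= B e) ->
  pt (fun e => foldl (step e) (ini e) (l e)).
Proof.
move=> hl hi hs [B [p hp] H]; apply: pt_foldl => //.
by exists (pw p); [pbt | move=> e k; apply: leq_trans (H e k) (hp e)].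
Qed.

(** If every step adds at most a fixed polynomial amount to the accumulator, its size stays
    polynomial; most loops are of this kind. *)
Lemma pt_foldl_add (E S X : encType) (step : E -> S -> X -> S) (ini : E -> S) (l : E -> seq X) :
  pt l -> pt ini -> pt (fun q : (E * S) * X => step q.1.1 q.1.2 q.2) ->
  (exists2 B : E -> nat, bd B &
    forall e s x, sz x <= sz (l e) -> sz (step e s x) <= sz s + B e) ->
  pt (fun e => foldl (step e) (ini e) (l e)).
Proof.
move=> hl hi hs [B hB H]; apply: pt_foldl_bd => //.
exists (fun e => sz (ini e) + size (l e) * B e); first by bdt.
move=> e k.
have Hk : forall (l' : seq X) s, (forall x, List.In x l' -> sz x <= sz (l e)) ->
    sz (foldl (step e) s l') <= sz s + size l' * B e.
  elim=> [|x l' IH] s hl' /=; first lia.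
  have := H e s x (hl' x (or_introl erefl)).
  have := IH (step e s x) (fun y hy => hl' y (or_intror hy)); lia.
apply: leq_trans (Hk _ _ _) _.
  move=> x; elim: (l e) k => [|y l' IH] [|k] //= [->|/IH h]; rewrite sz_cons; lia.
by rewrite leq_add2l leq_mul2r size_take_min geq_minr orbT.
Qed.

Lemma pt_rev (E X : encType) (l : E -> seq X) : pt l -> pt (fun e => rev (l e)).
Proof.
move=> hl; apply: (pt_ext (f := fun e => foldl (fun s x => x :: s) [::] (l e))).
  by move=> e; rewrite -(revK (l e)) foldl_rev revK; elim: (rev _) => //= x s ->.
apply: (pt_foldl_add (step := fun _ s x => x :: s)); ptt.
exists (fun e => sz (l e) + 1); first by bdt.
by move=> e s x h; rewrite sz_cons; lia.
Qed.

Lemma pt_foldr_bd (E S X : encType) (step : E -> X -> S -> S) (ini : E -> S) (l : E -> seq X) :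
  pt l -> pt ini -> pt (fun q : (E * S) * X => step q.1.1 q.2 q.1.2) ->
  (exists2 B : E -> nat, bd B &
    forall e k, sz (foldr (step e) (ini e) (drop k (l e))) <= B e) ->
  pt (fun e => foldr (step e) (ini e) (l e)).
Proof.
move=> hl hi hs [B hB H].
apply: (pt_ext (f := fun e => foldl (fun s x => step e x s) (ini e) (rev (l e)))).
  by move=> e; rewrite foldl_rev.
apply: pt_foldl_bd => //; first exact: pt_rev.
by exists B => // e k; rewrite take_rev foldl_rev.
Qed.

Lemma pt_cat (E X : encType) (l m : E -> seq X) : pt l -> pt m -> pt (fun e => l e ++ m e).
Proof.
move=> hl hm; apply: (pt_ext (f := fun e => foldl (fun s x => x :: s) (m e) (rev (l e)))).
  by move=> e; rewrite foldl_rev; elim: (l e) => //= x s ->.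
apply: (pt_foldl_add (step := fun _ s x => x :: s)); ptt; first exact: pt_rev.
exists (fun e => sz (rev (l e)) + 1); first by bdt; apply: bd_sz; apply: pt_rev hl.
by move=> e s x h; rewrite sz_cons; lia.
Qed.

Lemma pt_rcons (E X : encType) (l : E -> seq X) x : pt l -> pt x -> pt (fun e => rcons (l e) (x e)).
Proof.
move=> hl hx; apply: (pt_ext (f := fun e => l e ++ [:: x e])); first by move=> e; rewrite cats1.
by apply: pt_cat; ptt.
Qed.

Lemma pt_map (E X Y : encType) (f : E -> X -> Y) (l : E -> seq X) :
  pt l -> pt (fun q : E * X => f q.1 q.2) -> pt (fun e => map (f e) (l e)).
Proof.
move=> hl hf; apply: (pt_ext (f := fun e => rev (foldl (fun s x => f e x :: s) [::] (l e)))).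
  move=> e; have H : forall s a, rev (foldl (fun s x => f e x :: s) a s) = rev a ++ map (f e) s.
    by elim=> [|x s IH] a /=; [rewrite cats0 | rewrite IH rev_cons cat_rcons].
  exact: H.
apply: pt_rev; apply: (pt_foldl_add (step := fun e s x => f e x :: s)); ptt.
have [k _ hk] := pt_sz hf.
exists (fun e => (pw k (sz e + sz (l e)).+1).+1); first by bdt.
move=> e s x h; rewrite sz_cons; have := hk (e, x) => /=.
have : pw k (sz (e, x)) <= pw k (sz e + sz (l e)).+1 by apply: pw_mono; rewrite sz_pair; lia.
lia.
Qed.

Lemma pt_units (E : encType) (n : E -> nat) : pt n -> pt (fun e => nseq (n e) tt).
Proof. by move=> h; apply: (pt_comp (g := fun n => nseq n tt) h); apply: pt_cast; elim=> //= k ->. Qed.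

Lemma pt_nseq (E X : encType) (n : E -> nat) (x : E -> X) :
  pt n -> pt x -> pt (fun e => nseq (n e) (x e)).
Proof.
move=> hn hx; apply: (pt_ext (f := fun e => map (fun _ => x e) (nseq (n e) tt))).
  by move=> e; rewrite map_nseq.
apply: (pt_map (f := fun e _ => x e)); first exact: pt_units.
by ptt.
Qed.

Lemma pt_size (E X : encType) (l : E -> seq X) : pt l -> pt (fun e => size (l e)).
Proof.
move=> hl; apply: (pt_ext (f := fun e => size (map (fun _ => tt) (l e)))).
  by move=> e; rewrite size_map.
apply: (pt_comp (f := fun e => map (fun _ => tt) (l e)) (g := fun s : seq unit => size s)).
  by apply: (pt_map (f := fun _ _ => tt)); ptt.
by apply: pt_cast; elim=> //= x s ->; case: x.
Qed.

Lemma pt_iter_bd (E S : encType) (step : E -> S -> S) (ini : E -> S) (n : E -> nat) :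
  pt n -> pt ini -> pt (fun q : E * S => step q.1 q.2) ->
  (exists2 B : E -> nat, bd B & forall e k, k <= n e -> sz (iter k (step e) (ini e)) <= B e) ->
  pt (fun e => iter (n e) (step e) (ini e)).
Proof.
move=> hn hi hs [B hB H].
have E' e m : foldl (fun s _ => step e s) (ini e) (nseq m tt) = iter m (step e) (ini e).
  by elim: m (ini e) => //= m IH s; rewrite IH -iterSr.
apply: (pt_ext (f := fun e => foldl (fun s _ => step e s) (ini e) (nseq (n e) tt))) => //.
apply: (pt_foldl_bd (step := fun e s _ => step e s)) => //; first exact: pt_units.
  by ptt.
exists B => // e k; have -> : take k (nseq (n e) tt) = nseq (minn k (n e)) tt.
  elim: k (n e) => [|k IH] [|m] //=; rewrite ?minn0 //.
  by rewrite IH minnSS.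
by rewrite E'; apply: H; apply: geq_minr.
Qed.

Lemma pt_iter_add (E S : encType) (step : E -> S -> S) (ini : E -> S) (n : E -> nat) :
  pt n -> pt ini -> pt (fun q : E * S => step q.1 q.2) ->
  (exists2 B : E -> nat, bd B & forall e s, sz (step e s) <= sz s + B e) ->
  pt (fun e => iter (n e) (step e) (ini e)).
Proof.
move=> hn hi hs [B hB H]; apply: pt_iter_bd => //.
exists (fun e => sz (ini e) + n e * B e); first by bdt.
move=> e k hk; have : sz (iter k (step e) (ini e)) <= sz (ini e) + k * B e.
  by elim: k {hk} => [|k IH] /=; [lia | have := H e (iter k (step e) (ini e)); lia].
by move/leq_trans; apply; rewrite leq_add2l leq_mul2r hk orbT.
Qed.

Lemma pt_pred (E : encType) (n : E -> nat) : pt n -> pt (fun e => (n e).-1).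
Proof.
move=> h; apply: (pt_ext (f := fun e => match n e with 0 => 0 | m.+1 => m end)); last by ptt.
by move=> e; case: (n e).
Qed.

Lemma pt_addn (E : encType) (m n : E -> nat) : pt m -> pt n -> pt (fun e => m e + n e).
Proof.
move=> hm hn; apply: (pt_ext (f := fun e => iter (m e) (fun s => s.+1) (n e))).
  by move=> e; elim: (m e) => //= k ->.
apply: (pt_iter_add (step := fun _ s => s.+1)); ptt.
by exists (fun _ => 2); [bdt | move=> e s; rewrite !sz_nat; lia].
Qed.
Lemma pt_subn (E : encType) (m n : E -> nat) : pt m -> pt n -> pt (fun e => m e - n e).
Proof.
move=> hm hn; apply: (pt_ext (f := fun e => iter (n e) (fun s => s.-1) (m e))).
  by move=> e; elim: (n e) => [|k IH] /=; [rewrite subn0 | rewrite IH subnS].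
apply: (pt_iter_add (step := fun _ s => s.-1)); ptt; first by apply: pt_pred; ptt.
by exists (fun _ => 2); [bdt | move=> e s; rewrite !sz_nat; lia].
Qed.
Lemma pt_muln (E : encType) (m n : E -> nat) : pt m -> pt n -> pt (fun e => m e * n e).
Proof.
move=> hm hn; apply: (pt_ext (f := fun e => iter (m e) (fun s => n e + s) 0)).
  by move=> e; elim: (m e) => //= k ->; rewrite mulSn.
apply: (pt_iter_add (step := fun e s => n e + s)); ptt.
  by apply: (pt_addn (m := fun q : E * nat => n q.1)); ptt.
by exists (fun e => 2 * n e); [bdt | move=> e s; rewrite !sz_nat; lia].
Qed.
Lemma pt_negb (E : encType) (b : E -> bool) : pt b -> pt (fun e => ~~ b e).
Proof. by move=> h; apply: (pt_ext (f := fun e => if b e then false else true)); [move=> e; case: (b e) | ptt]. Qed.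
Lemma pt_andb (E : encType) (b c : E -> bool) : pt b -> pt c -> pt (fun e => b e && c e).
Proof. by move=> h h'; apply: (pt_ext (f := fun e => if b e then c e else false)); [move=> e; case: (b e) | ptt]. Qed.
Lemma pt_orb (E : encType) (b c : E -> bool) : pt b -> pt c -> pt (fun e => b e || c e).
Proof. by move=> h h'; apply: (pt_ext (f := fun e => if b e then true else c e)); [move=> e; case: (b e) | ptt]. Qed.
Lemma pt_eqb (E : encType) (b c : E -> bool) : pt b -> pt c -> pt (fun e => b e == c e).
Proof.
move=> h h'; apply: (pt_ext (f := fun e => if b e then c e else ~~ c e)); first by move=> e; case: (b e); case: (c e).
by apply: pt_if => //; apply: pt_negb.
Qed.
Lemma pt_addb (E : encType) (b c : E -> bool) : pt b -> pt c -> pt (fun e => b e (+) c e).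
Proof.
move=> h h'; apply: (pt_ext (f := fun e => if b e then ~~ c e else c e)); first by move=> e; case: (b e); case: (c e).
by apply: pt_if => //; apply: pt_negb.
Qed.
Lemma pt_leq (E : encType) (m n : E -> nat) : pt m -> pt n -> pt (fun e => m e <= n e).
Proof.
move=> hm hn; have h := pt_subn hm hn.
apply: (pt_ext (f := fun e => match m e - n e with 0 => true | _.+1 => false end)); last by ptt.
by move=> e; rewrite /leq; case: (m e - n e).
Qed.
Lemma pt_eqn (E : encType) (m n : E -> nat) : pt m -> pt n -> pt (fun e => m e == n e).
Proof.
move=> hm hn; apply: (pt_ext (f := fun e => (m e <= n e) && (n e <= m e))); first by move=> e; rewrite eqn_leq.
by apply: pt_andb; apply: pt_leq.
Qed.
Lemma pt_behead (E X : encType) (l : E -> seq X) : pt l -> pt (fun e => behead (l e)).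
Proof.
move=> h; apply: (pt_ext (f := fun e => match l e with [::] => [::] | _ :: s => s end)); last by ptt.
by move=> e; case: (l e).
Qed.
Lemma pt_head (E X : encType) (x : X) (l : E -> seq X) : pt l -> pt (fun e => head x (l e)).
Proof.
move=> h; apply: (pt_ext (f := fun e => match l e with [::] => x | y :: _ => y end)); last by ptt.
by move=> e; case: (l e).
Qed.
Lemma pt_drop (E X : encType) (n : E -> nat) (l : E -> seq X) :
  pt n -> pt l -> pt (fun e => drop (n e) (l e)).
Proof.
move=> hn hl; apply: (pt_ext (f := fun e => iter (n e) behead (l e))).
  move=> e; elim: (n e) => [|k IH] /=; first by rewrite drop0.
  by rewrite IH -[in RHS]add1n -drop_drop drop1.
apply: (pt_iter_add (step := fun _ s => behead s)); ptt; first by apply: pt_behead; ptt.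
by exists (fun e => 0); [bdt | move=> e [|x s]; rewrite ?sz_cons /=; lia].
Qed.
Lemma pt_take (E X : encType) (n : E -> nat) (l : E -> seq X) :
  pt n -> pt l -> pt (fun e => take (n e) (l e)).
Proof.
move=> hn hl; apply: (pt_ext (f := fun e => rev (drop (size (l e) - n e) (rev (l e))))).
  by move=> e; rewrite drop_rev revK; case: (leqP (n e) (size (l e))) => h; [rewrite subKn | rewrite !take_oversize //; lia].
by apply: pt_rev; apply: pt_drop; [apply: pt_subn => //; apply: pt_size | apply: pt_rev].
Qed.
Lemma pt_nth (E X : encType) (x : X) (l : E -> seq X) (n : E -> nat) :
  pt l -> pt n -> pt (fun e => nth x (l e) (n e)).
Proof.
move=> hl hn; apply: (pt_ext (f := fun e => head x (drop (n e) (l e)))).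
  by move=> e; rewrite -nth0 nth_drop addn0.
by apply: pt_head; apply: pt_drop.
Qed.
Lemma pt_last (E X : encType) (x : X) (l : E -> seq X) : pt l -> pt (fun e => last x (l e)).
Proof.
move=> hl; apply: (pt_ext (f := fun e => nth x (l e) (size (l e)).-1)); first by move=> e; rewrite nth_last.
by apply: pt_nth => //; apply: pt_pred; apply: pt_size.
Qed.
Lemma pt_iota (E : encType) (m n : E -> nat) : pt m -> pt n -> pt (fun e => iota (m e) (n e)).
Proof.
move=> hm hn.
apply: (pt_ext (f := fun e => iter (n e) (fun s => rcons s (m e + size s)) [::])).
  move=> e; have : size (iter (n e) (fun s => rcons s (m e + size s)) [::]) = n e
     /\ iter (n e) (fun s => rcons s (m e + size s)) [::] = iota (m e) (n e).
    by elim: (n e) => [//|k [h1 h2]]; rewrite iterS size_rcons h1 h2; split=> //; rewrite -[k.+1]addn1 iotaD cats1.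
  by case.
apply: (pt_iter_bd (step := fun e s => rcons s (m e + size s))); ptt.
  by apply: pt_rcons; ptt; apply: pt_addn; ptt; apply: pt_size; ptt.
exists (fun e => (n e * (2 * (m e + n e) + 2)).+1); first by bdt.
move=> e k hk; suff : sz (iter k (fun s => rcons s (m e + size s)) [::]) <= (k * (2 * (m e + n e) + 2)).+1
   /\ size (iter k (fun s => rcons s (m e + size s)) [::]) = k.
  by case=> h _; apply: leq_trans h _; rewrite ltnS leq_mul2r hk orbT.
elim: k hk => //= k IH hk; have [h1 h2] := IH (ltnW hk).
by rewrite size_rcons sz_rcons h2 sz_nat; split=> //; nia.
Qed.
Lemma pt_flatten (E X : encType) (l : E -> seq (seq X)) : pt l -> pt (fun e => flatten (l e)).
Proof.
move=> hl; apply: (pt_ext (f := fun e => foldl (fun s x => s ++ x) [::] (l e))).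
  move=> e; have H : forall s a, foldl (fun s x => s ++ x) a s = a ++ flatten s :> seq X.
    by elim=> [|x s IH] a /=; [rewrite cats0 | rewrite IH catA].
  exact: H.
apply: (pt_foldl_add (step := fun _ s x => s ++ x)); ptt; first by apply: pt_cat; ptt.
exists (fun e => sz (l e)); first by bdt.
by move=> e s x h; have := sz_cat s x; lia.
Qed.
Lemma pt_all (E X : encType) (p : E -> X -> bool) (l : E -> seq X) :
  pt l -> pt (fun q : E * X => p q.1 q.2) -> pt (fun e => all (p e) (l e)).
Proof.
move=> hl hp; apply: (pt_ext (f := fun e => foldl (fun b x => b && p e x) true (l e))).
  move=> e; suff H b s : foldl (fun b x => b && p e x) b s = b && all (p e) s by rewrite H.
  by elim: s b => [|x s IH] b /=; rewrite ?andbT // IH andbA.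
apply: (pt_foldl_add (step := fun e b x => b && p e x)); ptt.
  by apply: pt_andb; ptt.
exists (fun e => 3); first by bdt.
by move=> e s x h; apply: leq_trans (sz_bool _) _; apply: leq_addl.
Qed.
Lemma pt_has (E X : encType) (p : E -> X -> bool) (l : E -> seq X) :
  pt l -> pt (fun q : E * X => p q.1 q.2) -> pt (fun e => has (p e) (l e)).
Proof.
move=> hl hp; apply: (pt_ext (f := fun e => ~~ all (fun x => ~~ p e x) (l e))).
  by move=> e; rewrite all_predC negbK.
apply: pt_negb; apply: (pt_all (p := fun e x => ~~ p e x)) => //.
exact: pt_negb.
Qed.
Lemma pt_filter (E X : encType) (p : E -> X -> bool) (l : E -> seq X) :
  pt l -> pt (fun q : E * X => p q.1 q.2) -> pt (fun e => filter (p e) (l e)).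
Proof.
move=> hl hp; apply: (pt_ext (f := fun e => flatten (map (fun x => if p e x then [:: x] else [::]) (l e)))).
  by move=> e; elim: (l e) => //= x s ->; case: (p e x).
by apply: pt_flatten; apply: (pt_map (f := fun e x => if p e x then [:: x] else [::])); ptt.
Qed.
Lemma pt_set_nth (E X : encType) (x0 : X) (l : E -> seq X) (n : E -> nat) (x : E -> X) :
  pt l -> pt n -> pt x -> pt (fun e => set_nth x0 (l e) (n e) (x e)).
Proof.
move=> hl hn hx; apply: (pt_ext (f := fun e => take (n e) (l e) ++ nseq (n e - size (l e)) x0
   ++ x e :: drop (n e).+1 (l e))).
  move=> e; rewrite set_nthE; case: ltnP => h.
    by have -> : n e - size (l e) = 0 by apply/eqP; apply: ltnW.
  by rewrite take_oversize // drop_oversize ?cat_nseq //; apply: leqW.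
by apply: pt_cat; [apply: pt_take | apply: pt_cat; [apply: pt_nseq => //; ptt; apply: pt_subn => //; apply: pt_size |
  ptt; apply: pt_drop; ptt]].
Qed.
End Lib.

Ltac pt_hook0 ::=
  match goal with
  | |- pt _ (fun e => rev (@?f e)) => simple apply pt_rev
  | |- pt _ (fun e => @?f e ++ @?g e) => simple apply pt_cat
  | |- pt _ (fun e => rcons (@?f e) (@?g e)) => simple apply pt_rcons
  | |- pt _ (fun e => map (@?f e) (@?g e)) => simple apply (pt_map (f := f))
  | |- pt _ (fun e => nseq (@?f e) (@?g e)) => simple apply pt_nseq
  | |- pt _ (fun e => size (@?g e)) => simple apply pt_size
  | |- pt _ (fun e => (@?g e).-1) => simple apply pt_pred
  | |- pt _ (fun e => @?f e + @?g e) => simple apply pt_addn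
  | |- pt _ (fun e => @?f e - @?g e) => simple apply pt_subn
  | |- pt _ (fun e => @?f e * @?g e) => simple apply pt_muln
  | |- pt _ (fun e => ~~ (@?g e)) => simple apply pt_negb
  | |- pt _ (fun e => @?f e && @?g e) => simple apply pt_andb
  | |- pt _ (fun e => @?f e || @?g e) => simple apply pt_orb
  | |- pt _ (fun e => @?f e (+) @?g e) => simple apply pt_addb
  | |- pt _ (fun e => @?f e <= @?g e) => simple apply pt_leq
  | |- pt _ (fun e => @?f e == @?g e) => first [simple apply pt_eqb | simple apply pt_eqn]
  | |- pt _ (fun e => behead (@?g e)) => simple apply pt_behead
  | |- pt _ (fun e => head ?x (@?g e)) => simple apply pt_head
  | |- pt _ (fun e => last ?x (@?g e)) => simple apply pt_last
  | |- pt _ (fun e => drop (@?f e) (@?g e)) => simple apply pt_drop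
  | |- pt _ (fun e => take (@?f e) (@?g e)) => simple apply pt_take
  | |- pt _ (fun e => nth ?x (@?f e) (@?g e)) => simple apply pt_nth
  | |- pt _ (fun e => set_nth ?x (@?f e) (@?g e) (@?h e)) => simple apply pt_set_nth
  | |- pt _ (fun e => iota (@?f e) (@?g e)) => simple apply pt_iota
  | |- pt _ (fun e => flatten (@?g e)) => simple apply pt_flatten
  | |- pt _ (fun e => all (@?f e) (@?g e)) => simple apply (pt_all (p := f))
  | |- pt _ (fun e => has (@?f e) (@?g e)) => simple apply (pt_has (p := f))
  | |- pt _ (fun e => filter (@?f e) (@?g e)) => simple apply (pt_filter (p := f))
  end.

(** * Straight-line programs *)

Section SLP.
Variables (G T : Type) (step : seq T -> G -> T).

Lemma slp_values_rcons gs g : slp_values step (rcons gs g) =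
  rcons (slp_values step gs) (step (slp_values step gs) g).
Proof. by rewrite /slp_values -cats1 foldl_cat. Qed.
Lemma size_slp_values gs : size (slp_values step gs) = size gs.
Proof. by elim/last_ind: gs => // gs g IH; rewrite slp_values_rcons !size_rcons IH. Qed.
Lemma nth_slp_values_cat d gs hs j : j < size gs ->
  nth d (slp_values step (gs ++ hs)) j = nth d (slp_values step gs) j.
Proof.
elim/last_ind: hs => [|hs h IH] hj; first by rewrite cats0.
rewrite -rcons_cat slp_values_rcons nth_rcons size_slp_values size_cat ltn_addr //.
exact: IH.
Qed.
Lemma slp_wf_rcons (wf : nat -> G -> bool) gs g :
  slp_wf wf (rcons gs g) = slp_wf wf gs && wf (size gs) g.
Proof.
rewrite /slp_wf size_rcons -[(size gs).+1]addn1 iotaD /= add0n cats1.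
by rewrite zip_rcons ?size_iota // all_rcons andbC.
Qed.
End SLP.

(** * Simulation of machines by circuits *)

(* Predicated execution: a guard decides whether a command has any effect, and loops are unrolled [T] times, so that the control flow does not depend on the data. *)
Section Psim.
Variables (T S : nat).

(** Registers are cut at [S] symbols because a circuit gives each of them a fixed number of wires.
    Queries are answered as by the empty oracle. *)
Fixpoint psim c (g : bool) (s : store) : store :=
  match c with
  | Skip => s
  | Push i b => if g then update s i (take S (b :: s i)) else s
  | Pop i => if g then update s i (behead (s i)) else s
  | Query i => if g then update s i (take S [:: false]) else s
  | Seq c1 c2 => psim c2 g (psim c1 g s)
  | Case i c0 cF cT =>
      psim cT (g && (ohead (s i) == Some true)) (psim cF (g && (ohead (s i) == Some false))
        (psim c0 (g && (ohead (s i) == None)) s))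
  | While i c => iter T (fun s => psim c (g && (ohead (s i) != None)) s) s
  end.

Lemma psim_false c s : psim c false s = s.
Proof.
elim: c s => //= [c1 h1 c2 h2 s|i c0 h0 c1 h1 c2 h2 s|i c h s].
- by rewrite h1 h2.
- by rewrite h0 h1 h2.
- by elim: T => //= k ->.
Qed.

(** For loops the induction needs every number of rounds from [t] on: after the first round fewer
    rounds are left. Surplus rounds are idle because their guard is false. *)
Definition psim_spec c s s' t :=
  if c is While i c1 then forall n, t <= n ->
    iter n (fun s => psim c1 (ohead (s i) != None) s) s = s'
  else psim c true s = s'.

Lemma psim_spec_eq c s s' t : psim_spec c s s' t -> t <= T -> psim c true s = s'.
Proof. by case: c => //= i c h ht; apply: h. Qed.

Lemma psim_exec_spec c s s' t : exec (fun _ => False) c s s' t -> t <= T ->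
  (forall i, size (s i) + t <= S) -> psim_spec c s s' t.
Proof.
elim=> {c s s' t} //=.
- by move=> s i b _ h; rewrite /psim_spec /= take_oversize //=; have := h i; lia.
- by move=> s i _ _ h; rewrite /psim_spec /= take_oversize //=; have := h i; lia.
- move=> c1 c2 s s1 s2 t1 t2 e1 IH1 e2 IH2 hT hS; rewrite /psim_spec /=.
  rewrite (psim_spec_eq (IH1 _ _)); try lia; last by move=> i; have := hS i; lia.
  apply: psim_spec_eq; [apply: IH2; first lia | lia].
  by move=> i; have := exec_size e1 i; have := hS i; lia.
- move=> i c0 cF cT s s1 t _ IH hT hS; rewrite /psim_spec /=.
  have {}IH := psim_spec_eq (IH (ltnW hT) (fun j => leq_trans (leq_add (leqnn _) (leqnSn t)) (hS j))) (ltnW hT).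
  by case: (s i) IH => [|[] w] /= IH; rewrite !psim_false.
- by move=> i c s h _ _ n _; elim: n => //= k ->; rewrite h psim_false.
- move=> i c s s1 s2 t1 t2 h e1 IH1 e2 IH2 hT hS [|n] // hn.
  rewrite iterSr; have -> : ohead (s i) != None by case: (s i) h.
  rewrite (psim_spec_eq (IH1 _ _)); try lia; last by move=> j; have := hS j; lia.
  apply: IH2; [lia | | lia].
  by move=> j; have := exec_size e1 j; have := hS j; lia.
Qed.

Lemma psim_exec c s s' t : exec (fun _ => False) c s s' t -> t <= T ->
  (forall i, size (s i) + t <= S) -> psim c true s = s'.
Proof. by move=> h hT hS; apply: psim_spec_eq (psim_exec_spec h hT hS) hT. Qed.

End Psim.

(* Register contents as vectors of [2 S] bits: entry [i] is a presence bit followed by the bit itself, and absent entries are zero. *)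
Definition cells (T : Type) (one : T) (w : seq T) : seq T := flatten [seq [:: one; b] | b <- w].
Definition vec (T : Type) (zero one : T) S (w : seq T) : seq T :=
  cells one w ++ nseq (2 * (S - size w)) zero.

Section Vec.
Variables (T : Type) (zero one : T) (S : nat).
Implicit Type w : seq T.

Lemma size_cells w : size (cells one w) = 2 * size w.
Proof. by elim: w => //= b w ->; lia. Qed.
Lemma take_cells k w : take (2 * k) (cells one w) = cells one (take k w).
Proof.
elim: w k => [|b w IH] [|k] //.
have -> : 2 * k.+1 = (2 * k).+2 by lia.
by rewrite /= -!/(cells _ _) IH.
Qed.
Lemma size_vec w : size w <= S -> size (vec zero one S w) = 2 * S.
Proof. by move=> h; rewrite size_cat size_cells size_nseq; lia. Qed.
(** On vectors, pushing and popping are shifts by two entries, hence pure rewiring; gates are spent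
    only on choosing between the old and the new vector. *)
Lemma vec_push b w : size w <= S ->
  vec zero one S (take S (b :: w)) = take (2 * S) [:: one, b & vec zero one S w].
Proof.
rewrite leq_eqVlt => /orP[/eqP h|h].
  rewrite /vec h subnn muln0 cats0 -[[:: one, b & cells one w]]/(cells one (b :: w)) take_cells.
  by rewrite size_takel ?subnn ?muln0 ?cats0 // /= h leqnSn.
rewrite take_oversize // /vec -[[:: one, b & _]]/(cells one (b :: w) ++ _).
have -> : 2 * (S - size w) = 2 * (S - size (b :: w)) + 2 by rewrite /=; lia.
by rewrite nseqD catA takel_cat ?take_oversize // size_cat size_cells size_nseq /=; lia.
Qed.
Lemma vec_pop w : size w <= S ->
  vec zero one S (behead w) = drop 2 (vec zero one S w) ++ take (2 * S) [:: zero; zero].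
Proof.
case: w => [|b w] h; rewrite /vec /= ?subn0.
  case: S h => [|k] // _.
  have -> : 2 * k.+1 = 2 + 2 * k by lia.
  by rewrite [take _ _]take_oversize // {2}nseqD drop_size_cat ?size_nseq // -[[:: zero; zero]]/(nseq 2 zero) -nseqD addnC.
rewrite drop0; have -> : S - size w = (S - (size w).+1).+1 by move: h; rewrite /=; lia.
have -> : 2 * (S - (size w).+1).+1 = 2 * (S - (size w).+1) + 2 by lia.
by rewrite nseqD catA take_oversize //=; move: h; rewrite /=; lia.
Qed.
Lemma nth_vec d w i : size w <= S -> i < size w ->
  nth d (vec zero one S w) (2 * i) = one /\ nth d (vec zero one S w) (2 * i).+1 = nth d w i.
Proof.
move=> h hi; rewrite /vec !nth_cat !size_cells.
have -> : 2 * i < 2 * size w by lia.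
have -> : (2 * i).+1 < 2 * size w by lia.
elim: w i {h} hi => // b w IH [|i] // /IH [h1 h2].
by have -> : 2 * i.+1 = (2 * i).+2 by lia.
Qed.
Lemma nth_vec_out w j : 2 * size w <= j -> nth zero (vec zero one S w) j = zero.
Proof.
by move=> h; rewrite /vec nth_cat size_cells ltnNge h /= nth_nseq; case: ifP.
Qed.
End Vec.
Lemma map_vec (T U : Type) (f : T -> U) zero one S w :
  map f (vec zero one S w) = vec (f zero) (f one) S (map f w).
Proof.
by rewrite /vec map_cat map_nseq size_map; congr cat; elim: w => //= b w ->.
Qed.

(* Wires of the generated circuit are gate positions; gates 0 and 1 are the constants. *)
Definition mux_gates (c nc : nat) (gs : seq bgate) (ab : nat * nat) : seq bgate :=
  rcons (rcons (rcons gs (BAnd c ab.1)) (BAnd nc ab.2)) (BOr (size gs) (size gs).+1).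

Definition mux (c nc : nat) (st : seq bgate * seq nat) (ab : nat * nat) :=
  (mux_gates c nc st.1 ab, rcons st.2 (size st.1).+2).

Definition circ_state : Type := seq bgate * seq (seq nat).

Definition assign (c i : nat) (new : seq nat) (st : circ_state) : circ_state :=
  let m := foldl (mux c (size st.1)) (rcons st.1 (BNot c), [::])
             (zip new (nth [::] st.2 i)) in
  (m.1, set_nth [::] st.2 i m.2).

(** With [n] the number of gates so far, the guards of the empty, false and true branches are at
    positions [n + 1], [n + 5] and [n + 3]; the other three gates are auxiliary. *)
Definition guards (c i : nat) (st : circ_state) : seq bgate :=
  let r := nth [::] st.2 i in
  let n := size st.1 in
  rcons (rcons (rcons (rcons (rcons (rcons st.1 (BNot (nth 0 r 0))) (BAnd c n))
    (BAnd c (nth 0 r 0))) (BAnd n.+2 (nth 0 r 1))) (BNot (nth 0 r 1))) (BAnd n.+2 n.+4).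

Section Gen.
Variables (T S : nat).

Fixpoint gen (c : cmd) (g : nat) (st : circ_state) : circ_state :=
  match c with
  | Skip => st
  | Push i b => assign g i (take (2 * S) [:: 1, nat_of_bool b & nth [::] st.2 i]) st
  | Pop i => assign g i (drop 2 (nth [::] st.2 i) ++ take (2 * S) [:: 0; 0]) st
  | Query i => assign g i (take (2 * S) [:: 1, 0 & nseq (2 * S) 0]) st
  | Seq c1 c2 => gen c2 g (gen c1 g st)
  | Case i c0 cF cT =>
      gen cT (size st.1 + 3) (gen cF (size st.1 + 5) (gen c0 (size st.1 + 1)
        (guards g i st, st.2)))
  | While i c => iter T (fun st =>
      gen c (size st.1) (rcons st.1 (BAnd g (nth 0 (nth [::] st.2 i) 0)), st.2)) st
  end.
End Gen.

(** * Correctness of the generated gates *)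

Section Correct.
Variables (T S k R : nat).

Definition wv x gs j := nth false (slp_values (bstep x) gs) j.

Definition good (gs : seq bgate) :=
  [/\ slp_wf (bgate_wf k) gs, 2 <= size gs,
      forall x, wv x gs 0 = false & forall x, wv x gs 1 = true].

Definition extends (gs gs' : seq bgate) := size gs <= size gs' /\
  forall x j, j < size gs -> wv x gs' j = wv x gs j.

Lemma extends_trans gs1 gs2 gs3 : extends gs1 gs2 -> extends gs2 gs3 -> extends gs1 gs3.
Proof.
move=> [h1 e1] [h2 e2]; split; first exact: leq_trans h1 h2.
by move=> x j hj; rewrite e2 ?e1 //; apply: leq_trans hj h1.
Qed.

Lemma wv_rcons x gs g j : wv x (rcons gs g) j =
  if j < size gs then wv x gs j
  else if j == size gs then bstep x (slp_values (bstep x) gs) g else false.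
Proof. by rewrite /wv slp_values_rcons nth_rcons size_slp_values. Qed.

Lemma emit gs g : good gs -> bgate_wf k (size gs) g ->
  [/\ good (rcons gs g), extends gs (rcons gs g) &
      forall x, wv x (rcons gs g) (size gs) = bstep x (slp_values (bstep x) gs) g].
Proof.
move=> [wf s2 h0 h1] hg; split.
- split; rewrite ?slp_wf_rcons ?wf ?size_rcons //=; first lia.
    by move=> x; rewrite wv_rcons (leq_trans _ s2) ?h0.
  by move=> x; rewrite wv_rcons s2 h1.
- by split; [rewrite size_rcons | move=> x j hj; rewrite wv_rcons hj].
- by move=> x; rewrite wv_rcons ltnn eqxx.
Qed.

Lemma emit_mux gs c nc a b : good gs -> c < size gs -> nc < size gs ->
  a < size gs -> b < size gs ->
  let gs' := mux_gates c nc gs (a, b) in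
  [/\ good gs', extends gs gs', size gs' = (size gs).+3 &
     forall x, wv x gs nc = ~~ wv x gs c ->
       wv x gs' (size gs).+2 = if wv x gs c then wv x gs a else wv x gs b].
Proof.
move=> G hc hnc ha hb; rewrite /mux_gates /=.
have [|G1 E1 V1] := @emit gs (BAnd c a) G; first by rewrite /= hc ha.
set g1 := rcons gs _ in G1 E1 V1 *.
have s1 : size g1 = (size gs).+1 by rewrite size_rcons.
have [|G2 E2 V2] := @emit g1 (BAnd nc b) G1; first by rewrite /= s1; lia.
set g2 := rcons g1 _ in G2 E2 V2 *.
have s2 : size g2 = (size gs).+2 by rewrite size_rcons s1.
have [|G3 E3 V3] := @emit g2 (BOr (size gs) (size gs).+1) G2; first by rewrite /= s2; lia.
split=> //.
- exact: extends_trans E1 (extends_trans E2 E3).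
- by rewrite size_rcons s2.
- move=> x hn; rewrite -s2 V3 /= -!/(wv _ _ _).
  rewrite -s1 V2 /= -!/(wv _ _ _) (proj2 E2) ?s1 // V1 /= -!/(wv _ _ _).
  rewrite !(proj2 E1) // hn; case: (wv x gs c) => //=.
  by rewrite orbF.
Qed.

Lemma emit_muxes gs c nc ab : good gs -> c < size gs -> nc < size gs ->
  all (fun p => (p.1 < size gs) && (p.2 < size gs)) ab ->
  let m := foldl (mux c nc) (gs, [::]) ab in
  [/\ good m.1, extends gs m.1, size m.2 = size ab,
     all (fun w => w < size m.1) m.2 &
     forall x, wv x gs nc = ~~ wv x gs c ->
       map (wv x m.1) m.2 =
       map (fun p => if wv x gs c then wv x gs p.1 else wv x gs p.2) ab].
Proof.
move=> G hc hnc; elim/last_ind: ab => [|ab [a b] IH] /=; first by split.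
rewrite all_rcons /= => /andP[/andP[ha hb] /IH] {IH} /=.
rewrite -cats1 foldl_cat /= cats1; set m := foldl _ _ _ => -[G' [E1 E2] hs hw hv].
have lt j : j < size gs -> j < size m.1 by move=> h; apply: leq_trans h E1.
have [G3 E3 S3 V3] := emit_mux G' (lt _ hc) (lt _ hnc) (lt _ ha) (lt _ hb).
rewrite -/(mux_gates _ _ _ _) in G3 E3 S3 V3 *; split=> //.
- exact: extends_trans (conj E1 E2) E3.
- by rewrite !size_rcons hs.
- rewrite all_rcons S3 leqnn /=; apply: sub_all hw => w hw; lia.
- move=> x hn; rewrite !map_rcons V3 ?E2 // -hv //; congr rcons.
  by apply/eq_in_map => w /(allP hw) h; rewrite (proj2 E3).
Qed.

(* On input [x] the wires of [st] carry the store [s x]. *)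
Definition rep (st : circ_state) (s : bits -> store) :=
  [/\ good st.1, size st.2 = R,
      forall i, i < R -> size (nth [::] st.2 i) = 2 * S,
      forall i w, w \in nth [::] st.2 i -> w < size st.1 &
      forall x i, i < R -> size (s x i) <= S /\
        map (wv x st.1) (nth [::] st.2 i) = vec false true S (s x i)].

Lemma rep_ext st s gs : rep st s -> good gs -> extends st.1 gs -> rep (gs, st.2) s.
Proof.
move=> [G hR hS hw hv] G' [E1 E2]; split=> //=.
  by move=> i w /hw h; apply: leq_trans h E1.
move=> x i hi; have [h1 h2] := hv x i hi; split=> //.
by rewrite -h2; apply/eq_in_map => w /hw h; rewrite E2.
Qed.

Lemma zip_mux (U : Type) (f : nat -> U) (c : bool) (s t : seq nat) : size s = size t ->
  map (fun p => if c then f p.1 else f p.2) (zip s t) = if c then map f s else map f t.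
Proof. by case: c; elim: s t => [|a s IH] [|b t] //= [/IH ->]. Qed.

Lemma assign_rep st s g i new (v : bits -> bits) : rep st s -> i < R -> g < size st.1 ->
  size new = 2 * S -> all (fun w => w < size st.1) new ->
  (forall x, size (v x) <= S /\ map (wv x st.1) new = vec false true S (v x)) ->
  rep (assign g i new st) (fun x => if wv x st.1 g then update (s x) i (v x) else s x)
  /\ extends st.1 (assign g i new st).1.
Proof.
move=> Rp hi hg hnew hw hv; have [G hR hS hwr hvr] := Rp.
rewrite /assign.
have [|G1 E1 V1] := @emit st.1 (BNot g) G; first by [].
set gs1 := rcons _ _ in G1 E1 V1 *.
have s1 : size gs1 = (size st.1).+1 by rewrite size_rcons.
have [|||G2 E2 S2 W2 V2] := @emit_muxes gs1 g (size st.1) (zip new (nth [::] st.2 i)) G1.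
- by rewrite s1; lia.
- by rewrite s1.
- apply/allP => -[a b] hab /=.
  have ha : a \in new.
    by rewrite -(@unzip1_zip _ _ new (nth [::] st.2 i)) ?hS ?hnew //; apply/mapP; exists (a, b).
  have hb : b \in nth [::] st.2 i.
    by rewrite -(@unzip2_zip _ _ new (nth [::] st.2 i)) ?hS ?hnew //; apply/mapP; exists (a, b).
  by have := allP hw _ ha; have := hwr _ _ hb; rewrite s1 /=; lia.
set m := foldl _ _ _ in G2 E2 S2 W2 V2 *.
have E : extends st.1 m.1 := extends_trans E1 E2.
split=> //; split=> //=.
- by rewrite size_set_nth hR; lia.
- move=> j hj; rewrite nth_set_nth /=; case: eqP => [_|_]; last exact: hS.
  by rewrite S2 size_zip hnew hS // minnn.
- move=> j w; rewrite nth_set_nth /=; case: eqP => [_ /(allP W2) //|_ /hwr h].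
  exact: leq_trans h (proj1 E).
- move=> x j hj; rewrite nth_set_nth /=.
  have [h1 h2] := hvr x j hj; have [h3 h4] := hv x.
  have e1 u : all (fun w => w < size st.1) u -> map (wv x m.1) u = map (wv x st.1) u.
    by move=> hu; apply/eq_in_map => w /(allP hu) h; rewrite (proj2 E).
  have eg : wv x gs1 g = wv x st.1 g by rewrite (proj2 E1).
  case: eqP => [ej|nj]; last first.
    have -> : (if wv x st.1 g then update (s x) i (v x) else s x) j = s x j.
      by case: ifP => // _; rewrite /update; case: eqP => [/nj|].
    by rewrite e1 ?h2 //; apply/allP => w /hwr.
  subst j; have -> : (if wv x st.1 g then update (s x) i (v x) else s x) i =
    if wv x st.1 g then v x else s x i by case: ifP => // _; rewrite /update eqxx.
 rewrite V2 ?V1 ?eg //.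
  rewrite zip_mux ?hnew ?hS //.
  have e1' u : all (fun w => w < size st.1) u -> map (wv x gs1) u = map (wv x st.1) u.
    by move=> hu; apply/eq_in_map => w /(allP hu) h; rewrite (proj2 E1).
  by case: ifP => _; rewrite e1' ?h2 ?h4 //; apply/allP => w /hwr.
Qed.

(** The top of a stack is visible on the first two wires of its vector. If [S = 0] there are no such
    wires, and both lookups default to gate 0, the constant false. *)
Lemma head_rep st s x i : rep st s -> i < R ->
  [/\ nth 0 (nth [::] st.2 i) 0 < size st.1, nth 0 (nth [::] st.2 i) 1 < size st.1,
     wv x st.1 (nth 0 (nth [::] st.2 i) 0) = (ohead (s x i) != None) &
     wv x st.1 (nth 0 (nth [::] st.2 i) 1) = (ohead (s x i) == Some true)].
Proof.
move=> [[wf g2 w0 w1] hR hS hw hv] hi; have [h1 h2] := hv x i hi.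
have H j : nth 0 (nth [::] st.2 i) j < size st.1.
  case: (ltnP j (size (nth [::] st.2 i))) => hj; first by apply: hw (mem_nth _ _).
  by rewrite nth_default //; lia.
have N j : wv x st.1 (nth 0 (nth [::] st.2 i) j) = nth false (vec false true S (s x i)) j.
  rewrite -h2; case: (ltnP j (size (nth [::] st.2 i))) => hj; first by rewrite (nth_map 0).
  by rewrite [RHS]nth_default ?size_map // [nth 0 _ _]nth_default // w0.
split; rewrite ?N //; case: (s x i) h1 => [|b w] h1.
- by rewrite nth_vec_out.
- by have [-> _] := @nth_vec _ false true S false (b :: w) 0 h1 isT.
- by rewrite nth_vec_out.
- by rewrite [LHS](proj2 (@nth_vec _ false true S false (b :: w) 0 h1 isT)) /=; case: b {h1}.
Qed.

Lemma rep_eq st s s' : rep st s -> (forall x, s x = s' x) -> rep st s'.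
Proof.
move=> h e; have -> : s' = s by apply: functional_extensionality.
by [].
Qed.

(** The gates do not depend on the input: all dependence on data sits in the value of the guard
    wire, so one list of gates follows the predicated execution for all inputs at once. *)
Lemma gen_rep c g st s : rep st s -> bound_reg c <= R -> g < size st.1 ->
  rep (gen T S c g st) (fun x => psim T S c (wv x st.1 g) (s x)) /\
  extends st.1 (gen T S c g st).1.
Proof.
elim: c g st s => [|i b|i|i|c1 IH1 c2 IH2|i c0 IH0 c1 IH1 c2 IH2|i c IH] g st s Rp hb hg /=.
- by [].
- have [G hR hS hw hv] := Rp; have [wf g2 w0 w1] := G.
  apply: (@assign_rep st s g i _ (fun x => take S (b :: s x i))) => //.
  + by rewrite size_takel //= (hS i hb); lia.
  + apply/allP => w /mem_take; rewrite !inE => /orP[/eqP->|/orP[/eqP->|/hw //]] //.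
    by case: (b) => /=; lia.
  + move=> x; have [h1 h2] := hv x i hb; split; first by rewrite size_take; case: ltnP.
    by rewrite vec_push // map_take /= h2 w1; case: (b); rewrite ?w1 ?w0.
- have [G hR hS hw hv] := Rp; have [wf g2 w0 w1] := G.
  apply: (@assign_rep st s g i _ (fun x => behead (s x i))) => //.
  + by rewrite size_cat size_drop (hS i hb) size_take /=; case: ltnP; lia.
  + rewrite all_cat; apply/andP; split; apply/allP => w; first by move=> /mem_drop/hw.
    by move=> /mem_take; rewrite !inE => /orP[/eqP->|/eqP->]; lia.
  + move=> x; have [h1 h2] := hv x i hb; split; first by rewrite size_behead; lia.
    by rewrite vec_pop // map_cat map_drop h2 map_take /= w0.
- have [G hR hS hw hv] := Rp; have [wf g2 w0 w1] := G.
  apply: (@assign_rep st s g i _ (fun x => take S [:: false])) => //.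
  + by rewrite size_takel //= size_nseq; lia.
  + by apply/allP => w /mem_take; rewrite !inE mem_nseq => /orP[/eqP->|/orP[/eqP->|/andP[_ /eqP->]]] //; lia.
  + move=> x; split; first by rewrite size_take; case: ltnP.
    by rewrite (@vec_push _ false true S false [::] (leq0n S)) map_take /= map_nseq w0 w1 /vec /= subn0.
- have [R1 E1] := IH1 g st s Rp (leq_trans (leq_maxl _ _) hb) hg.
  have [R2 E2] := IH2 g _ _ R1 (leq_trans (leq_maxr _ _) hb) (leq_trans hg (proj1 E1)).
  split; last exact: extends_trans E1 E2.
  by apply: rep_eq R2 _ => x; rewrite (proj2 E1).
- have hi : i < R by apply: leq_trans hb; apply: leq_maxl.
  have hr x := head_rep x Rp hi.
  have [G hR hS hw hv] := Rp.
  have [l0 l1 _ _] := hr [::].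
  rewrite /guards; set r := nth [::] st.2 i in hr l0 l1 *; set n := size st.1 in hg l0 l1 *.
  have [|G1 E1 V1] := @emit st.1 (BNot (nth 0 r 0)) G; first by [].
  set g1 := rcons st.1 _ in G1 E1 V1 *.
  have s1 : size g1 = n.+1 by rewrite size_rcons.
  have [|G2 E2 V2] := @emit g1 (BAnd g n) G1; first by rewrite /= s1; lia.
  set g2 := rcons g1 _ in G2 E2 V2 *.
  have s2 : size g2 = n.+2 by rewrite size_rcons s1.
  have [|G3 E3 V3] := @emit g2 (BAnd g (nth 0 r 0)) G2; first by rewrite /= s2; lia.
  set g3 := rcons g2 _ in G3 E3 V3 *.
  have s3 : size g3 = n.+3 by rewrite size_rcons s2.
  have [|G4 E4 V4] := @emit g3 (BAnd n.+2 (nth 0 r 1)) G3; first by rewrite /= s3; lia.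
  set g4 := rcons g3 _ in G4 E4 V4 *.
  have s4 : size g4 = n.+4 by rewrite size_rcons s3.
  have [|G5 E5 V5] := @emit g4 (BNot (nth 0 r 1)) G4; first by rewrite /= s4; lia.
  set g5 := rcons g4 _ in G5 E5 V5 *.
  have s5 : size g5 = n.+4.+1 by rewrite size_rcons s4.
  have [|G6 E6 V6] := @emit g5 (BAnd n.+2 n.+4) G5; first by rewrite /= s5; lia.
  set g6 := rcons g5 _ in G6 E6 V6 *.
  have s6 : size g6 = n.+4.+2 by rewrite size_rcons s5.
  (* Each guard is evaluated where it is emitted; these extensions carry its value to the final list
     [g6]. *)
  have E56 := E6; have E46 := extends_trans E5 E56; have E36 := extends_trans E4 E46.
  have E26 := extends_trans E3 E36; have E16 := extends_trans E2 E26.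
  have E06 := extends_trans E1 E16.
  have e0 x j : j < n -> wv x g6 j = wv x st.1 j by move=> h; rewrite (proj2 E06).
  have vn x : wv x g6 n = (ohead (s x i) == None).
    rewrite (proj2 E16) ?s1 // V1 /= -/(wv _ _ _); have [_ _ -> _] := hr x.
    by rewrite negbK.
  have vn1 x : wv x g6 n.+1 = wv x st.1 g && (ohead (s x i) == None).
    rewrite (proj2 E26) ?s2 // -s1 V2 /= -!/(wv _ _ _) (proj2 E1) //; congr andb.
    by rewrite -(proj2 E16) ?s1 // vn.
  have vn2 x : wv x g6 n.+2 = wv x st.1 g && (ohead (s x i) != None).
    rewrite (proj2 E36) ?s3 // -s2 V3 /= -!/(wv _ _ _).
    rewrite -!(proj2 E26) ?s2 ?e0 //; try lia; by have [_ _ -> _] := hr x.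
  have vn3 x : wv x g6 n.+3 = wv x st.1 g && (ohead (s x i) == Some true).
    rewrite (proj2 E46) ?s4 // -s3 V4 /= -!/(wv _ _ _).
    rewrite -!(proj2 E36) ?s3 ?vn2 ?e0 //; try lia; have [_ _ _ ->] := hr x.
    by case: (wv x st.1 g) => //; case: (s x i).
  have vn5 x : wv x g6 (n + 5) = wv x st.1 g && (ohead (s x i) == Some false).
    have -> : n + 5 = size g5 by rewrite s5; lia.
    rewrite V6 /= -!/(wv _ _ _) -!(proj2 E56) ?s5 ?vn2 //; try lia.
    rewrite (proj2 E56) ?s5 // -s4 V5 /= -!/(wv _ _ _) -(proj2 E46) ?s4 ?e0 //; try lia.
    have [_ _ _ ->] := hr x.
    by case: (wv x st.1 g) => //; case: (s x i) => [|[]].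
  have R0 := rep_ext Rp G6 E06.
  have [||R1 F1] := IH0 (n + 1) _ _ R0; first by move: hb; rewrite !geq_max => /and4P[].
    by rewrite /= s6; lia.
  have [||R2 F2] := IH1 (n + 5) _ _ R1; first by move: hb; rewrite !geq_max => /and4P[].
    by apply: leq_trans (proj1 F1); rewrite /= s6; lia.
  have [||R3 F3] := IH2 (n + 3) _ _ R2; first by move: hb; rewrite !geq_max => /and4P[].
    by apply: leq_trans (leq_trans (proj1 F1) (proj1 F2)); rewrite /= s6; lia.
  split; last first.
    exact: extends_trans E06 (extends_trans F1 (extends_trans F2 F3)).
  apply: rep_eq R3 _ => x.
  rewrite /= in F1 F2.
  have F1' j : j < n.+4.+2 -> wv x (gen T S c0 (n + 1) (g6, st.2)).1 j = wv x g6 j.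
    by move=> h; rewrite (proj2 F1) // s6.
  have F2' j : j < n.+4.+2 ->
      wv x (gen T S c1 (n + 5) (gen T S c0 (n + 1) (g6, st.2))).1 j = wv x g6 j.
    move=> h; rewrite (proj2 F2) ?F1' //.
    by apply: leq_trans (proj1 F1); rewrite s6.
  rewrite F2' ?F1' ?vn5; try lia.
  by rewrite addn1 addn3 vn1 vn3.
- have hi : i < R by apply: leq_trans hb; apply: leq_maxl.
  set F := (fun st0 : circ_state => _).
  suff H m : rep (iter m F st) (fun x => iter m (fun s0 =>
      psim T S c (wv x st.1 g && (ohead (s0 i) != None)) s0) (s x)) /\
    extends st.1 (iter m F st).1 by exact: H.
  elim: m => [|m [Rm Em]] //=.
  set sm := iter m F st in Rm Em *.
  have hgm : g < size sm.1 by apply: leq_trans hg (proj1 Em).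
  have hr x := head_rep x Rm hi.
  have [l0 _ _ _] := hr [::].
  have [G _ _ _ _] := Rm.
  have [|G1 E1 V1] := @emit sm.1 (BAnd g (nth 0 (nth [::] sm.2 i) 0)) G; first by rewrite /= hgm.
  have R1 := rep_ext Rm G1 E1.
  have [||R2 E2] := IH (size sm.1) _ _ R1.
  + by apply: leq_trans hb; apply: leq_maxr.
  + by rewrite /= size_rcons.
  split; last exact: extends_trans Em (extends_trans E1 E2).
  apply: rep_eq R2 _ => x /=.
  rewrite V1 /= -!/(wv _ _ _); have [_ _ -> _] := hr x.
  by rewrite (proj2 Em).
Qed.

End Correct.

(** * Generating the circuits in polynomial time *)

Lemma pt_recode O (E F G : encType) (f : E -> F) (g : E -> G) :
  pt O f -> (forall e, enc (g e) = enc (f e)) -> pt O g.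
Proof. by move=> [c [k h]] H; exists c, k => a r; rewrite /code H; apply: h. Qed.

Definition bgate_rep (g : bgate) : nat * (nat * nat) :=
  match g with
  | BInput i => (0, (i, 0))
  | BConst b => (1, (nat_of_bool b, 0))
  | BNot i => (2, (i, 0))
  | BAnd i j => (3, (i, j))
  | BOr i j => (4, (i, j))
  end.
Canonical bgate_enc := EncType (fun g => enc (bgate_rep g)).
Canonical bcircuit_enc := EncType (fun C => enc (bgates C, boutputs C)).

Section Pt.
Variable O : language.
Local Notation pt := (pt O).

Lemma pt_BInput (E : encType) (f : E -> nat) : pt f -> pt (fun e => BInput (f e)).
Proof. by move=> h; apply: (pt_recode (f := fun e => (0, (f e, 0)))); ptt. Qed.
Lemma pt_BNot (E : encType) (f : E -> nat) : pt f -> pt (fun e => BNot (f e)).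
Proof. by move=> h; apply: (pt_recode (f := fun e => (2, (f e, 0)))); ptt. Qed.
Lemma pt_BAnd (E : encType) (f g : E -> nat) : pt f -> pt g -> pt (fun e => BAnd (f e) (g e)).
Proof. by move=> h h'; apply: (pt_recode (f := fun e => (3, (f e, g e)))); ptt. Qed.
Lemma pt_BOr (E : encType) (f g : E -> nat) : pt f -> pt g -> pt (fun e => BOr (f e) (g e)).
Proof. by move=> h h'; apply: (pt_recode (f := fun e => (4, (f e, g e)))); ptt. Qed.
Lemma pt_BConst (E : encType) (f : E -> bool) : pt f -> pt (fun e => BConst (f e)).
Proof.
move=> h; apply: (pt_ext (f := fun e => if f e then BConst true else BConst false)).
  by move=> e; case: (f e).
by ptt.
Qed.
Lemma pt_nat_of_bool (E : encType) (f : E -> bool) : pt f -> pt (fun e => nat_of_bool (f e)).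
Proof. by move=> h; apply: (pt_ext (f := fun e => if f e then 1 else 0)); [move=> e; case: (f e) | ptt]. Qed.
Lemma pt_bgates (E : encType) (f : E -> bcircuit) : pt f -> pt (fun e => bgates (f e)).
Proof. by move=> h; apply: (pt_fst (E := seq_enc bgate_enc) (F := seq_enc nat_enc) (g := fun e => (bgates (f e), boutputs (f e)))); apply: (pt_recode h). Qed.
Lemma pt_boutputs (E : encType) (f : E -> bcircuit) : pt f -> pt (fun e => boutputs (f e)).
Proof. by move=> h; apply: (pt_snd (E := seq_enc bgate_enc) (F := seq_enc nat_enc) (g := fun e => (bgates (f e), boutputs (f e)))); apply: (pt_recode h). Qed.
Lemma pt_BCircuit (E : encType) (f : E -> seq bgate) g : pt f -> pt g -> pt (fun e => BCircuit (f e) (g e)).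
Proof. by move=> h h'; apply: (pt_recode (f := fun e => (f e, g e))); ptt. Qed.

Lemma pt_minn (E : encType) (f g : E -> nat) : pt f -> pt g -> pt (fun e => minn (f e) (g e)).
Proof. by move=> h h'; rewrite /minn; ptt. Qed.
Lemma pt_zip (E X Y : encType) (x0 : X) (y0 : Y) (f : E -> seq X) (g : E -> seq Y) :
  pt f -> pt g -> pt (fun e => zip (f e) (g e)).
Proof.
move=> hf hg; apply: (pt_ext (f := fun e => map (fun i => (nth x0 (f e) i, nth y0 (g e) i))
   (iota 0 (minn (size (f e)) (size (g e)))))).
  move=> e; apply: (@eq_from_nth _ (x0, y0)); first by rewrite size_map size_iota size_zip.
  move=> i; rewrite size_map size_iota => hi.
  by rewrite (nth_map 0) ?size_iota // nth_iota // nth_zip_cond size_zip hi.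
by ptt; apply: pt_minn; ptt.
Qed.
Lemma pt_expc (E : encType) k (f : E -> nat) : pt f -> pt (fun e => f e ^ k).
Proof.
move=> h; elim: k => [|k IH]; first exact: pt_const.
by apply: (pt_ext (f := fun e => f e * f e ^ k)); [move=> e; rewrite expnS | ptt].
Qed.
End Pt.

Ltac pt_hook1 ::=
  match goal with
  | |- pt _ (fun e => BInput (@?f e)) => simple apply pt_BInput
  | |- pt _ (fun e => BNot (@?f e)) => simple apply pt_BNot
  | |- pt _ (fun e => BConst (@?f e)) => simple apply pt_BConst
  | |- pt _ (fun e => BAnd (@?f e) (@?g e)) => simple apply pt_BAnd
  | |- pt _ (fun e => BOr (@?f e) (@?g e)) => simple apply pt_BOr
  | |- pt _ (fun e => BCircuit (@?f e) (@?g e)) => simple apply pt_BCircuit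
  | |- pt _ (fun e => bgates (@?f e)) => simple apply pt_bgates
  | |- pt _ (fun e => boutputs (@?f e)) => simple apply pt_boutputs
  | |- pt _ (fun e => nat_of_bool (@?f e)) => simple apply pt_nat_of_bool
  | |- pt _ (fun e => minn (@?f e) (@?g e)) => simple apply pt_minn
  | |- pt _ (fun e => (@?f e) ^ ?k) => simple apply pt_expc
  end.

(* [pt] quantifies over all inputs, so the output of the generator has to be bounded on ill-formed states as well. *)
Definition gate_le M (g : bgate) := ((bgate_rep g).2.1 <= M.+1) && ((bgate_rep g).2.2 <= M.+1).
Definition out_le M (st : seq bgate * seq nat) :=
  [&& size st.1 <= M, all (gate_le M) st.1 & all (leq^~ M) st.2].
Definition st_le L Q M (st : circ_state) :=
  [&& size st.1 <= M, all (gate_le M) st.1, size st.2 <= Q &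
    all (fun r => (size r <= L) && all (leq^~ M) r) st.2].

Lemma gate_le_mono M M' g : M <= M' -> gate_le M g -> gate_le M' g.
Proof. by move=> h /andP[h1 h2]; apply/andP; split; lia. Qed.
Lemma leqs_mono M M' s : M <= M' -> all (leq^~ M) s -> all (leq^~ M') s.
Proof. by move=> h; apply: sub_all => w; lia. Qed.
Lemma gates_mono M M' s : M <= M' -> all (gate_le M) s -> all (gate_le M') s.
Proof. by move=> h; apply: sub_all => w; apply: gate_le_mono. Qed.
Lemma st_le_mono L Q M M' st : M <= M' -> st_le L Q M st -> st_le L Q M' st.
Proof.
move=> h /and4P[h1 h2 h3 h4]; apply/and4P; split=> //; first lia.
  exact: gates_mono h2.
by apply: sub_all h4 => r /andP[-> h5]; apply: leqs_mono h5.
Qed.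

Lemma muxes_le c nc M ab st : c <= M -> nc <= M ->
  all (fun p => (p.1 <= M) && (p.2 <= M)) ab -> out_le M st ->
  out_le (M + 3 * size ab) (foldl (mux c nc) st ab).
Proof.
move=> hc hnc hab hst.
suff H n st' : out_le (M + n) st' -> out_le (M + n + 3 * size ab) (foldl (mux c nc) st' ab).
  by have := H 0 st; rewrite !addn0; apply.
elim: ab n st' hab {hst} => [|[a b] ab IH] n st' /=; first by rewrite muln0 addn0.
move=> /andP[/andP[ha hb] /IH{}IH] /and3P[h1 h2 h3].
have -> : M + n + 3 * (size ab).+1 = M + (n + 3) + 3 * size ab by lia.
apply: IH; apply/and3P; split=> /=.
- by rewrite !size_rcons; lia.
- rewrite !all_rcons (gates_mono _ h2) ?andbT; last by lia.
  by rewrite /gate_le /= andbC; apply/and3P; split; [lia|lia|lia].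
- by rewrite all_rcons (leqs_mono _ h3) ?andbT; lia.
Qed.

Lemma size_muxes c nc ab st : size (foldl (mux c nc) st ab).2 = size st.2 + size ab.
Proof. by elim: ab st => [|p ab IH] st /=; rewrite ?addn0 // IH /= size_rcons; lia. Qed.

Lemma nth_regs_le L Q M st i : st_le L Q M st ->
  size (nth [::] st.2 i) <= L /\ all (leq^~ M) (nth [::] st.2 i).
Proof.
case/and4P=> _ _ _ h; case: (ltnP i (size st.2)) => hi; last by rewrite nth_default.
by move/allP: h => /(_ _ (mem_nth [::] hi)) /andP[].
Qed.

Lemma assign_le L Q M c i new st : c <= M -> i < Q -> size new <= L ->
  all (leq^~ M) new -> st_le L Q M st -> st_le L Q (M + (3 * L).+1) (assign c i new st).
Proof.
move=> hc hi hn hw hst; have [hl ho] := nth_regs_le i hst.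
case/and4P: hst => h1 h2 h3 h4; rewrite /assign.
set ab := zip _ _; set m := foldl _ _ _.
have hab : size ab <= L by rewrite size_zip; lia.
have : out_le (M.+1 + 3 * size ab) m.
  apply: muxes_le; try lia.
    apply/allP => -[a b] hin /=.
    have ha : a \in new.
      by move: hin; rewrite /ab; elim: (new) (nth _ _ _) => [|x s IH] [|y t] //=;
        rewrite !inE => /orP[/eqP[-> _]|/IH ->]; rewrite ?eqxx ?orbT.
    have hb : b \in nth [::] st.2 i.
      by move: hin; rewrite /ab; elim: (new) (nth _ _ _) => [|x s IH] [|y t] //=;
        rewrite !inE => /orP[/eqP[_ ->]|/IH ->]; rewrite ?eqxx ?orbT.
    by have := allP hw _ ha; have := allP ho _ hb; rewrite /=; lia.
  apply/and3P; split=> //=; first by rewrite size_rcons.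
  rewrite all_rcons (gates_mono _ h2) // andbT /gate_le /=; lia.
case/and3P=> m1 m2 m3; apply/and4P; split=> /=; first lia.
- by apply: gates_mono m2; lia.
- by rewrite size_set_nth; lia.
- apply/(all_nthP [::]) => j _; rewrite nth_set_nth /=; case: eqP => _.
    rewrite size_muxes /= add0n hab; apply: leqs_mono m3; lia.
  case: (ltnP j (size st.2)) => hj; last by rewrite nth_default.
  by move/allP: h4 => /(_ _ (mem_nth [::] hj)) /andP[-> h]; apply: leqs_mono h; lia.
Qed.

(** Bound on the number of gates emitted: an assignment takes one negation and three gates per
    multiplexer, a branching six guards, a round of a loop one guard. The nesting depth is a
    constant of the command, so this is polynomial in [T] and [L]. *)
Fixpoint cost c T L :=
  match c with
  | Skip => 0
  | Push _ _ | Pop _ | Query _ => (3 * L).+1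
  | Seq c1 c2 => cost c1 T L + cost c2 T L
  | Case _ c0 c1 c2 => 6 + cost c0 T L + cost c1 T L + cost c2 T L
  | While _ c => T * (cost c T L).+1
  end.

Lemma guards_le L Q M g i st : g <= M -> st_le L Q M st ->
  st_le L Q (M + 6) (guards g i st, st.2).
Proof.
move=> hg hst; have [_ ho] := nth_regs_le i hst.
have hn j : nth 0 (nth [::] st.2 i) j <= M.
  case: (ltnP j (size (nth [::] st.2 i))) => hj; last by rewrite nth_default.
  exact: allP ho _ (mem_nth _ hj).
case/and4P: (hst) => h1 h2 h3 h4; rewrite /guards; apply/and4P; split=> //=.
- by rewrite !size_rcons; lia.
- rewrite !all_rcons (gates_mono _ h2) ?andbT; last by lia.
  by have n0 := hn 0; have n1 := hn 1; rewrite /gate_le /=; lia.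
- by have /and4P[_ _ _] := st_le_mono (leq_addr 6 M) hst.
Qed.

Lemma iter_gen_le T S L Q c g i M st :
  (forall M g st, 0 < M -> g <= M ->
    st_le L Q M st -> st_le L Q (M + cost c T L) (gen T S c g st)) ->
  0 < M -> g <= M -> st_le L Q M st -> forall m, st_le L Q (M + m * (cost c T L).+1)
   (iter m (fun st => gen T S c (size st.1)
     (rcons st.1 (BAnd g (nth 0 (nth [::] st.2 i) 0)), st.2)) st).
Proof.
move=> IH M0 hg hst; elim=> [|m IHm]; first by rewrite mul0n addn0.
rewrite iterS; set sm := iter m _ st in IHm *.
have -> : M + m.+1 * (cost c T L).+1 = (M + m * (cost c T L).+1).+1 + cost c T L by lia.
case/and4P: (IHm) => h1 h2 h3 h4.
have [hl ho] := nth_regs_le i IHm.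
apply: IH; [lia | lia |].
apply/and4P; split=> //=.
+ by rewrite size_rcons.
+ rewrite all_rcons (gates_mono _ h2) ?andbT // /gate_le /=; apply/andP; split; first lia.
  case: (ltnP 0 (size (nth [::] sm.2 i))) => hj; last by rewrite nth_default.
  by have := allP ho _ (mem_nth 0 hj); rewrite /=; lia.
+ by case/and4P: (st_le_mono (leqnSn _) IHm).
Qed.

Lemma gen_le T S L Q c : 2 * S <= L -> bound_reg c <= Q -> forall M g st, 0 < M -> g <= M ->
  st_le L Q M st -> st_le L Q (M + cost c T L) (gen T S c g st).
Proof.
move=> hL; elim: c => [|i b|i|i|c1 IH1 c2 IH2|i c0 IH0 c1 IH1 c2 IH2|i c IH] hQ M g st M0 hg hst;
  rewrite [gen _ _ _ _ _]/= [cost _ _ _]/=.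
- by rewrite addn0.
- have [hl ho] := nth_regs_le i hst; apply: assign_le => //.
    by rewrite size_take /=; case: ltnP; lia.
  apply/allP => w /mem_take; rewrite !inE => /orP[/eqP->//|/orP[/eqP->|/(allP ho)//]].
  by case: (b).
- have [hl ho] := nth_regs_le i hst; apply: assign_le => //.
    by rewrite size_cat size_drop size_take /=; case: ltnP; lia.
  rewrite all_cat; apply/andP; split; apply/allP => w; first by move/mem_drop/(allP ho).
  by move/mem_take; rewrite !inE => /orP[/eqP->|/eqP->].
- apply: assign_le => //; first by rewrite size_take /=; case: ltnP; lia.
  apply/allP => w /mem_take; rewrite !inE mem_nseq => /orP[/eqP->//|/orP[/eqP->//|]].
  by case/andP => _ /eqP->.
- rewrite addnA; move: hQ; rewrite /= geq_max => /andP[q1 q2].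
  by apply: IH2 => //; try lia; apply: IH1.
- move: hQ; rewrite /= !geq_max => /and4P[hi q0 q1 q2].
  have hs : size st.1 <= M by case/and4P: hst.
  rewrite !addnA; apply: IH2 => //; try lia; apply: IH1 => //; try lia.
  by apply: IH0 => //; try lia; apply: guards_le.
- move: hQ; rewrite /= geq_max => /andP[hi q].
  by apply: iter_gen_le => //; exact: IH.
Qed.

Definition gates_bound M := M * (4 * M + 22) + 1.
Lemma sz_gates M gs : size gs <= M -> all (gate_le M) gs -> sz gs <= gates_bound M.
Proof.
move=> h h2; apply: leq_trans (_ : size gs * (4 * M + 21).+1 + 1 <= _).
  apply: sz_seq => g; move: h2; elim: (gs) => //= g' s IH /andP[hg /IH{}IH] [<-|/IH //].
  case/andP: hg => h1 h3; have -> : sz g' = sz (bgate_rep g') by [].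
  have : (bgate_rep g').1 <= 4 by case: g' {h1 h3}.
  move: (bgate_rep g') h1 h3 => [a [b d]] /= h1 h3 h4.
  by rewrite !sz_pair !sz_nat; lia.
by rewrite /gates_bound leq_add2r; apply: leq_mul => //; lia.
Qed.
Lemma sz_wires M (r : seq nat) : all (leq^~ M) r -> sz r <= size r * (2 * M + 2) + 1.
Proof.
move=> h; have -> : 2 * M + 2 = (2 * M + 1).+1 by lia.
apply: sz_seq => w; move: h; elim: r => //= w' s IH /andP[hw /IH{}IH] [<-|/IH //].
by rewrite sz_nat; lia.
Qed.
Definition st_bound L Q M := (gates_bound M + (Q * (L * (2 * M + 2) + 2) + 1)).+1.
Lemma sz_st L Q M st : st_le L Q M st -> sz st <= st_bound L Q M.
Proof.
case: st => gs rs /and4P[/= h1 h2 h3 h4]; rewrite sz_pair ltnS leq_add ?sz_gates //.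
apply: leq_trans (_ : size rs * (L * (2 * M + 2) + 1).+1 + 1 <= _).
  apply: sz_seq => r; move: h4; elim: rs {h3} => //= r' s IH /andP[/andP[hr hw] /IH{}IH] [<-|/IH //].
  by apply: leq_trans (sz_wires hw) _; rewrite leq_add2r leq_mul2r hr orbT.
by rewrite leq_add2r; apply: leq_mul => //; lia.
Qed.
Lemma sz_mem (E : encType) (s : seq E) x : List.In x s -> sz x < sz s.
Proof. by elim: s => //= y s IH [->|/IH h]; rewrite sz_cons; lia. Qed.
Lemma In_take (T : Type) (s : seq T) k x : List.In x (take k s) -> List.In x s.
Proof. by elim: s k => [|y s IH] [|k] //= [->|/IH]; [left|right]. Qed.
Lemma all_In (T : Type) (p : T -> bool) s : (forall x, List.In x s -> p x) -> all p s.
Proof. by elim: s => //= x s IH h; rewrite h ?IH //; [move=> y hy; apply: h; right | left]. Qed.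

Lemma gates_le_sz (gs : seq bgate) : all (gate_le (sz gs)) gs.
Proof.
apply: all_In => g /sz_mem; have -> : sz g = sz (bgate_rep g) by [].
rewrite /gate_le; move: (bgate_rep g) => [a [b d]]; rewrite !sz_pair !sz_nat /=; lia.
Qed.
Lemma wires_le_sz (r : seq nat) : all (leq^~ (sz r)) r.
Proof. by apply: all_In => w /sz_mem; rewrite sz_nat; lia. Qed.
Lemma st_le_sz (st : circ_state) : st_le (sz st) (sz st) (sz st) st.
Proof.
case: st => gs rs; rewrite sz_pair; apply/and4P; split=> /=.
- by have h : 2 * size gs < sz gs := size_sz gs; lia.
- by apply: gates_mono (gates_le_sz gs); lia.
- by have h : 2 * size rs < sz rs := size_sz rs; lia.
- apply: all_In => r /sz_mem h; apply/andP; split.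
    by have h2 : 2 * size r < sz r := size_sz r; lia.
  by apply: leqs_mono (wires_le_sz r); lia.
Qed.
Lemma st_le_mono3 L Q M L' Q' M' st : L <= L' -> Q <= Q' -> M <= M' ->
  st_le L Q M st -> st_le L' Q' M' st.
Proof.
move=> hL hQ hM /(st_le_mono hM) /and4P[h1 h2 h3 h4]; apply/and4P; split=> //; first lia.
by apply: sub_all h4 => r /andP[h5 h6]; apply/andP; split=> //; lia.
Qed.

Section PtGen.
Variable O : language.
Local Notation pt := (pt O).

Lemma pt_assign (E : encType) (c : E -> nat) i (new : E -> seq nat) (st : E -> circ_state) :
  pt c -> pt new -> pt st -> pt (fun e => assign (c e) i (new e) (st e)).
Proof.
move=> hc hn hs.
have hz : pt (fun e => zip (new e) (nth [::] (st e).2 i)) by apply: (pt_zip 0 0); ptt.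
suff hm : pt (fun e => foldl (mux (c e) (size (st e).1)) (rcons (st e).1 (BNot (c e)), [::])
   (zip (new e) (nth [::] (st e).2 i))) by rewrite /assign; ptt.
apply: (pt_foldl_bd (step := fun e => mux (c e) (size (st e).1))) => //; ptt.
  by rewrite /mux /mux_gates; ptt.
pose z e := zip (new e) (nth [::] (st e).2 i).
pose M e := (c e + sz (st e) + sz (z e)).+1.
pose N e := M e + 3 * size (z e).
exists (fun e => st_bound (size (z e)) 1 (N e)).
  by rewrite /st_bound /gates_bound /N /M /z; bdt.
move=> e k; set m := foldl _ _ _.
have hsz : size (take k (z e)) <= size (z e) by rewrite size_take; case: ltnP; lia.
have : out_le (M e + 3 * size (take k (z e))) m.
  apply: muxes_le.
  - by rewrite /M; lia.
  - have h : 2 * size (st e).1 < sz (st e).1 := size_sz (st e).1.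
    have h' : sz (st e).1 < sz (st e) := sz_fst (st e); rewrite /M; lia.
  - apply: all_In => -[a b] h.
    by have := sz_mem (In_take h); rewrite sz_pair !sz_nat /M /=; lia.
  - case/and4P: (st_le_sz (st e)) => h1 h2 h3 h4; apply/and3P; split=> //=.
      by rewrite size_rcons /M; lia.
    rewrite all_rcons (gates_mono _ h2) ?andbT /gate_le /M /=; lia.
case/and3P=> h1 h2 h3.
have h4 : st_le (size (z e)) 1 (N e) (m.1, [:: m.2]).
  apply/and4P; split=> //=; first by rewrite /N; lia.
    by apply: gates_mono h2; rewrite /N; lia.
  rewrite size_muxes /= add0n hsz /= andbT; apply: leqs_mono h3; rewrite /N; lia.
have := sz_st h4; rewrite !sz_pair sz_cons; have := sz_pair m.1 m.2.
by case: (m) => a b /= ->; lia.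
Qed.

Lemma pt_guards (E : encType) (g : E -> nat) i (st : E -> circ_state) :
  pt g -> pt st -> pt (fun e => guards (g e) i (st e)).
Proof. by move=> hg hs; rewrite /guards; ptt. Qed.

Lemma bd_cost (E : encType) c (T L : E -> nat) : bd T -> bd L -> bd (fun e => cost c (T e) (L e)).
Proof. by move=> hT hL; elim: c => /= *; bdt. Qed.

(** The command is fixed, so the induction over it takes place outside the machines: each loop of
    [c] contributes one bounded iteration to the generator. *)
Lemma pt_gen c (E : encType) (T S g : E -> nat) (st : E -> circ_state) :
  pt T -> pt S -> pt g -> pt st -> pt (fun e => gen (T e) (S e) c (g e) (st e)).
Proof.
elim: c E T S g st => [|i b|i|i|c1 IH1 c2 IH2|i c0 IH0 c1 IH1 c2 IH2|i c IH] E T S g st hT hS hg hst /=.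
- by [].
- by apply: pt_assign; ptt.
- by apply: pt_assign; ptt.
- by apply: pt_assign; ptt.
- by apply: IH2 => //; apply: IH1.
- have h0 : pt (fun e => gen (T e) (S e) c0 (size (st e).1 + 1) (guards (g e) i (st e), (st e).2)).
    by apply: IH0; ptt; apply: pt_guards.
  by apply: IH2; ptt; apply: IH1; ptt.
- pose L e := sz (st e) + 2 * S e.
  pose Q e := sz (st e) + bound_reg (While i c).
  pose M e := (sz (st e) + g e).+1.
  apply: (pt_iter_bd (step := fun e st0 => gen (T e) (S e) c (size st0.1)
      (rcons st0.1 (BAnd (g e) (nth 0 (nth [::] st0.2 i) 0)), st0.2))) => //.
    by apply: IH; ptt.
  exists (fun e => st_bound (L e) (Q e) (M e + T e * (cost c (T e) (L e)).+1)).
    have hL : bd L by rewrite /L; bdt.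
    have hQ : bd Q by rewrite /Q; bdt.
    have hM : bd M by rewrite /M; bdt.
    have hC : bd (fun e => cost c (T e) (L e)) by apply: bd_cost => //; apply: bd_nat hT.
    by rewrite /st_bound /gates_bound; bdt.
  move=> e k hk.
  have hst0 : st_le (L e) (Q e) (M e) (st e).
    by apply: st_le_mono3 (st_le_sz (st e)); rewrite /L /Q /M; lia.
  have hc : bound_reg c <= Q e by rewrite /Q /=; lia.
  have hL : 2 * S e <= L e by rewrite /L; lia.
  have := iter_gen_le i (gen_le (T e) hL hc) (g := g e) _ _ hst0 k.
  rewrite {1 2}/M => /(_ isT (ltac:(lia))) /(st_le_mono (M' := M e + T e * (cost c (T e) (L e)).+1)) h.
  by apply: sz_st; apply: h; rewrite leq_add2l leq_mul2r hk orbT.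
Qed.
End PtGen.

(** * Uniform circuits for polynomial-time functions *)

Section Compile.
Variables (c : cmd) (e : nat).

Definition input_gates k := [:: BConst false; BConst true] ++ [seq BInput i | i <- iota 0 k].

(** The number of rounds is the time bound on inputs of total length [size x + k], and the vectors
    are long enough that nothing is cut off and [l] output bits exist. The word [x] is hard-wired, a
    boolean being the number of the constant gate carrying it; the inputs are gates [2] to
    [k + 1]. *)
Definition run_circuit (x : bits) (k l : nat) : circ_state :=
  gen ((size x + k) ^ e + e) (size x + k + ((size x + k) ^ e + e) + l) c 1
    (input_gates k,
     vec 0 1 (size x + k + ((size x + k) ^ e + e) + l) [seq nat_of_bool b | b <- x] ::
     vec 0 1 (size x + k + ((size x + k) ^ e + e) + l) (iota 2 k) ::
     nseq (bound_reg c) (vec 0 1 (size x + k + ((size x + k) ^ e + e) + l) [::])).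

(** The odd entries of a vector are its bits. Those of absent symbols are false, so the result is
    padded or cut to length [l]. *)
Definition compiled (x : bits) (k l : nat) : bcircuit :=
  let st := run_circuit x k l in
  BCircuit st.1 [seq nth 0 (nth [::] st.2 0) (2 * i).+1 | i <- iota 0 l].

Lemma input_gates_values k z :
  slp_values (bstep z) (input_gates k) = [:: false; true] ++ mkseq (nth false z) k.
Proof.
rewrite /input_gates; elim: k => // k IH.
rewrite -[k.+1]addn1 iotaD add0n map_cat catA cats1 slp_values_rcons IH.
by rewrite /= /mkseq iotaD map_cat cats1.
Qed.

Lemma input_gates_wf k : slp_wf (bgate_wf k) (input_gates k).
Proof.
suff H j : j <= k -> slp_wf (bgate_wf k) (input_gates j) by exact: H.
elim: j => // j IH hj; rewrite /input_gates -[j.+1]addn1 iotaD add0n map_cat catA cats1.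
by rewrite slp_wf_rcons IH ?(ltnW hj).
Qed.

Lemma size_input_gates k : size (input_gates k) = k.+2.
Proof. by rewrite /input_gates /= size_map size_iota. Qed.

Lemma wv_input k z j : wv z (input_gates k) j = nth false ([:: false; true] ++ mkseq (nth false z) k) j.
Proof. by rewrite /wv input_gates_values. Qed.

Lemma mem_vec (T : eqType) (zero one : T) S w x :
  x \in vec zero one S w -> [|| x == zero, x == one | x \in w].
Proof.
rewrite mem_cat mem_nseq => /orP[|/andP[_ ->]] //.
elim: w => //= b w IH; rewrite /cells /= !inE => /orP[->|/orP[->|/IH]]; rewrite ?orbT //.
by case/or3P=> ->; rewrite ?orbT.
Qed.

Lemma run_rep x k l :
  let S := size x + k + ((size x + k) ^ e + e) + l in
  rep S k (bound_reg c).+2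
    (input_gates k, vec 0 1 S [seq nat_of_bool b | b <- x] :: vec 0 1 S (iota 2 k) ::
     nseq (bound_reg c) (vec 0 1 S [::]))
    (fun z => nth [::] [:: x; mkseq (nth false z) k]).
Proof.
move=> S; have hx : size x <= S by rewrite /S; lia.
have hk : k <= S by rewrite /S; lia.
have w0 z : wv z (input_gates k) 0 = false by rewrite wv_input.
have w1 z : wv z (input_gates k) 1 = true by rewrite wv_input.
have nv i : nth [::] (nseq (bound_reg c) (vec 0 1 S [::])) i =
    if i < bound_reg c then vec 0 1 S [::] else [::] by rewrite nth_nseq.
split; cbn [fst snd]; rewrite ?size_input_gates.
- by split; rewrite ?input_gates_wf ?size_input_gates.
- by rewrite /= size_nseq.
- move=> [|[|i]] /=; rewrite ?size_vec ?size_map ?size_iota // => hi.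
  by rewrite nv -ltnS -ltnS hi size_vec.
- move=> [|[|i]] w /=; last rewrite nv; last case: ifP => // _.
  + by move/mem_vec; case/or3P=> [/eqP->|/eqP->|/mapP[b _ ->]] //; case: b.
  + by move/mem_vec; case/or3P=> [/eqP->|/eqP->|] //; rewrite mem_iota; lia.
  + by move/mem_vec; case/or3P=> [/eqP->|/eqP->|].
- move=> z [|[|i]] hi /=.
  + rewrite map_vec w0 w1 -map_comp; split=> //; congr vec.
    by rewrite -[RHS]map_id; apply: eq_map => -[] /=; rewrite ?w0 ?w1.
  + rewrite map_vec w0 w1 size_mkseq; split=> //; congr vec.
    rewrite (iotaDl 2 0 k) -map_comp; apply/eq_in_map => j; rewrite mem_iota => /= hj.
    by transitivity (nth false (mkseq (nth false z) k) j); [rewrite wv_input | rewrite nth_mkseq].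
  + have hi' : i < bound_reg c := hi.
    by rewrite nv hi' map_vec w0 w1 nth_nil.
Qed.

Variable f : seq bits -> bits.
Hypothesis fP : forall xs : seq bits, size xs = 2 ->
  exists s t, [/\ exec (fun _ => False) c (nth [::] xs) s t,
    s 0 = f xs & t <= size (flatten xs) ^ e + e].

Lemma compiledP x k l : bcircuit_wf k l (compiled x k l) /\
  forall z, size z = k ->
    beval (compiled x k l) z = mkseq (nth false (f [:: x; z])) l.
Proof.
have R0 := run_rep x k l; rewrite /= in R0.
set S := size x + k + ((size x + k) ^ e + e) + l in R0.
set T := (size x + k) ^ e + e.
have [||Rp _] := @gen_rep T S k (bound_reg c).+2 c 1 _ _ R0; [by lia | by [] |].
move: Rp; rewrite /compiled; change (gen T S c 1 _) with (run_circuit x k l).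
set st := run_circuit x k l => -[[wf g2 w0 w1] hR hS hw hv].
have hlS : l <= S by rewrite /S; lia.
have ho i : i < l -> nth 0 (nth [::] st.2 0) (2 * i).+1 \in nth [::] st.2 0.
  by move=> hi; apply: mem_nth; rewrite hS //; lia.
split.
  apply/and3P; split=> //=; first by rewrite size_map size_iota.
  by apply/allP => w /mapP[i]; rewrite mem_iota => hi ->; apply: hw (ho _ _).
move=> z hz; rewrite /beval /= -map_comp; apply/eq_in_map => i; rewrite mem_iota /= => hi.
rewrite -/(wv z st.1 _).
have [] := hv z 0 isT; set w := psim _ _ _ _ _ _ => h1 h2.
have ew : w = f [:: x; z].
  rewrite /w wv_input /=.
  have [s [t [h hs ht]]] := @fP [:: x; z] erefl.
  rewrite -hs; congr (_ 0).
  have -> : mkseq (nth false z) k = z by rewrite -hz mkseq_nth.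
  have ht' : t <= T by move: ht; rewrite /= cats0 size_cat hz.
  have hS' : size x + k + t <= S by rewrite /S; move: ht'; rewrite /T; lia.
  apply: psim_exec h ht' _ => -[|[|j]]; rewrite /= ?nth_nil /= ?hz; lia.
have -> : wv z st.1 (nth 0 (nth [::] st.2 0) (2 * i).+1) = nth false (vec false true S w) (2 * i).+1.
  by rewrite -h2 (nth_map 0) // hS //; lia.
rewrite -ew; case: (ltnP i (size w)) => hiw; first by have [_ ->] := nth_vec false true false h1 hiw.
by rewrite nth_vec_out ?nth_default //; lia.
Qed.
End Compile.

Lemma pt_vec O (E : encType) (S : E -> nat) (w : E -> seq nat) : pt O S -> pt O w ->
  pt O (fun e => vec 0 1 (S e) (w e)).
Proof. by move=> hS hw; rewrite /vec /cells; ptt. Qed.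

Lemma pt_compiled c e O : pt O (fun p : bits * (nat * nat) => compiled c e p.1 p.2.1 p.2.2).
Proof.
have hr : pt O (fun p : bits * (nat * nat) => run_circuit c e p.1 p.2.1 p.2.2).
  rewrite /run_circuit; apply: pt_gen; rewrite /input_gates; ptt; apply: pt_vec; ptt.
by rewrite /compiled; ptt.
Qed.

(** Both forward maps obtain their circuits here: the instance is hard-wired, and only the seed
    remains an input. *)
Theorem polytime_circuits (f : seq bits -> bits) : polytime 2 f ->
  exists G : bits -> nat -> nat -> bcircuit,
    (forall O, pt O (fun p : bits * (nat * nat) => G p.1 p.2.1 p.2.2)) /\
    forall x k l, bcircuit_wf k l (G x k l) /\ forall z, size z = k ->
      beval (G x k l) z = mkseq (nth false (f [:: x; z])) l.
Proof.
case=> c [e fP]; exists (compiled c e); split; first by move=> O; apply: pt_compiled.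
by move=> x k l; apply: compiledP fP x k l.
Qed.

(** * Codes and their decoders *)

Definition val2 (l : seq bool) : nat := foldr (fun b n => nat_of_bool b + n.*2) 0 l.

Lemma ltn_binlen k i : (i < binlen k) = (2 ^ i <= k).
Proof.
rewrite /binlen; apply/idP/idP => h.
  rewrite leqNgt; apply/negP => h2.
  by have := up_log_min (isT : 1 < 2) h2; lia.
rewrite ltnNge; apply/negP => h2; have := @up_logP 2 k.+1 isT.
by have := @leq_pexp2l 2 _ _ isT h2; lia.
Qed.
Lemma binlen_gt k : k < 2 ^ binlen k.
Proof. by rewrite ltnNge -ltn_binlen ltnn. Qed.
Lemma binlen_le k : binlen k <= k.
Proof. by rewrite leqNgt ltn_binlen -ltnNge ltn_expl. Qed.
Lemma binlen_leq k j : k < 2 ^ j -> binlen k <= j.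
Proof. by move=> h; rewrite leqNgt ltn_binlen -ltnNge. Qed.

Lemma val2_lt l : val2 l < 2 ^ size l.
Proof. by elim: l => //= b l IH; rewrite expnS; case: b => /=; lia. Qed.
Lemma val2_cat l m : val2 (l ++ m) = val2 l + 2 ^ size l * val2 m.
Proof. by elim: l => [|b l IH] /=; [rewrite mul1n | rewrite IH expnS; lia]. Qed.
Lemma val2_nseq0 n : val2 (nseq n false) = 0.
Proof. by elim: n => //= n ->. Qed.
Lemma val2_inj l m : size l = size m -> val2 l = val2 m -> l = m.
Proof.
elim: l m => [|b l IH] [|c m] //= [hs] h.
have [h1 h2] : b = c /\ val2 l = val2 m by case: b h; case: c; rewrite /=; lia.
by rewrite h1 (IH m hs h2).
Qed.

(** A large number enters programs only under [tobits], as a word for its residue modulo [2 ^ w]: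
    written as a [nat] it would have exponential size. *)
Definition tobits (w k : nat) : seq bool := mkseq (fun i => odd (k %/ 2 ^ i)) w.

Lemma size_tobits w k : size (tobits w k) = w. Proof. exact: size_mkseq. Qed.
Lemma tobitsS w k : tobits w.+1 k = odd k :: tobits w k./2.
Proof.
rewrite /tobits /mkseq /= divn1; congr cons.
rewrite (iotaDl 1 0) -map_comp; apply: eq_map => i /=.
by rewrite expnS divnMA divn2.
Qed.
Lemma val2_tobits w k : val2 (tobits w k) = k %% 2 ^ w.
Proof.
elim: w k => [|w IH] k; first by rewrite modn1.
rewrite tobitsS /= IH expnS -divn2.
have := divn_eq (k %/ 2) (2 ^ w); have := divn_eq k 2; rewrite modn2.
set a := k %/ 2; set b := odd k; set q := a %/ _; set r := a %% _ => hk ha.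
have hr : r < 2 ^ w by rewrite ltn_mod expn_gt0.
have -> : k = q * (2 * 2 ^ w) + (b + r.*2) by rewrite hk ha; lia.
by rewrite modnMDl modn_small //; case: (b); lia.
Qed.
Lemma val2_binary k : val2 (binary k) = k.
Proof. by rewrite -/(tobits _ _) val2_tobits modn_small // binlen_gt. Qed.
Lemma tobits_val2 l : tobits (size l) (val2 l) = l.
Proof. by apply: val2_inj; rewrite ?size_tobits // val2_tobits modn_small // val2_lt. Qed.

Section PtCodes.
Variable O : language.
Local Notation pt := (pt O).

(** Halves, binary lengths and quotients of unary numbers are all computed by counting the [i] below
    a bound that pass a test. *)
Lemma size_filter_lt m n : size (filter (fun i => i < m) (iota 0 n)) = minn m n.
Proof.
elim: n => [|n IH]; first by rewrite minn0.
rewrite -[n.+1]addn1 iotaD filter_cat size_cat IH /= add0n.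
by case: ltnP => h /=; lia.
Qed.

Lemma pt_half (E : encType) (f : E -> nat) : pt f -> pt (fun e => (f e)./2).
Proof.
move=> h; apply: (pt_ext (f := fun e => size (filter (fun i => i.+1 + i.+1 <= f e) (iota 0 (f e))))).
  move=> e; rewrite -[RHS](minn_idPl (_ : (f e)./2 <= f e)); last by lia.
  by rewrite -size_filter_lt; congr size; apply: eq_filter => i; lia.
by ptt.
Qed.
Lemma pt_odd (E : encType) (f : E -> nat) : pt f -> pt (fun e => odd (f e)).
Proof.
move=> h; apply: (pt_ext (f := fun e => (f e)./2 + (f e)./2 != f e)); first by move=> e; lia.
by ptt; apply: pt_half.
Qed.
Lemma pt_iter_half (E : encType) (f g : E -> nat) : pt f -> pt g -> pt (fun e => f e %/ 2 ^ g e).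
Proof.
move=> hf hg; apply: (pt_ext (f := fun e => iter (g e) half (f e))).
  by move=> e; elim: (g e) => [|k IH] /=; rewrite ?divn1 // IH -divn2 -divnMA -expnSr.
apply: (pt_iter_add (step := fun _ => half)) => //; first by apply: pt_half; ptt.
by exists (fun _ => 0); [bdt | move=> e s; rewrite !sz_nat; lia].
Qed.
Lemma pt_binlen (E : encType) (f : E -> nat) : pt f -> pt (fun e => binlen (f e)).
Proof.
move=> h; apply: (pt_ext (f := fun e => size (filter (fun i => 0 < f e %/ 2 ^ i) (iota 0 (f e))))).
  move=> e; rewrite -[RHS](minn_idPl (binlen_le _)) -size_filter_lt.
  congr size; apply: eq_filter => i; rewrite ltn_binlen divn_gt0 ?expn_gt0 //.
by ptt; apply: pt_iter_half; ptt.
Qed.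
Lemma pt_tobits (E : encType) (w f : E -> nat) : pt w -> pt f -> pt (fun e => tobits (w e) (f e)).
Proof.
move=> hw hf; rewrite /tobits /mkseq; ptt.
by apply: pt_odd; apply: pt_iter_half; ptt.
Qed.
Lemma pt_binary (E : encType) (f : E -> nat) : pt f -> pt (fun e => binary (f e)).
Proof. by move=> h; apply: pt_tobits => //; apply: pt_binlen. Qed.

Lemma pt_list_code (E X : encType) (c : E -> X -> seq bool) (l : E -> seq X) :
  pt (fun q : E * X => c q.1 q.2) -> pt l -> pt (fun e => list_code (c e) (l e)).
Proof. by move=> hc hl; rewrite /list_code; ptt. Qed.
Lemma pt_nat_code (E : encType) (f : E -> nat) : pt f -> pt (fun e => nat_code (f e)).
Proof.
move=> h; rewrite /nat_code; apply: (pt_list_code (c := fun _ (b : bool) => [:: b])); ptt.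
exact: pt_binary.
Qed.
Lemma pt_unary_code (E : encType) (f : E -> nat) : pt f -> pt (fun e => unary_code (f e)).
Proof. by move=> h; rewrite /unary_code; ptt. Qed.

Lemma pt_bgate_rep (E : encType) (f : E -> bgate) : pt f -> pt (fun e => bgate_rep (f e)).
Proof. by move=> h; apply: (pt_recode h). Qed.

Lemma pt_bgate_code (E : encType) (f : E -> bgate) : pt f -> pt (fun e => bgate_code (f e)).
Proof.
move=> /pt_bgate_rep h.
apply: (pt_ext (f := fun e => let r := bgate_rep (f e) in
  if r.1 == 0 then [:: false; false; false] ++ nat_code r.2.1
  else if r.1 == 1 then [:: false; false; true; 0 < r.2.1]
  else if r.1 == 2 then [:: false; true; false] ++ nat_code r.2.1
  else if r.1 == 3 then [:: false; true; true] ++ nat_code r.2.1 ++ nat_code r.2.2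
  else [:: true; false; false] ++ nat_code r.2.1 ++ nat_code r.2.2)).
  by move=> e; case: (f e) => // -[].
have h1 : pt (fun e => nat_code (bgate_rep (f e)).2.1) by apply: pt_nat_code; ptt.
have h2 : pt (fun e => nat_code (bgate_rep (f e)).2.2) by apply: pt_nat_code; ptt.
by ptt.
Qed.
Lemma pt_bcircuit_code (E : encType) (f : E -> bcircuit) : pt f -> pt (fun e => bcircuit_code (f e)).
Proof.
move=> h; rewrite /bcircuit_code; apply: pt_cat.
  by apply: (pt_list_code (c := fun _ => bgate_code)); ptt; apply: pt_bgate_code; ptt.
by apply: (pt_list_code (c := fun _ => nat_code)); ptt; apply: pt_nat_code; ptt.
Qed.

Lemma pt_bstep (E : encType) (x vs : E -> seq bool) (g : E -> bgate) :
  pt x -> pt vs -> pt g -> pt (fun e => bstep (x e) (vs e) (g e)).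
Proof.
move=> hx hv /pt_bgate_rep h.
apply: (pt_ext (f := fun e => let r := bgate_rep (g e) in
  if r.1 == 0 then nth false (x e) r.2.1
  else if r.1 == 1 then 0 < r.2.1
  else if r.1 == 2 then ~~ nth false (vs e) r.2.1
  else if r.1 == 3 then nth false (vs e) r.2.1 && nth false (vs e) r.2.2
  else nth false (vs e) r.2.1 || nth false (vs e) r.2.2)).
  by move=> e; case: (g e) => // -[].
by ptt.
Qed.
Lemma pt_beval (E : encType) (C : E -> bcircuit) (x : E -> seq bool) :
  pt C -> pt x -> pt (fun e => beval (C e) (x e)).
Proof.
move=> hC hx; rewrite /beval.
have hv : pt (fun e => slp_values (bstep (x e)) (bgates (C e))).
  rewrite /slp_values.
  apply: (pt_foldl_add (step := fun e vs g => rcons vs (bstep (x e) vs g))); ptt.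
    by apply: pt_bstep; ptt.
  by exists (fun _ => 4); [bdt | move=> e s g _; rewrite sz_rcons; have := sz_bool (bstep (x e) s g); lia].
by apply: (pt_map (f := fun e j => nth false (slp_values (bstep (x e)) (bgates (C e))) j)); ptt;
  apply: (pt_comp (f := fst) (g := fun e => slp_values (bstep (x e)) (bgates (C e)))); ptt.
Qed.

End PtCodes.

Ltac pt_hook2 ::=
  match goal with
  | |- pt _ (fun e => (@?f e)./2) => simple apply pt_half
  | |- pt _ (fun e => odd (@?f e)) => simple apply pt_odd
  | |- pt _ (fun e => binlen (@?f e)) => simple apply pt_binlen
  | |- pt _ (fun e => binary (@?f e)) => simple apply pt_binary
  | |- pt _ (fun e => tobits (@?f e) (@?g e)) => simple apply pt_tobits
  | |- pt _ (fun e => nat_code (@?f e)) => simple apply pt_nat_code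
  | |- pt _ (fun e => unary_code (@?f e)) => simple apply pt_unary_code
  | |- pt _ (fun e => list_code (@?f e) (@?g e)) => simple apply (pt_list_code (c := f))
  | |- pt _ (fun e => bcircuit_code (@?f e)) => simple apply pt_bcircuit_code
  | |- pt _ (fun e => beval (@?f e) (@?g e)) => simple apply pt_beval
  end.

(** * Decoders *)

Definition parse_list (X : Type) (p : seq bool -> X * seq bool) (s : seq bool) : seq X * seq bool :=
  (iter (size s) (fun st : (seq X * seq bool) * bool =>
     if st.2 then
       if st.1.2 is b :: r then
         if b then ((rcons st.1.1 (p r).1, (p r).2), true) else ((st.1.1, r), false)
       else ((st.1.1, [::]), false)
     else st) (([::], s), true)).1.

(** As many rounds as there are symbols suffice, since every entry consumes at least its marker and
    the end marker is one more symbol. The flag makes the remaining rounds idle. *)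
Lemma parse_list_code (X : Type) (c : X -> bits) p (xs : seq X) rest :
  (forall x r, List.In x xs -> p (c x ++ r) = (x, r)) ->
  parse_list p (list_code c xs ++ rest) = (xs, rest).
Proof.
move=> hp; rewrite /parse_list; set F := (fun st : (seq X * seq bool) * bool => _).
have hstop n st : iter n F (st, false) = (st, false) by elim: n => //= n ->.
have H n acc : size xs < n ->
    iter n F ((acc, list_code c xs ++ rest), true) = ((acc ++ xs, rest), false).
  elim: xs n acc hp => [|x xs IH] [|n] // acc hp hn; rewrite iterSr.
    by rewrite {2}/F /= hstop cats0.
  rewrite {2}/F /= -!catA hp; last by left.
  have -> : flatten [seq true :: c x0 | x0 <- xs] ++ [:: false] ++ rest = list_code c xs ++ rest.
    by rewrite /list_code -catA.
  by rewrite IH ?cat_rcons // => y r hy; apply: hp; right.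
rewrite H //= size_cat /list_code size_cat /= addn1 ltnS.
apply: leq_trans (leq_addr _ _).
by elim: xs {hp H} => //= x xs IH; rewrite size_cat; lia.
Qed.

Definition parse_bit (s : seq bool) := (head false s, behead s).
(** Binary codes are decoded into unary numbers. The cap keeps the result polynomial on garbage,
    where a short word could denote an exponentially large number. *)
Definition capped (cap : nat) (l : seq bool) : nat :=
  foldr (fun b n => minn cap (nat_of_bool b + (n + n))) 0 l.
Definition parse_bits := parse_list parse_bit.
Definition parse_nat cap (s : seq bool) := (capped cap (parse_bits s).1, (parse_bits s).2).
Definition parse_unary (s : seq bool) :=
  (size (parse_list (fun s => (tt, s)) s).1, (parse_list (fun s => (tt, s)) s).2).

Lemma capped_val cap l : capped cap l = minn cap (val2 l).
Proof. by elim: l => [|b l IH] /=; [rewrite minn0 | rewrite IH; lia]. Qed.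
Lemma parse_bitsP l r : parse_bits (list_code (fun b => [:: b]) l ++ r) = (l, r).
Proof. by apply: parse_list_code. Qed.
Lemma parse_natP cap n r : n <= cap -> parse_nat cap (nat_code n ++ r) = (n, r).
Proof. by move=> h; rewrite /parse_nat parse_bitsP /= capped_val val2_binary (minn_idPr h). Qed.
Lemma parse_unaryP n r : parse_unary (unary_code n ++ r) = (n, r).
Proof.
have -> : unary_code n = list_code (fun _ : unit => [::]) (nseq n tt).
  by rewrite /unary_code /list_code; congr cat; elim: n => //= n ->.
have H := @parse_list_code unit (fun _ => [::]) (fun s => (tt, s)) (nseq n tt) r.
by rewrite /parse_unary H; [rewrite size_nseq | case].
Qed.

Definition parse_gate cap (s : seq bool) : bgate * seq bool :=
  let r := drop 3 s in
  if nth false s 0 then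
    (BOr (parse_nat cap r).1 (parse_nat cap (parse_nat cap r).2).1,
     (parse_nat cap (parse_nat cap r).2).2)
  else if nth false s 1 then
    if nth false s 2 then
      (BAnd (parse_nat cap r).1 (parse_nat cap (parse_nat cap r).2).1,
       (parse_nat cap (parse_nat cap r).2).2)
    else (BNot (parse_nat cap r).1, (parse_nat cap r).2)
  else if nth false s 2 then (BConst (head false r), behead r)
  else (BInput (parse_nat cap r).1, (parse_nat cap r).2).

Definition parse_circuit cap (s : seq bool) : bcircuit * seq bool :=
  let g := parse_list (parse_gate cap) s in
  let o := parse_list (parse_nat cap) g.2 in
  (BCircuit g.1 o.1, o.2).

Definition args_le cap (g : bgate) := ((bgate_rep g).2.1 <= cap) && ((bgate_rep g).2.2 <= cap).

Lemma parse_gateP cap g r : args_le cap g -> parse_gate cap (bgate_code g ++ r) = (g, r).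
Proof.
have H n r' : n <= cap -> parse_nat cap (nat_code n ++ r') = (n, r') := @parse_natP cap n r'.
rewrite /parse_gate /bgate_code; move: (parse_nat cap) nat_code H => P N H.
by case: g => [i|b|j|j k|j k]; case/andP=> /= h1 h2; rewrite ?drop0 -?catA ?H //= ?H.
Qed.

Lemma parse_circuit_le cap C r : (forall g, List.In g (bgates C) -> args_le cap g) ->
  (forall j, List.In j (boutputs C) -> j <= cap) ->
  parse_circuit cap (bcircuit_code C ++ r) = (C, r).
Proof.
case: C => gs os /= hgs hos.
rewrite /parse_circuit /bcircuit_code -catA parse_list_code /=; last first.
  by move=> g r' /hgs; apply: parse_gateP.
by rewrite parse_list_code // => j r' hj; apply: parse_natP; apply: hos.
Qed.

Lemma In_mem (T : eqType) (s : seq T) x : List.In x s -> x \in s.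
Proof. by elim: s => //= y s IH [->|/IH h]; rewrite inE ?eqxx // h orbT. Qed.

Lemma parse_circuitP cap m k C r : bcircuit_wf m k C -> m <= cap -> size (bgates C) <= cap -> 0 < cap ->
  parse_circuit cap (bcircuit_code C ++ r) = (C, r).
Proof.
case: C => gs os /and3P[/= wf _ ho] hm hg hc; apply: parse_circuit_le => /=; last first.
  by move=> j /In_mem/(allP ho) h; lia.
move: wf hg; elim/last_ind: gs {ho} => // gs g IH; rewrite slp_wf_rcons size_rcons => /andP[h1 h2] hg g'.
rewrite -cats1 => /List.in_app_iff[/(IH h1 (ltnW hg)) //|[<-|//]].
by rewrite /args_le; case: g h2 => //= [i|b|j|j l|j l]; [lia|case: b; lia|lia|lia|lia].
Qed.

(** A decoder whose cap exceeds all numbers in both circuits inverts both codes. This works for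
    ill-formed circuits too, as needed for solutions, which do not repeat well-formedness. *)
Lemma bcircuit_code_inj C C' r r' : bcircuit_code C ++ r = bcircuit_code C' ++ r' -> C = C' /\ r = r'.
Proof.
move=> h; pose M D := sz (bgates D) + sz (boutputs D).
have H D cap rest : M D < cap -> parse_circuit cap (bcircuit_code D ++ rest) = (D, rest).
  move=> hc; apply: parse_circuit_le.
    move=> g /(@sz_mem bgate_enc); have -> : sz g = sz (bgate_rep g) by [].
    rewrite /args_le; move: (bgate_rep g) hc => [a [b d]]; rewrite !sz_pair !sz_nat /M /=; lia.
  by move=> j /(@sz_mem nat_enc); rewrite sz_nat; move: hc; rewrite /M; lia.
have e1 := H C (M C + M C').+1 r (leq_addr _ _).
have e2 := H C' (M C + M C').+1 r' (leq_addl _ _).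
by move: e1; rewrite h e2 => -[-> ->].
Qed.

Section PtParse.
Variable O : language.
Local Notation pt := (pt O).

Lemma pt_parse_list (E X : encType) (p : E -> seq bool -> X * seq bool) (s : E -> seq bool) :
  pt (fun q : E * seq bool => p q.1 q.2) -> (forall e r, size (p e r).2 <= size r) ->
  pt s -> pt (fun e => parse_list (p e) (s e)).
Proof.
move=> hp hsz hs; rewrite /parse_list; apply: pt_fst.
have [k _ hk] := pt_sz hp.
apply: (pt_iter_bd (step := fun e (st : (seq X * seq bool) * bool) => _)); ptt.
pose B e := pw k (sz e + 4 * size (s e) + 2).
exists (fun e => (size (s e) * (B e).+1 + 1 + (4 * size (s e) + 1)).+4.+1).
  by rewrite /B; bdt.
move=> e n hn; set F := (fun st : (seq X * seq bool) * bool => _).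
suff H : sz (iter n F (([::], s e), true)).1.1 <= n * (B e).+1 + 1
   /\ size (iter n F (([::], s e), true)).1.2 <= size (s e).
  move: H; case: (iter n F _) => [[a r] b] /= [h1 h2]; rewrite !sz_pair.
  have h3 := sz_bits r; have h4 := sz_bool b.
  have h5 : n * (B e).+1 <= size (s e) * (B e).+1 by rewrite leq_mul2r hn orbT.
  by lia.
elim: n {hn} => [|n [IH1 IH2]] //.
rewrite iterS; move: (iter n F _) IH1 IH2 => [[a r] b] /= h1 h2.
rewrite /F /=; case: b => /=; last by split; lia.
case: r h2 => [|[] r] /= h2; try by split; lia.
split; last by apply: leq_trans (hsz e r) _; lia.
rewrite sz_rcons; have : sz (p e r).1 <= B e.
  have := hk (e, r); rewrite /= => h3.
  apply: leq_trans (leq_trans (ltnW (sz_fst _)) h3) _; apply: pw_mono; rewrite sz_pair.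
  by have := sz_bits r; lia.
by lia.
Qed.
End PtParse.

Lemma parse_list_size (X : Type) (p : seq bool -> X * seq bool) s :
  (forall r, size (p r).2 <= size r) -> size (parse_list p s).2 <= size s.
Proof.
move=> hp; rewrite /parse_list; set F := (fun st : (seq X * seq bool) * bool => _).
elim: {1}(size s) => [|n IH] //.
rewrite iterS; move: (iter n F _) IH => [[a r] b] /= h.
rewrite /F /=; case: b => //=; case: r h => [|[] r] //= h; last by lia.
by apply: leq_trans (hp r) _; lia.
Qed.
Lemma parse_bits_size s : size (parse_bits s).2 <= size s.
Proof. by apply: parse_list_size => r; rewrite /= size_behead leq_pred. Qed.
Lemma parse_nat_size cap s : size (parse_nat cap s).2 <= size s.
Proof. exact: parse_bits_size. Qed.
Lemma parse_gate_size cap s : size (parse_gate cap s).2 <= size s.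
Proof.
have h1 := parse_nat_size cap (drop 3 s).
have h2 := parse_nat_size cap (parse_nat cap (drop 3 s)).2.
have h3 : size (drop 3 s) <= size s by rewrite size_drop; lia.
rewrite /parse_gate; have h4 := leq_trans h1 h3; have h5 := leq_trans h2 h4.
case: ifP => _ //; case: ifP => _; case: ifP => _ //.
by rewrite [(_, _).2]/= size_behead; apply: leq_trans (leq_pred _) h3.
Qed.

Section Pt.
Variable O : language.
Local Notation pt := (pt O).

Lemma pt_parse_bits (E : encType) (s : E -> seq bool) : pt s -> pt (fun e => parse_bits (s e)).
Proof.
move=> hs; apply: (pt_parse_list (p := fun _ => parse_bit)) => //; first by rewrite /parse_bit; ptt.
by move=> _ r; rewrite /= size_behead leq_pred.
Qed.
Lemma pt_capped (E : encType) (cap : E -> nat) (s : E -> seq bool) :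
  pt cap -> pt s -> pt (fun e => capped (cap e) (s e)).
Proof.
move=> hc hs; apply: (pt_foldr_bd (step := fun e b n => minn (cap e) (nat_of_bool b + (n + n)))); ptt.
exists (fun e => 2 * cap e + 1); first by bdt.
move=> e k; rewrite sz_nat leq_add2r leq_mul2l /=.
by case: (drop k (s e)) => //= b l; apply: geq_minl.
Qed.
Lemma pt_parse_nat (E : encType) (cap : E -> nat) (s : E -> seq bool) :
  pt cap -> pt s -> pt (fun e => parse_nat (cap e) (s e)).
Proof.
move=> hc /pt_parse_bits hs; rewrite /parse_nat; ptt.
by apply: pt_capped; ptt.
Qed.
Lemma pt_parse_unary (E : encType) (s : E -> seq bool) : pt s -> pt (fun e => parse_unary (s e)).
Proof.
move=> hs.
have h : pt (fun e => parse_list (fun s => (tt, s)) (s e)).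
  by apply: (pt_parse_list (p := fun _ s => (tt, s))) => //; ptt.
by rewrite /parse_unary; ptt.
Qed.
Lemma pt_parse_gate (E : encType) (cap : E -> nat) (s : E -> seq bool) :
  pt cap -> pt s -> pt (fun e => parse_gate (cap e) (s e)).
Proof.
move=> hc hs.
have h1 : pt (fun e => parse_nat (cap e) (drop 3 (s e))) by apply: pt_parse_nat; ptt.
have h2 : pt (fun e => parse_nat (cap e) (parse_nat (cap e) (drop 3 (s e))).2).
  by apply: pt_parse_nat; ptt.
by rewrite /parse_gate; ptt.
Qed.
Lemma pt_parse_circuit (E : encType) (cap : E -> nat) (s : E -> seq bool) :
  pt cap -> pt s -> pt (fun e => parse_circuit (cap e) (s e)).
Proof.
move=> hc hs.
have h1 : pt (fun e => parse_list (parse_gate (cap e)) (s e)).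
  apply: (pt_parse_list (p := fun e => parse_gate (cap e))) => //.
    by apply: pt_parse_gate; ptt.
  by move=> e r; apply: parse_gate_size.
have h2 : pt (fun e => parse_list (parse_nat (cap e)) (parse_list (parse_gate (cap e)) (s e)).2).
  apply: (pt_parse_list (p := fun e => parse_nat (cap e))); ptt.
    by apply: pt_parse_nat; ptt.
  by move=> e r; apply: parse_nat_size.
by rewrite /parse_circuit; ptt.
Qed.
End Pt.

Ltac pt_hook3 ::=
  match goal with
  | |- pt _ (fun e => parse_bits (@?f e)) => simple apply pt_parse_bits
  | |- pt _ (fun e => parse_unary (@?f e)) => simple apply pt_parse_unary
  | |- pt _ (fun e => parse_nat (@?f e) (@?g e)) => simple apply pt_parse_nat
  | |- pt _ (fun e => parse_circuit (@?f e) (@?g e)) => simple apply pt_parse_circuit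
  end.

(** * Binary arithmetic *)

Lemma tobits_mod w n : tobits w (n %% 2 ^ w) = tobits w n.
Proof. by apply: val2_inj; rewrite ?size_tobits // !val2_tobits modn_mod. Qed.
Lemma tobits_eq w m n : m = n %[mod 2 ^ w] -> tobits w m = tobits w n.
Proof. by move=> h; rewrite -tobits_mod h tobits_mod. Qed.
Lemma fitE w l : take w (l ++ nseq w false) = tobits w (val2 l).
Proof.
apply: val2_inj; first by rewrite size_tobits size_takel // size_cat size_nseq leq_addl.
have E : val2 l = val2 (l ++ nseq w false) by rewrite val2_cat val2_nseq0 muln0 addn0.
rewrite val2_tobits E -{2}(cat_take_drop w (l ++ nseq w false)) val2_cat.
have -> : size (take w (l ++ nseq w false)) = w by rewrite size_takel // size_cat size_nseq leq_addl.
rewrite addnC mulnC modnMDl modn_small //.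
by apply: leq_trans (val2_lt _) _; rewrite leq_pexp2l // size_take; case: ltnP => //; lia.
Qed.

(** A full adder; the state is the carry with the sum bits so far. *)
Definition add_step (st : bool * seq bool) (p : bool * bool) :=
  ((p.1 && p.2) || (st.1 && (p.1 || p.2)), rcons st.2 (p.1 (+) p.2 (+) st.1)).

Lemma add_stepP l m c out : size l = size m ->
  let r := foldl add_step (c, out) (zip l m) in
  r.2 = out ++ tobits (size l) (val2 l + val2 m + c).
Proof.
elim: l m c out => [|x l IH] [|y m] c out //=; first by rewrite cats0.
case=> h; rewrite IH // tobitsS /add_step /= cat_rcons; congr (_ ++ _ :: _).
  by rewrite !oddD !odd_double !oddb; case: x y c => [] [] [].
by congr tobits; case: x y c => [] [] [] /=; lia.
Qed.

Section Pt.
Variable O : language.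
Local Notation pt := (pt O).

Lemma pt_fit (E : encType) (w : E -> nat) (l : E -> seq bool) : pt w -> pt l ->
  pt (fun e => tobits (w e) (val2 (l e))).
Proof.
move=> hw hl; apply: (pt_ext (f := fun e => take (w e) (l e ++ nseq (w e) false))); last by ptt.
by move=> e; rewrite fitE.
Qed.

Lemma pt_add2 (E : encType) (w : E -> nat) (a b : E -> seq bool) : pt w -> pt a -> pt b ->
  pt (fun e => tobits (w e) (val2 (a e) + val2 (b e))).
Proof.
move=> hw ha hb.
apply: (pt_ext (f := fun e => (foldl add_step (false, [::])
   (zip (tobits (w e) (val2 (a e))) (tobits (w e) (val2 (b e))))).2)).
  move=> e; rewrite add_stepP ?size_tobits //= addn0; apply: tobits_eq.
  by rewrite !val2_tobits modnDm.
have h1 : pt (fun e => tobits (w e) (val2 (a e))) by apply: pt_fit.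
have h2 : pt (fun e => tobits (w e) (val2 (b e))) by apply: pt_fit.
have h3 : pt (fun e => zip (tobits (w e) (val2 (a e))) (tobits (w e) (val2 (b e)))).
  by apply: (pt_zip false false).
apply: pt_snd; apply: (pt_foldl_add (step := fun _ => add_step)) => //; ptt.
  by rewrite /add_step; ptt.
exists (fun _ => 10); first by bdt.
move=> e [c s] [x y] _; rewrite /add_step /= !sz_pair sz_rcons.
by have := sz_gt0 c; have := sz_bool (x && y || c && (x || y)); have := sz_bool (x (+) y (+) c); lia.
Qed.

Lemma pt_mul2 (E : encType) (w : E -> nat) (a b : E -> seq bool) : pt w -> pt a -> pt b ->
  pt (fun e => tobits (w e) (val2 (a e) * val2 (b e))).
Proof.
move=> hw ha hb.
(* Shift and add from the most significant bit: [false :: acc] doubles the accumulator. *)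
apply: (pt_ext (f := fun e => foldr (fun (x : bool) acc =>
    tobits (w e) (val2 (false :: acc) + val2 (if x then a e else [::])))
    (tobits (w e) (val2 [::])) (b e))).
  move=> e; elim: (b e) => [|x l IH] /=; first by rewrite muln0.
  rewrite {}IH; apply: tobits_eq; rewrite val2_tobits add0n -muln2 -modnDml modnMml modnDml.
  by case: x => /=; congr (_ %% _); rewrite ?add1n ?mulnS ?mulnDr -muln2; lia.
apply: (pt_foldr_bd (step := fun e (x : bool) acc =>
    tobits (w e) (val2 (false :: acc) + val2 (if x then a e else [::])))) => //.
- by apply: pt_fit => //; ptt.
- by apply: pt_add2; ptt.
exists (fun e => 4 * w e + 1); first by bdt.
by move=> e k; case: (drop k (b e)) => [|x l] /=; apply: leq_trans (sz_bits _) _; rewrite size_tobits.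
Qed.

(* [q.-1.+1] is [q] except that it avoids division by zero, whose remainder would be exponentially long in unary. *)
Definition divmod_step q (b : bool) (st : seq bool * nat) : seq bool * nat :=
  let t := b + (st.2 + st.2) in
  if q.-1.+1 <= t then (true :: st.1, t - q.-1.+1) else (false :: st.1, t).
Lemma double_div1 d Q r b : Q <= b + (r + r) ->
  b + (d * Q + r).*2 = d.*2.+1 * Q + (b + (r + r) - Q).
Proof. by rewrite -!mul2n => h; nia. Qed.
Lemma double_div0 d Q r b : b + (d * Q + r).*2 = d.*2 * Q + (b + (r + r)).
Proof. by rewrite -!mul2n; nia. Qed.
(** Long division. [foldr] meets the most significant bit first, and the remainder, being below the
    small divisor, can stay in unary. *)
Lemma divmodP q l : let r := foldr (divmod_step q) ([::], 0) l in
  [/\ r.1 = tobits (size l) (val2 l %/ q.-1.+1) & r.2 = val2 l %% q.-1.+1].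
Proof.
set Q := q.-1.+1.
elim: l => [|b l [IH1 IH2]] /=; first by rewrite mod0n div0n.
set r := foldr _ _ _ in IH1 IH2 *.
have hr : r.2 < Q by rewrite IH2 ltn_pmod.
have hd := divn_eq (val2 l) Q; rewrite -IH2 in hd.
rewrite /divmod_step -/Q; case: (boolP (Q <= b + (r.2 + r.2))) => ht; last rewrite -ltnNge in ht.
- have e : b + (val2 l).*2 = ((val2 l %/ Q).*2.+1) * Q + (b + (r.2 + r.2) - Q).
    by rewrite {1}hd double_div1.
  have h : b + (r.2 + r.2) - Q < Q by case: (b) => /=; lia.
  rewrite e modnMDl divnMDl // (modn_small h) (divn_small h) addn0 tobitsS IH1 /=.
  by rewrite odd_double uphalf_double.
- have e : b + (val2 l).*2 = ((val2 l %/ Q).*2) * Q + (b + (r.2 + r.2)).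
    by rewrite {1}hd double_div0.
  rewrite e modnMDl divnMDl // (modn_small ht) (divn_small ht) addn0 tobitsS IH1 /=.
  by rewrite odd_double doubleK.
Qed.

Lemma pt_divmod (E : encType) (q : E -> nat) (l : E -> seq bool) : pt q -> pt l ->
  pt (fun e => foldr (divmod_step (q e)) ([::], 0) (l e)).
Proof.
move=> hq hl; apply: (pt_foldr_bd (step := fun e => divmod_step (q e))); ptt.
  by rewrite /divmod_step; ptt.
exists (fun e => 4 * size (l e) + 2 * (q e).+1 + 5); first by bdt.
move=> e k; have [] := divmodP (q e) (drop k (l e)).
case: (foldr _ _ _) => a b /= -> hb; rewrite sz_pair sz_nat.
have := sz_bits (tobits (size (drop k (l e))) (val2 (drop k (l e)) %/ (q e).-1.+1)).
have : b < (q e).-1.+1 by rewrite hb ltn_pmod.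
by rewrite size_tobits size_drop; lia.
Qed.

(** * Digits in a given radix *)

Definition digits q k n := mkseq (fun i => n %/ q ^ i %% q) k.
(** Horner's rule with a leading part [top], which stands for the quotient by [q ^ size ds];
    together with it the digits determine the number. *)
Definition undigits q (ds : seq nat) (top : nat) := foldr (fun d n => d + q * n) top ds.

Lemma digits_undigits q ds top : 0 < q -> all (fun d => d < q) ds ->
  digits q (size ds) (undigits q ds top) = ds /\ undigits q ds top %/ q ^ size ds = top.
Proof.
move=> hq; elim: ds => [|d ds IH] /=; first by rewrite divn1.
case/andP=> hd /IH [h1 h2]; rewrite /digits /mkseq /= divn1.
have hdiv : (d + q * undigits q ds top) %/ q = undigits q ds top.
  by rewrite addnC mulnC divnMDl // divn_small // addn0.
split; last by rewrite expnS divnMA hdiv.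
congr cons; first by rewrite addnC mulnC modnMDl modn_small.
rewrite -[RHS]h1 (iotaDl 1 0) -map_comp; apply: eq_map => i /=.
by rewrite expnS divnMA hdiv.
Qed.
Lemma undigits_digits q k n : undigits q (digits q k n) (n %/ q ^ k) = n.
Proof.
elim: k n => [|k IH] n; first by rewrite /= divn1.
rewrite /digits /mkseq /= divn1 (iotaDl 1 0) -map_comp.
have -> : [seq ((fun i => n %/ q ^ i %% q) \o addn 1) i | i <- iota 0 k] = digits q k (n %/ q).
  by apply: eq_map => i /=; rewrite expnS divnMA.
by rewrite expnS divnMA IH addnC mulnC -divn_eq.
Qed.
Lemma digits_lt q k n : 0 < q -> all (fun d => d < q) (digits q k n).
Proof. by move=> hq; apply/allP => d /mapP[i _ ->]; rewrite ltn_mod. Qed.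
Lemma undigits_lt q ds top : all (fun d => d < q) ds ->
  undigits q ds top < q ^ size ds * top.+1.
Proof.
elim: ds => [|d ds IH] /=; first by rewrite mul1n.
by case/andP=> hd /IH h; rewrite expnS; nia.
Qed.

Lemma pt_digits_step (E : encType) (q k : E -> nat) (l : E -> seq bool) : pt q -> pt k -> pt l ->
  pt (fun e => (digits (q e).-1.+1 (k e) (val2 (l e)),
     tobits (size (l e)) (val2 (l e) %/ (q e).-1.+1 ^ k e))).
Proof.
move=> hq hk hl.
pose F (e : E) (st : seq nat * seq bool) :=
  let r := foldr (divmod_step (q e)) ([::], 0) st.2 in (rcons st.1 r.2, r.1).
have H e n : iter n (F e) ([::], l e) =
    (digits (q e).-1.+1 n (val2 (l e)), tobits (size (l e)) (val2 (l e) %/ (q e).-1.+1 ^ n)).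
  elim: n => [|n IH]; first by rewrite /= divn1 tobits_val2.
  rewrite iterS {}IH /F; cbn [fst snd].
  have [-> ->] := divmodP (q e) (tobits (size (l e)) (val2 (l e) %/ (q e).-1.+1 ^ n)).
  have hs : val2 (l e) %/ (q e).-1.+1 ^ n < 2 ^ size (l e).
    by apply: leq_ltn_trans (leq_div _ _) (val2_lt _).
  rewrite size_tobits val2_tobits (modn_small hs) /digits -[n.+1]addn1 /mkseq iotaD map_cat /= cats1.
  by rewrite addn1 expnSr divnMA.
apply: (pt_ext (f := fun e => iter (k e) (F e) ([::], l e))) => //.
apply: (pt_iter_bd (step := F)) => //; ptt.
  have h : pt (fun q0 : E * (seq nat * seq bool) => foldr (divmod_step (q q0.1)) ([::], 0) q0.2.2).
    by apply: pt_divmod; ptt.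
  by rewrite /F; ptt.
exists (fun e => (k e * (2 * q e + 4) + 1 + (4 * size (l e) + 1)).+1); first by bdt.
move=> e n hn; rewrite H sz_pair ltnS leq_add //.
  apply: leq_trans (_ : size (digits (q e).-1.+1 n (val2 (l e))) * (2 * (q e) + 3).+1 + 1 <= _).
    apply: sz_seq => d hd; rewrite sz_nat.
    have : d < (q e).-1.+1.
      exact: allP (digits_lt n (val2 (l e)) (ltn0Sn (q e).-1)) _ (In_mem hd).
    by lia.
  by rewrite /digits size_mkseq leq_add2r; apply: leq_mul => //; lia.
by apply: leq_trans (sz_bits _) _; rewrite size_tobits.
Qed.
Lemma pt_digits (E : encType) (q k : E -> nat) (l : E -> seq bool) : pt q -> pt k -> pt l ->
  pt (fun e => digits (q e).-1.+1 (k e) (val2 (l e))).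
Proof. by move=> hq hk hl; apply: pt_ext (pt_fst (pt_digits_step hq hk hl)). Qed.
Lemma pt_digits_rest (E : encType) (q k : E -> nat) (l : E -> seq bool) : pt q -> pt k -> pt l ->
  pt (fun e => tobits (size (l e)) (val2 (l e) %/ (q e).-1.+1 ^ k e)).
Proof. by move=> hq hk hl; apply: pt_ext (pt_snd (pt_digits_step hq hk hl)). Qed.

Lemma pt_undigits (E : encType) (w q : E -> nat) (ds : E -> seq nat) (top : E -> seq bool) :
  pt w -> pt q -> pt ds -> pt top ->
  pt (fun e => tobits (w e) (undigits (q e) (ds e) (val2 (top e)))).
Proof.
move=> hw hq hd ht.
apply: (pt_ext (f := fun e => foldr (fun d acc =>
    tobits (w e) (val2 (tobits (w e) d) +
       val2 (tobits (w e) (val2 (tobits (w e) (q e)) * val2 acc))))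
    (tobits (w e) (val2 (top e))) (ds e))).
  move=> e; elim: (ds e) => //= d ds' ->; apply: tobits_eq.
  by rewrite !val2_tobits modnMm modnDm.
apply: (pt_foldr_bd (step := fun e d acc =>
    tobits (w e) (val2 (tobits (w e) d) +
       val2 (tobits (w e) (val2 (tobits (w e) (q e)) * val2 acc))))) => //.
- by apply: pt_fit.
- apply: pt_add2; [by ptt | by ptt |].
  by apply: pt_mul2; [by ptt | by ptt | by ptt].
exists (fun e => 4 * w e + 1); first by bdt.
by move=> e k; case: (drop k (ds e)) => [|x l] /=; apply: leq_trans (sz_bits _) _; rewrite size_tobits.
Qed.
End Pt.

Ltac pt_pre ::=
  match goal with
  | |- pt _ (fun e => tobits (@?w e) (val2 (@?f e) + val2 (@?g e))) => simple apply pt_add2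
  | |- pt _ (fun e => tobits (@?w e) (val2 (@?f e) * val2 (@?g e))) => simple apply pt_mul2
  | |- pt _ (fun e => tobits (@?w e) (undigits (@?f e) (@?g e) (val2 (@?h e)))) => simple apply pt_undigits
  | |- pt _ (fun e => tobits (@?w e) (val2 (@?f e))) => simple apply pt_fit
  | |- pt _ (fun e => tobits (size (@?l e)) (val2 (@?l e) %/ (@?q e).-1.+1 ^ (@?k e))) => simple apply pt_digits_rest
  | |- pt _ (fun e => digits (@?q e).-1.+1 (@?k e) (val2 (@?l e))) => simple apply pt_digits
  end.

Import Order.TTheory GRing.Theory Num.Theory.

(** * Algebraic circuits *)

Section Univariate.
Variables (P : acircuit) (a : seq int) (i : nat).
Local Open Scope ring_scope.

(** The restriction of the circuit to the line through [a] parallel to the axis [i], as a univariate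
    polynomial. *)
Definition pstep (vs : seq {poly int}) (g : agate) : {poly int} :=
  match g with
  | AVar j => if j == i then 'X else (nth 0 a j)%:P
  | AParam j => (nth 0 (aparams P) j)%:P
  | AAdd j k => nth 0 vs j + nth 0 vs k
  | AMul j k => nth 0 vs j * nth 0 vs k
  end.

Lemma pstep_values gs j :
  (forall t, (nth 0 (slp_values pstep gs) j).[t] =
     nth 0 (slp_values (astep (aparams P) (set_nth 0 a i t)) gs) j) /\
  (size (nth 0%R (slp_values pstep gs) j) <=
    (nth 0%N (slp_values (degree_step (inl i)) gs) j).+1)%N.
Proof.
elim/last_ind: gs j => [|gs g IH] j.
  by split=> [t|]; rewrite !nth_nil ?horner0 ?size_poly0.
rewrite !slp_values_rcons !nth_rcons !size_slp_values.
split=> [t|].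
  rewrite slp_values_rcons nth_rcons size_slp_values.
  case: ltnP => _; first by case: (IH j).
  case: eqP => _; last by rewrite horner0.
  case: g => [k|k|k l|k l] /=.
  - by rewrite nth_set_nth /=; case: eqP => _; rewrite ?hornerX ?hornerC.
  - by rewrite hornerC.
  - by rewrite hornerD (proj1 (IH k)) (proj1 (IH l)).
  - by rewrite hornerM (proj1 (IH k)) (proj1 (IH l)).
case: ltnP => _; first by case: (IH j).
case: eqP => _; last by rewrite size_poly0.
case: g => [k|k|k l|k l] /=.
- have -> : ((inl k : nat + nat) == inl i) = (k == i) by [].
  by case: eqP => _; rewrite ?size_polyX // size_polyC; case: (_ != _).
- by rewrite size_polyC; case: (_ != _).
- apply: leq_trans (size_polyD _ _) _; rewrite geq_max; apply/andP.
  by split; apply: leq_trans (proj2 (IH _)) _; rewrite ltnS ?leq_maxl ?leq_maxr.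
- apply: leq_trans (size_polyMleq _ _) _; have := leq_add (proj2 (IH k)) (proj2 (IH l)).
  by rewrite addnS addSn -!subn1 leq_subLR => h; apply: leq_trans h _; rewrite add1n.
Qed.

Lemma aeval_poly d : (adegree (inl i) P <= d)%N ->
  exists2 p : {poly int}, (size p <= d.+1)%N &
    forall t, p.[t] = aeval P (set_nth 0 a i t).
Proof.
move=> hd; have [h1 h2] := pstep_values (agates P) (size (agates P)).-1.
exists (nth 0 (slp_values pstep (agates P)) (size (agates P)).-1).
  apply: leq_trans h2 _; rewrite ltnS; move: hd; rewrite /adegree.
  by rewrite -nth_last size_slp_values.
by move=> t; rewrite h1 /aeval -nth_last size_slp_values.
Qed.

End Univariate.

Lemma poly_nat_roots (p : {poly int}) d (r : seq nat) : p != 0%R -> size p <= d.+1 -> uniq r ->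
  all (fun t : nat => p.[Posz t] == 0)%R r -> size r <= d.
Proof.
move=> p0 hs hu hr; rewrite -ltnS; apply: leq_trans hs.
rewrite -(size_map Posz); apply: max_poly_roots => //.
  by apply/allP => _ /mapP[t /(allP hr) ht ->].
by rewrite map_inj_uniq // => x y [].
Qed.

(** * Roots and nonroots on axis-parallel lines *)

Definition neval (P : acircuit) (h : seq nat) : int := aeval P (map Posz h).

Section Hybrid.
Variables (P : acircuit) (n d : nat).
Hypothesis deg : forall i, adegree (inl i) P <= d.

(** The coordinates are replaced one at a time. The line through the current nonroot carries a
    nonzero polynomial of degree at most [d], which cannot vanish at all of [0, ..., d]. *)
Lemma small_nonroot (a : seq int) : size a = n -> aeval P a <> 0%R ->
  exists2 b : seq nat, size b = n & all (fun t => t <= d) b /\ neval P b <> 0%R.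
Proof.
move=> sa na.
suff H i : i <= n -> exists2 b : seq nat, size b = i &
    all (fun t => t <= d) b /\ aeval P (map Posz b ++ drop i a) <> 0%R.
  have [b hb [h1 h2]] := H n (leqnn n); exists b => //; split=> //.
  by move: h2; rewrite -sa drop_size cats0.
elim: i => [_|i IH hi]; first by exists [::]; rewrite ?drop0.
have [b hb [h1 h2]] := IH (ltnW hi).
have [p hp hpe] := aeval_poly (map Posz b ++ drop i a) (deg i).
have set_eq t : set_nth 0%R (map Posz b ++ drop i a) i t = map Posz b ++ t :: drop i.+1 a.
  rewrite (drop_nth 0%R) ?sa // set_nthE size_cat size_map /= hb size_drop.
  have -> : i < i + (size a - i.+1).+1 by lia.
  rewrite take_cat size_map hb ltnn subnn take0 cats0; congr (_ ++ _ :: _).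
  by rewrite drop_cat size_map hb ltnNge leqnSn /= subSnn /= drop0.
have p0 : p != 0%R.
  apply/eqP => e; apply: h2; have := hpe (nth 0%R a i).
  by rewrite e horner0 set_eq -drop_nth ?sa.
case: (boolP (all (fun t : nat => p.[Posz t] == 0)%R (iota 0 d.+1))) => hall.
  by have := poly_nat_roots p0 hp (iota_uniq 0 d.+1) hall; rewrite size_iota ltnn.
case/allPn: hall => t; rewrite mem_iota /= => ht ht0.
exists (rcons b t); rewrite ?size_rcons ?hb //; split.
  by rewrite all_rcons h1 andbT; lia.
by rewrite map_rcons cat_rcons -set_eq -hpe; apply/eqP.
Qed.

(** The number [e] packs the hybrid index [e %/ d] with the rank [e %% d] of the root on its line;
    [o] is the point to be recovered without its coordinate at that index. *)
Definition row_decode (Z : seq nat -> bool) q (a : seq nat) (e : nat) (o : seq nat) : seq nat :=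
  let i := e %/ d in
  let t := nth 0 [seq t <- iota 0 q | Z (take i a ++ t :: drop i o)] (e %% d) in
  take i o ++ t :: drop i o.

(* Hybrid argument: some point between the root [h] and the nonroot [a] lies on an axis-parallel line on which [P] does not vanish identically, and [h] is recovered from the line and the rank of its root. *)
Lemma row_decodeP q (a h : seq nat) : size a = n -> size h = n ->
  all (fun t => t < q) h -> neval P a <> 0%R -> neval P h = 0%R ->
  exists e o, [/\ e < n * d, size o = n.-1, all (fun t => t < q) o &
    row_decode (fun b => neval P b == 0%R) q a e o = h].
Proof.
move=> sa sh hq na nh.
have [i hi [h1 h2]] : exists2 i, i < n & neval P (take i a ++ drop i h) = 0%R /\
    neval P (take i.+1 a ++ drop i.+1 h) <> 0%R.
  have H i : i <= n -> neval P (take i a ++ drop i h) <> 0%R ->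
      exists2 i, i < n & neval P (take i a ++ drop i h) = 0%R /\
         neval P (take i.+1 a ++ drop i.+1 h) <> 0%R.
    elim: i => [_|i IH hi hne]; first by rewrite take0 drop0.
    case: (eqVneq (neval P (take i a ++ drop i h)) 0%R) => [e|/eqP ne]; first by exists i.
    exact: IH (ltnW hi) ne.
  by apply: (H n) => //; rewrite -{1}sa take_size -sh drop_size cats0.
pose o := take i h ++ drop i.+1 h.
have so : size (take i h) = i by rewrite size_takel // sh ltnW.
have sta : size (take i a) = i by rewrite size_takel // sa ltnW.
have to : take i o = take i h by rewrite /o take_cat so ltnn subnn take0 cats0.
have dro : drop i o = drop i.+1 h by rewrite /o drop_cat so ltnn subnn drop0.
have [p hp hpe] := aeval_poly (map Posz (take i a ++ drop i h)) (deg i).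
have set_eq t : set_nth 0%R (map Posz (take i a ++ drop i h)) i (Posz t) =
    map Posz (take i a ++ t :: drop i o).
  rewrite (drop_nth 0) ?sh // !map_cat /= set_nthE size_cat size_map sta /= size_map size_drop sh.
  have -> : i < i + (n - i.+1).+1 by lia.
  rewrite take_cat size_map sta ltnn subnn take0 cats0 dro; congr (_ ++ _ :: _).
  by rewrite drop_cat size_map sta ltnNge leqnSn /= subSnn /= drop0.
have hpe' (t : nat) : p.[Posz t]%R = neval P (take i a ++ t :: drop i o) by rewrite hpe set_eq.
have p0 : p != 0%R.
  apply/eqP => e; apply: h2; have := hpe' (nth 0 a i).
  by rewrite e horner0 dro -cat_rcons -take_nth ?sa.
pose r := [seq t <- iota 0 q | neval P (take i a ++ t :: drop i o) == 0%R].
have hr : nth 0 h i \in r.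
  rewrite mem_filter mem_iota /= (allP hq) ?mem_nth ?sh // andbT dro.
  by rewrite -drop_nth ?sh // h1.
have hrd : size r <= d.
  apply: poly_nat_roots p0 hp _ _; first exact: filter_uniq (iota_uniq 0 q).
  by apply/allP => t; rewrite mem_filter => /andP[ht _]; rewrite hpe'.
(* The rank is below [d], so it survives the packing in radix [d]; in particular [d] is positive. *)
have jd : index (nth 0 h i) r < d by apply: leq_trans hrd; rewrite index_mem.
exists (i * d + index (nth 0 h i) r), o; split.
- by apply: leq_trans (_ : i.+1 * d <= _); [rewrite mulSn addnC ltn_add2r | rewrite leq_mul2r hi orbT].
- by rewrite size_cat so size_drop sh; lia.
- by rewrite all_cat; apply/andP; split; apply/allP => t; [move/mem_take|move/mem_drop]; apply: (allP hq).
- rewrite /row_decode divnMDl ?divn_small ?addn0; try lia.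
  rewrite modnMDl modn_small // -/r nth_index // to dro.
  by rewrite -drop_nth ?sh // cat_take_drop.
Qed.
End Hybrid.

(** * The size of the values of algebraic circuits *)

Section Magnitude.
Variables (P : acircuit) (n d W : nat) (a : seq int).
Let k := size (aparams P).
Hypothesis deg : forall l, adegree l P <= d.
Hypothesis wf : slp_wf (agate_wf n k) (agates P).
Hypothesis leafa : forall i, (`|nth 0%R a i| <= 2 ^ W)%N.
Hypothesis leafp : forall i, (`|nth 0%R (aparams P) i| <= 2 ^ W)%N.

(** Sum of the syntactic degrees over all variables and parameters. It adds up exactly at products,
    and at sums it dominates both arguments. Counting the parameters excludes repeated squaring of
    constants. *)
Definition total_degree gs j :=
  \sum_(i < n) nth 0 (slp_values (degree_step (inl (nat_of_ord i))) gs) j +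
  \sum_(i < k) nth 0 (slp_values (degree_step (inr (nat_of_ord i))) gs) j.

Lemma total_degree_rcons gs g j : total_degree (rcons gs g) j =
  if j < size gs then total_degree gs j else
  if j == size gs then
    \sum_(i < n) degree_step (inl (nat_of_ord i)) (slp_values (degree_step (inl (nat_of_ord i))) gs) g +
    \sum_(i < k) degree_step (inr (nat_of_ord i)) (slp_values (degree_step (inr (nat_of_ord i))) gs) g
  else 0.
Proof.
rewrite /total_degree.
under eq_bigr => i _ do rewrite slp_values_rcons nth_rcons size_slp_values.
under [X in _ + X]eq_bigr => i _ do rewrite slp_values_rcons nth_rcons size_slp_values.
by case: ltnP => // _; case: eqP => // _; rewrite !big1.
Qed.

(** At a product the exponents add like the degrees. At a sum the value at most doubles, which is
    paid for by the growth of the gate position [j]; this needs the degree to be positive. *)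
Lemma value_bound gs : slp_wf (agate_wf n k) gs -> forall j, j < size gs ->
  0 < total_degree gs j /\
  (`|nth 0%R (slp_values (astep (aparams P) a) gs) j| <= 2 ^ ((W + j) * total_degree gs j))%N.
Proof.
elim/last_ind: gs => // gs g IH; rewrite slp_wf_rcons => /andP[/IH{}IH hg] j.
rewrite size_rcons ltnS leq_eqVlt total_degree_rcons slp_values_rcons nth_rcons size_slp_values.
case/orP=> [/eqP->|hj]; last by rewrite hj; apply: IH.
rewrite ltnn eqxx; set D := (_ + _)%N.
have leaf (z : int) : 0 < D -> (`|z| <= 2 ^ W)%N -> (`|z| <= 2 ^ ((W + size gs) * D))%N.
  move=> hD h; apply: leq_trans h _; rewrite leq_pexp2l //.
  by apply: leq_trans (leq_addr (size gs) W) _; rewrite leq_pmulr.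
case: g hg @D leaf => [i|i|i l|i l] hg D leaf.
- have hD : 0 < D.
    apply: leq_trans (leq_addr _ _); rewrite (bigD1 (Ordinal hg)) //=.
    by rewrite eqxx.
  by split=> //; apply: leaf => //; apply: leafa.
- have hD : 0 < D.
    apply: leq_trans (leq_addl _ _); rewrite (bigD1 (Ordinal hg)) //=.
    by rewrite eqxx.
  by split=> //; apply: leaf => //; apply: leafp.
- case/andP: hg => hi hl; have [p1 b1] := IH i hi; have [p2 b2] := IH l hl.
  have d1 : total_degree gs i <= D by apply: leq_add; apply: leq_sum => u _; apply: leq_maxl.
  have d2 : total_degree gs l <= D by apply: leq_add; apply: leq_sum => u _; apply: leq_maxr.
  have hD : 0 < D by apply: leq_trans p1 d1.
  split=> //=.
  apply: leq_trans (_ : 2 ^ (((W + size gs).-1) * D).+1 <= _); last first.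
    rewrite leq_pexp2l //; have : 0 < W + size gs by lia.
    by case: (W + size gs) => // m _; rewrite /= mulSn; lia.
  have e1 : 2 ^ ((W + i) * total_degree gs i) <= 2 ^ ((W + size gs).-1 * D).
    by rewrite leq_pexp2l //; apply: leq_mul => //; lia.
  have e2 : 2 ^ ((W + l) * total_degree gs l) <= 2 ^ ((W + size gs).-1 * D).
    by rewrite leq_pexp2l //; apply: leq_mul => //; lia.
  rewrite expnS; have := leq_trans b1 e1; have := leq_trans b2 e2.
  by move: (nth 0%R _ i) (nth 0%R _ l) (2 ^ _) => x y z; lia.
- case/andP: hg => hi hl; have [p1 b1] := IH i hi; have [p2 b2] := IH l hl.
  have hDe : D = total_degree gs i + total_degree gs l.
    by rewrite /D /= !big_split /= /total_degree addnACA.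
  split; first by rewrite hDe; lia.
  rewrite /= abszM hDe mulnDr expnD.
  apply: leq_mul; [apply: leq_trans b1 _ | apply: leq_trans b2 _];
    by rewrite leq_pexp2l // leq_mul2r; apply/orP; right; lia.
Qed.

Lemma aeval_bound : (`|aeval P a| <= 2 ^ ((W + size (agates P)) * ((n + k) * d)))%N.
Proof.
rewrite /aeval -nth_last size_slp_values.
case: (posnP (size (agates P))) => h0.
  by rewrite nth_default ?size_slp_values ?h0.
have hj : (size (agates P)).-1 < size (agates P) by rewrite prednK.
have [_ hb] := value_bound wf hj.
apply: leq_trans hb _; rewrite leq_pexp2l //; apply: leq_mul; first by lia.
have hl l : nth 0 (slp_values (degree_step l) (agates P)) (size (agates P)).-1 <= d.
  by have := deg l; rewrite /adegree -nth_last size_slp_values.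
rewrite mulnDl; apply: leq_add.
  apply: leq_trans (leq_sum _ (fun i _ => hl _)) _.
  by rewrite sum_nat_const card_ord.
apply: leq_trans (leq_sum _ (fun i _ => hl _)) _.
by rewrite sum_nat_const card_ord.
Qed.
End Magnitude.

(** * Zero tests by evaluation modulo a power of two *)

Definition agate_rep (g : agate) : nat * (nat * nat) :=
  match g with
  | AVar i => (0, (i, 0))
  | AParam i => (1, (i, 0))
  | AAdd i j => (2, (i, j))
  | AMul i j => (3, (i, j))
  end.
Canonical agate_enc := EncType (fun g => enc (agate_rep g)).

(* Integers enter the machines as a sign and a binary absolute value, and are then evaluated modulo [2 ^ B]. *)
Definition pint (p : bool * seq bool) : int := if p.1 then (- Posz (val2 p.2))%R else val2 p.2.
Definition sign_abs (z : int) : bool * seq bool := ((z < 0)%R, binary `|z|%N).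

Lemma pint_sign_abs z : pint (sign_abs z) = z.
Proof. by rewrite /pint /sign_abs /= val2_binary; case: ltrP; lia. Qed.

Definition ztwo B : int := Posz (2 ^ B).
Definition ztobits B (z : int) := tobits B `|(z %% (ztwo B))%Z|%N.

Lemma pow2_neq0 B : (ztwo B) != 0%R.
Proof. by rewrite /ztwo; have := expn_gt0 2 B; lia. Qed.
Lemma val2_ztobits B z : Posz (val2 (ztobits B z)) = (z %% (ztwo B))%Z.
Proof.
have h0 := modz_ge0 z (pow2_neq0 B).
have h1 : ((z %% ztwo B)%Z < ztwo B)%R by apply: ltz_pmod; rewrite /ztwo; have := expn_gt0 2 B; lia.
by rewrite val2_tobits modn_small; move: h1; rewrite /ztwo; lia.
Qed.
Lemma ztobits_eq B (n : nat) (z : int) : (Posz n = z %[mod (ztwo B)])%Z -> tobits B n = ztobits B z.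
Proof.
move=> h; apply: val2_inj; first by rewrite !size_tobits.
by apply/eqP; rewrite -eqz_nat val2_ztobits -h val2_tobits modz_nat.
Qed.
Lemma ztobits0 B z : all negb (ztobits B z) = ((ztwo B) %| z)%Z.
Proof.
have -> : all negb (ztobits B z) = (val2 (ztobits B z) == 0).
  by elim: (ztobits B z) => [//|[] l IH] /=; [lia | rewrite IH; lia].
by rewrite -eqz_nat val2_ztobits; apply/eqP/dvdz_mod0P.
Qed.

(** Two's complement. *)
Definition neg_bits B (v : seq bool) := tobits B (val2 (map negb v) + val2 [:: true]).
Lemma neg_bitsE B n : neg_bits B (tobits B n) = ztobits B (- Posz n)%R.
Proof.
apply: ztobits_eq.
have H l : val2 (map negb l) + 1 + val2 l = 2 ^ size l.
  by elim: l => //= b l; rewrite expnS; case: b => /=; lia.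
have := H (tobits B n); rewrite size_tobits val2_tobits /=; set u := val2 _ => e.
have en := divn_eq n (2 ^ B).
have -> : Posz (u + (1 + 0.*2)) = (Posz (n %/ 2 ^ B).+1 * (ztwo B) + - Posz n)%R.
  have e2 : u + 1 + n = (n %/ 2 ^ B).+1 * 2 ^ B by rewrite mulSn {1}en; lia.
  by rewrite /ztwo -PoszM -e2; lia.
by rewrite modzMDl.
Qed.

Section Eval.
Variables (B : nat) (ps : seq (bool * seq bool)) (h : seq nat).

Definition vstep (vs : seq (seq bool)) (g : agate) : seq bool :=
  match g with
  | AVar i => tobits B (nth 0 h i)
  | AParam i => if (nth (false, [::]) ps i).1
      then neg_bits B (tobits B (val2 (nth (false, [::]) ps i).2))
      else tobits B (val2 (nth (false, [::]) ps i).2)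
  | AAdd i j => tobits B (val2 (nth [::] vs i) + val2 (nth [::] vs j))
  | AMul i j => tobits B (val2 (nth [::] vs i) * val2 (nth [::] vs j))
  end.

(** Reduction modulo [2 ^ B] is a ring homomorphism, so it commutes with every gate. *)
Lemma vstep_values gs : slp_values vstep gs =
  map (ztobits B) (slp_values (astep (map pint ps) (map Posz h)) gs).
Proof.
elim/last_ind: gs => // gs g IH; rewrite !slp_values_rcons map_rcons; congr rcons => //.
rewrite IH; set vs := slp_values _ gs.
have N j : (Posz (val2 (nth [::] (map (ztobits B) vs) j)) = nth 0%R vs j %[mod (ztwo B)])%Z.
  case: (ltnP j (size vs)) => hj; last by rewrite !nth_default ?size_map.
  by rewrite (nth_map 0%R) // val2_ztobits modz_mod.
case: g => [i|i|i j|i j] /=.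
- apply: ztobits_eq; case: (ltnP i (size h)) => hi; first by rewrite (nth_map 0).
  by rewrite !nth_default ?size_map.
- case: (ltnP i (size ps)) => hi; last first.
    by rewrite !nth_default ?size_map //=; apply: ztobits_eq.
  rewrite (nth_map (false, [::])) // /pint; case: ifP => _; first by rewrite neg_bitsE.
  exact: ztobits_eq.
- by apply: ztobits_eq; rewrite PoszD -modzDm !N modzDm.
- by apply: ztobits_eq; rewrite PoszM -modzMm !N modzMm.
Qed.

Definition vzero gs := all negb (last [::] (slp_values vstep gs)).
End Eval.

(** A multiple of [2 ^ B] of absolute value below [2 ^ B] is zero. *)
Lemma vzeroP B P h : (`|neval P h| < 2 ^ B)%N ->
  vzero B (map sign_abs (aparams P)) h (agates P) = (neval P h == 0%R).
Proof.
rewrite /vzero vstep_values /neval /aeval -map_comp.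
have -> : map (pint \o sign_abs) (aparams P) = aparams P.
  by rewrite -[RHS]map_id; apply: eq_map => z; rewrite /= pint_sign_abs.
set vs := slp_values _ _ => hb.
have -> : all negb (last [::] (map (ztobits B) vs)) = ((ztwo B) %| last 0%R vs)%Z.
  by case: vs {hb} => [|x vs] /=; rewrite ?dvdz0 // last_map ztobits0.
apply/idP/eqP => [|->]; last by rewrite dvdz0.
by rewrite /dvdz /= => /dvdn_leq hd; apply/eqP; rewrite -absz_eq0; case: posnP => // /hd h'; move: hb; rewrite ltnNge h'.
Qed.

Definition parse_sint (s : seq bool) := ((head false s, (parse_bits (behead s)).1), (parse_bits (behead s)).2).
Definition parse_agate cap (s : seq bool) : agate * seq bool :=
  let r := drop 2 s in
  if nth false s 0 then
    if nth false s 1 then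
      (AMul (parse_nat cap r).1 (parse_nat cap (parse_nat cap r).2).1,
       (parse_nat cap (parse_nat cap r).2).2)
    else
      (AAdd (parse_nat cap r).1 (parse_nat cap (parse_nat cap r).2).1,
       (parse_nat cap (parse_nat cap r).2).2)
  else if nth false s 1 then (AParam (parse_nat cap r).1, (parse_nat cap r).2)
  else (AVar (parse_nat cap r).1, (parse_nat cap r).2).
Definition parse_acircuit cap (s : seq bool) :=
  let p := parse_list parse_sint s in (p.1, (parse_list (parse_agate cap) p.2).1).

Definition aargs_le cap (g : agate) := ((agate_rep g).2.1 <= cap) && ((agate_rep g).2.2 <= cap).
Lemma parse_agateP cap g r : aargs_le cap g -> parse_agate cap (agate_code g ++ r) = (g, r).
Proof.
have H n r' : n <= cap -> parse_nat cap (nat_code n ++ r') = (n, r') := @parse_natP cap n r'.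
rewrite /parse_agate /agate_code; move: (parse_nat cap) nat_code H => P N H.
by case: g => [i|i|j k|j k]; case/andP=> /= h1 h2; rewrite ?drop0 -?catA ?H //= ?H.
Qed.

Lemma size_list_code (X : Type) (c : X -> bits) xs : size xs <= size (list_code c xs).
Proof.
rewrite /list_code size_cat; apply: leq_trans (leq_addr _ _).
by elim: xs => //= x xs IH; rewrite size_cat; lia.
Qed.

Lemma acircuit_sizes P s : size (acircuit_code P) <= s ->
  size (aparams P) <= s /\ size (agates P) <= s.
Proof.
rewrite /acircuit_code size_cat => h.
have h1 := size_list_code int_code (aparams P).
by have h2 := size_list_code agate_code (agates P); split; lia.
Qed.

(** The plugged constants are spelled out in binary inside the code of the circuit. *)
Lemma param_bound P s z : size (acircuit_code P) <= s -> z \in aparams P -> (`|z| < 2 ^ s)%N.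
Proof.
move=> h hz; apply: leq_trans (binlen_gt _) _; rewrite leq_pexp2l //; apply: leq_trans h.
rewrite /acircuit_code size_cat; apply: leq_trans (leq_addr _ _).
rewrite /list_code size_cat; apply: leq_trans (leq_addr _ _).
elim: (aparams P) hz => //= x xs IH; rewrite inE size_cat => /orP[/eqP->|/IH h]; last by lia.
apply: leq_trans (_ : size (nat_code `|x|%N) <= _); last by lia.
by apply: leq_trans (size_list_code _ _); rewrite size_mkseq.
Qed.

Lemma parse_acircuitP cap n d s P w : Ckt n d s P -> prefix (acircuit_code P) w -> n + s <= cap ->
  parse_acircuit cap w = (map sign_abs (aparams P), agates P).
Proof.
move=> [wf _ hs] /prefixP[r ->] hc; have [s1 s2] := acircuit_sizes hs.
pose c' (p : bool * seq bool) := p.1 :: list_code (fun b : bool => [:: b]) p.2.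
have -> : acircuit_code P ++ r =
    list_code c' (map sign_abs (aparams P)) ++ (list_code agate_code (agates P) ++ r).
  by rewrite catA; congr (_ ++ r); rewrite /acircuit_code; congr cat; rewrite /list_code -map_comp.
rewrite /parse_acircuit parse_list_code; last first.
  by move=> [b l] r1 _; exact: (congr1 (fun p => ((b, p.1), p.2)) (parse_bitsP l r1)).
cbn [fst snd]; rewrite parse_list_code // => g r' hg; apply: parse_agateP.
move: wf s2 hg; elim/last_ind: (agates P) => // gs g' IH.
rewrite slp_wf_rcons size_rcons -cats1 => /andP[h1 h2] hs2 /List.in_app_iff[/(IH h1 (ltnW hs2)) //|[<-|//]].
by rewrite /aargs_le; case: g' h2 => //= [i|i|i j|i j]; lia.
Qed.

(** This is [aeval_bound] with leaves at most [2 ^ (q + s)] and at most [s] gates and [s]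
    parameters; the successor makes the inequality strict. *)
Definition eval_width n d s q := ((q + s + s) * ((n + s) * d)).+1.

Lemma neval_bound n d s q P h : Ckt n d s P -> all (fun t => t < q) h ->
  (`|neval P h| < 2 ^ eval_width n d s q)%N.
Proof.
move=> [wf hd hs] hq; have [s1 s2] := acircuit_sizes hs.
rewrite /eval_width; set X := (_ * _); apply: leq_trans (_ : (2 ^ X).+1 <= _); last first.
  by rewrite expnS mul2n -addnn -addn1 leq_add2l expn_gt0.
rewrite ltnS /neval /X; apply: leq_trans (@aeval_bound P n d (q + s) (map Posz h) hd wf _ _) _.
- move=> i; case: (ltnP i (size h)) => hi; last by rewrite nth_default ?size_map.
  rewrite (nth_map 0) //; apply: leq_trans (_ : q <= _).
    exact: ltnW (allP hq _ (mem_nth 0 hi)).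
  by apply: leq_trans (leq_addr s q) (ltnW (ltn_expl _ _)).
- move=> i; case: (ltnP i (size (aparams P))) => hi; last by rewrite nth_default.
  apply: leq_trans (ltnW (param_bound hs (mem_nth 0%R hi))) _.
  by rewrite leq_pexp2l // leq_addl.
- rewrite leq_pexp2l //; apply: leq_mul; first by rewrite leq_add2l.
  by rewrite leq_mul2r leq_add2l s1 orbT.
Qed.

(* Zero test at [h] of the circuit denoted by the word [w]; garbage unless [w] starts with the code of a circuit of [Ckt n d s] and the entries of [h] are below [q]. *)
Definition zero_at n d s q (w : seq bool) (h : seq nat) :=
  let p := parse_acircuit (n + s) w in
  vzero (eval_width n d s q) p.1 h p.2.

Lemma zero_atP n d s q P w h : Ckt n d s P -> prefix (acircuit_code P) w ->
  all (fun t => t < q) h -> zero_at n d s q w h = (neval P h == 0%R).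
Proof.
move=> hP hw hq; rewrite /zero_at (parse_acircuitP hP hw (leqnn _)).
by apply: vzeroP; apply: neval_bound.
Qed.

Section Pt.
Variable O : language.
Local Notation pt := (pt O).

Lemma pt_agate_rep (E : encType) (f : E -> agate) : pt f -> pt (fun e => agate_rep (f e)).
Proof. by move=> h; apply: (pt_recode h). Qed.
Lemma pt_AVar (E : encType) (f : E -> nat) : pt f -> pt (fun e => AVar (f e)).
Proof. by move=> h; apply: (pt_recode (f := fun e => (0, (f e, 0)))); ptt. Qed.
Lemma pt_AParam (E : encType) (f : E -> nat) : pt f -> pt (fun e => AParam (f e)).
Proof. by move=> h; apply: (pt_recode (f := fun e => (1, (f e, 0)))); ptt. Qed.
Lemma pt_AAdd (E : encType) (f g : E -> nat) : pt f -> pt g -> pt (fun e => AAdd (f e) (g e)).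
Proof. by move=> h h'; apply: (pt_recode (f := fun e => (2, (f e, g e)))); ptt. Qed.
Lemma pt_AMul (E : encType) (f g : E -> nat) : pt f -> pt g -> pt (fun e => AMul (f e) (g e)).
Proof. by move=> h h'; apply: (pt_recode (f := fun e => (3, (f e, g e)))); ptt. Qed.

Lemma pt_agate_code (E : encType) (f : E -> agate) : pt f -> pt (fun e => agate_code (f e)).
Proof.
move=> /pt_agate_rep h.
apply: (pt_ext (f := fun e => let r := agate_rep (f e) in
  if r.1 == 0 then [:: false; false] ++ nat_code r.2.1
  else if r.1 == 1 then [:: false; true] ++ nat_code r.2.1
  else if r.1 == 2 then [:: true; false] ++ nat_code r.2.1 ++ nat_code r.2.2
  else [:: true; true] ++ nat_code r.2.1 ++ nat_code r.2.2)).
  by move=> e; case: (f e).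
by ptt.
Qed.

Lemma pt_parse_agate (E : encType) (cap : E -> nat) (s : E -> seq bool) :
  pt cap -> pt s -> pt (fun e => parse_agate (cap e) (s e)).
Proof.
move=> hc hs.
have h1 : pt (fun e => parse_nat (cap e) (drop 2 (s e))) by ptt.
have h2 : pt (fun e => parse_nat (cap e) (parse_nat (cap e) (drop 2 (s e))).2) by ptt.
have c1 := pt_AMul; have c2 := pt_AAdd; have c3 := pt_AParam; have c4 := pt_AVar.
by rewrite /parse_agate; ptt; [apply: c1 | apply: c2 | apply: c3 | apply: c4]; ptt.
Qed.
Lemma parse_agate_size cap s : size (parse_agate cap s).2 <= size s.
Proof.
have h1 := parse_nat_size cap (drop 2 s).
have h2 := parse_nat_size cap (parse_nat cap (drop 2 s)).2.
have h3 : size (drop 2 s) <= size s by rewrite size_drop; lia.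
have h4 := leq_trans h1 h3; have h5 := leq_trans h2 h4.
by rewrite /parse_agate; case: ifP => _; case: ifP.
Qed.
Lemma pt_parse_acircuit (E : encType) (cap : E -> nat) (s : E -> seq bool) :
  pt cap -> pt s -> pt (fun e => parse_acircuit (cap e) (s e)).
Proof.
move=> hc hs.
have h1 : pt (fun e => parse_list parse_sint (s e)).
  apply: (pt_parse_list (p := fun _ => parse_sint)) => //; first by rewrite /parse_sint; ptt.
  by move=> _ r; apply: leq_trans (parse_bits_size _) _; rewrite size_behead leq_pred.
have h2 : pt (fun e => parse_list (parse_agate (cap e)) (parse_list parse_sint (s e)).2).
  apply: (pt_parse_list (p := fun e => parse_agate (cap e))); ptt.
    by apply: pt_parse_agate; ptt.
  by move=> e r; apply: parse_agate_size.
by rewrite /parse_acircuit; ptt.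
Qed.

Lemma pt_vzero (E : encType) (B : E -> nat) (ps : E -> seq (bool * seq bool)) (h : E -> seq nat)
    (gs : E -> seq agate) :
  pt B -> pt ps -> pt h -> pt gs -> pt (fun e => vzero (B e) (ps e) (h e) (gs e)).
Proof.
move=> hB hp hh hg.
have hneg (E' : encType) (B' : E' -> nat) (v : E' -> seq bool) : pt B' -> pt v ->
    pt (fun e => neg_bits (B' e) (v e)).
  move=> hB' hv; apply: (pt_add2 (a := fun e => map negb (v e)) (b := fun e => [:: true])); ptt.
have hv : pt (fun e => slp_values (vstep (B e) (ps e) (h e)) (gs e)).
  apply: (pt_foldl_add (step := fun e vs g => rcons vs (vstep (B e) (ps e) (h e) vs g))); ptt.
    have hr : pt (fun q : (E * seq (seq bool)) * agate => agate_rep q.2).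
      by apply: pt_agate_rep; ptt.
    apply: (pt_ext (f := fun q : (E * seq (seq bool)) * agate => let r := agate_rep q.2 in
      let B := B q.1.1 in let p := nth (false, [::]) (ps q.1.1) r.2.1 in
      if r.1 == 0 then tobits B (nth 0 (h q.1.1) r.2.1)
      else if r.1 == 1 then if p.1 then neg_bits B (tobits B (val2 p.2)) else tobits B (val2 p.2)
      else if r.1 == 2 then tobits B (val2 (nth [::] q.1.2 r.2.1) + val2 (nth [::] q.1.2 r.2.2))
      else tobits B (val2 (nth [::] q.1.2 r.2.1) * val2 (nth [::] q.1.2 r.2.2)))).
      by move=> q; case: (q.2).
    by ptt; apply: hneg; ptt.
  exists (fun e => 4 * B e + 2); first by bdt.
  move=> e s g _; rewrite sz_rcons -addnA leq_add2l.
  have hs : size (vstep (B e) (ps e) (h e) s g) = B e.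
    by case: g => [i|i|i j|i j] /=; try case: ifP => _; rewrite /neg_bits size_tobits.
  by have := sz_bits (vstep (B e) (ps e) (h e) s g); rewrite hs; lia.
by rewrite /vzero; ptt.
Qed.

Lemma pt_zero_at (E : encType) (n d s q : E -> nat) (w : E -> seq bool) (h : E -> seq nat) :
  pt n -> pt d -> pt s -> pt q -> pt w -> pt h ->
  pt (fun e => zero_at (n e) (d e) (s e) (q e) (w e) (h e)).
Proof.
move=> hn hd hs hq hw hh.
have hp : pt (fun e => parse_acircuit (n e + s e) (w e)) by apply: pt_parse_acircuit; ptt.
by rewrite /zero_at /eval_width; apply: pt_vzero; ptt.
Qed.

Lemma pt_divn (E : encType) (f g : E -> nat) : pt f -> pt g -> pt (fun e => f e %/ g e).
Proof.
move=> hf hg; apply: (pt_ext (f := fun e => if g e == 0 then 0 else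
    size (filter (fun i => i.+1 * g e <= f e) (iota 0 (f e))))); last by ptt.
move=> e; case: (posnP (g e)) => [->|g0]; first by rewrite divn0.
rewrite -[RHS](minn_idPl (leq_div _ _)) -size_filter_lt.
by congr size; apply: eq_filter => i; rewrite leq_divRL.
Qed.
Lemma pt_modn (E : encType) (f g : E -> nat) : pt f -> pt g -> pt (fun e => f e %% g e).
Proof.
move=> hf hg; have hd := pt_divn hf hg.
apply: (pt_ext (f := fun e => f e - f e %/ g e * g e)); last by ptt.
by move=> e; rewrite {1}(divn_eq (f e) (g e)) addnC addnK.
Qed.

Lemma pt_row_decode (E : encType) (Z : E -> seq nat -> bool) (d q : E -> nat) (a : E -> seq nat)
    (e : E -> nat) (o : E -> seq nat) :
  pt (fun x : E * seq nat => Z x.1 x.2) -> pt d -> pt q -> pt a -> pt e -> pt o ->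
  pt (fun x => row_decode (d x) (Z x) (q x) (a x) (e x) (o x)).
Proof.
move=> hZ hd hq ha he ho.
pose i x := e x %/ d x; have hi : pt i := pt_divn he hd.
pose j x := e x %% d x; have hj : pt j := pt_modn he hd.
apply: (pt_ext (f := fun x => take (i x) (o x) ++ nth 0 [seq t <- iota 0 (q x) |
  Z x (take (i x) (a x) ++ t :: drop (i x) (o x))] (j x) :: drop (i x) (o x))) => //.
by ptt.
Qed.
End Pt.

Ltac pt_hook4 ::=
  match goal with
  | |- pt _ (fun e => @?f e %/ @?g e) => simple apply pt_divn
  | |- pt _ (fun e => @?f e %% @?g e) => simple apply pt_modn
  | |- pt _ (fun e => AVar (@?f e)) => simple apply pt_AVar
  | |- pt _ (fun e => AParam (@?f e)) => simple apply pt_AParam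
  | |- pt _ (fun e => AAdd (@?f e) (@?g e)) => simple apply pt_AAdd
  | |- pt _ (fun e => AMul (@?f e) (@?g e)) => simple apply pt_AMul
  | |- pt _ (fun e => agate_code (@?f e)) => simple apply pt_agate_code
  end.

(** * Oracles and reductions *)

Lemma upd_upd s i w w' : update (update s i w) i w' = update s i w'.
Proof. by apply: functional_extensionality => j; rewrite /update; case: eqP. Qed.

(** A tag bit in front of every query directs it to one half of a joined oracle; the running time at
    most doubles. *)
Fixpoint tag_queries (b : bool) (c : cmd) : cmd :=
  match c with
  | Query i => Seq (Push i b) (Query i)
  | Seq c1 c2 => Seq (tag_queries b c1) (tag_queries b c2)
  | Case i c0 c1 c2 => Case i (tag_queries b c0) (tag_queries b c1) (tag_queries b c2)
  | While i c => While i (tag_queries b c)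
  | c => c
  end.

Lemma exec_tag O J b c s s' t : (forall w, J (b :: w) <-> O w) -> exec O c s s' t ->
  runs J (tag_queries b c) s s' (2 * t).
Proof.
move=> hJ; elim=> {c s s' t} /=.
- by move=> s; apply: runs_le (runs_skip _ _) _.
- by move=> s i b'; apply: runs_le (runs_push _ _ _ _) _.
- by move=> s i; apply: runs_le (runs_pop _ _ _) _.
- move=> s i h; apply: (@runs_seq _ _ _ _ _ _ 1 1); first exact: runs_push.
  rewrite -(upd_upd s i (b :: s i) [:: true]); exists 1 => //.
  by apply: ExecQueryYes; rewrite /update eqxx; apply/hJ.
- move=> s i h; apply: (@runs_seq _ _ _ _ _ _ 1 1); first exact: runs_push.
  rewrite -(upd_upd s i (b :: s i) [:: false]); exists 1 => //.
  by apply: ExecQueryNo; rewrite /update eqxx => /hJ.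
- by move=> c1 c2 s s1 s2 t1 t2 _ h1 _ h2; rewrite mulnDr; apply: runs_seq h1 h2.
- move=> i c0 cF cT s s1 t _ h; apply: (@runs_le _ _ _ _ (2 * t).+1); last lia.
  by apply: runs_case; case: (s i) h => [|[] w].
- by move=> i c s h; apply: runs_le (runs_stop _ _ h) _.
- move=> i c s s1 s2 t1 t2 h _ h1 _ h2; apply: (@runs_le _ _ _ _ (2 * t1 + 2 * t2).+1); last lia.
  exact: runs_loop h h1 h2.
Qed.

Lemma pt_tag O J b (E F : encType) (f : E -> F) : (forall w, J (b :: w) <-> O w) ->
  pt O f -> pt J f.
Proof.
move=> hJ [c [k h]]; apply: (pt_mk (c := tag_queries b c) (p := fun n => 2 * pw k n)); first by pbt.
move=> a r; have [t ht l] := h a r.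
by apply: runs_le (exec_tag hJ ht) _; rewrite leq_mul2l l.
Qed.

Definition join (L1 L2 : language) : language := fun w =>
  if w is b :: v then if b then L1 v else L2 v else False.

Lemma eq_bits_all (a b : seq bool) :
  (a == b) = (size a == size b) && all (fun p => p.1 == p.2) (zip a b).
Proof. by elim: a b => [|x a IH] [|y b] //=; rewrite eqseq_cons IH eqSS andbCA. Qed.

Lemma pt_eqbits O (E : encType) (a b : E -> seq bool) : pt O a -> pt O b ->
  pt O (fun e => a e == b e).
Proof.
move=> ha hb; apply: (pt_ext (f := fun e => (size (a e) == size (b e)) && all (fun p => p.1 == p.2) (zip (a e) (b e)))).
  by move=> e; rewrite eq_bits_all.
have hz : pt O (fun e => zip (a e) (b e)) by apply: (pt_zip false false).
by apply: pt_andb; [ptt | apply: (pt_all (X := prod_enc bool_enc bool_enc) (p := fun _ p => p.1 == p.2)) => //; ptt].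
Qed.

(** The common bound on witnesses is more generous than either of the two original ones, so the
    verifier itself checks the bound of the language selected by the tag. *)
Lemma NP_join L1 L2 : NP L1 -> NP L2 -> NP (join L1 L2).
Proof.
move=> [V1 [e1 [h1 H1]]] [V2 [e2 [h2 H2]]].
pose ok e (v z : seq bool) := size z <= size v ^ e + e.
pose V (p : bits * bits) : bits := match p.1 with
  | [::] => [::]
  | b :: v => if b then (if ok e1 v p.2 then V1 [:: v; p.2] else [::])
              else (if ok e2 v p.2 then V2 [:: v; p.2] else [::])
  end.
have i1 := pt_import2 h1; have i2 := pt_import2 h2.
have hV : pt (fun _ => False) V.
  rewrite /V /ok; ptt.
  - by apply: (pt_comp2 (f := fun v z => V1 [:: v; z])); ptt.
  - by apply: (pt_comp2 (f := fun v z => V2 [:: v; z])); ptt.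
exists (fun xs => V (nth [::] xs 0, nth [::] xs 1)), (e1 + e2); split; first exact: pt_export2.
have hb e (v : bits) : e <= e1 + e2 -> size v ^ e + e <= (size v).+1 ^ (e1 + e2) + (e1 + e2).
  move=> he; apply: leq_add => //; apply: leq_trans (_ : (size v).+1 ^ e <= _).
    by case: (e) => // e'; rewrite leq_exp2r.
  by rewrite leq_pexp2l.
move=> [|[] v]; rewrite /V /=.
- by split=> // -[].
- rewrite H1; split=> -[z hz hv]; exists z.
  + exact: leq_trans hz (hb e1 v (leq_addr e2 e1)).
  + by rewrite /ok hz.
  + by move: hv; rewrite /ok; case: ifP.
  + by move: hv; rewrite /ok; case: ifP.
- rewrite H2; split=> -[z hz hv]; exists z.
  + exact: leq_trans hz (hb e2 v (leq_addl e1 e2)).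
  + by rewrite /ok hz.
  + by move: hv; rewrite /ok; case: ifP.
  + by move: hv; rewrite /ok; case: ifP.
Qed.

Lemma NP_none : NP (fun _ => False).
Proof.
exists (fun _ => [::]), 0; split; last by move=> x; split=> // -[].
have h := @pt_export2 (fun _ => False) (fun _ => [::]) (pt_const _ _ _).
exact: h.
Qed.

Lemma polytime_NP k f : polytime k f -> polytimeNP k f.
Proof. by exists (fun _ => False) => //; exact: NP_none. Qed.

Lemma pt_joinl L1 L2 (E F : encType) (f : E -> F) : pt L1 f -> pt (join L1 L2) f.
Proof. by apply: (pt_tag (b := true)). Qed.
Lemma pt_joinr L1 L2 (E F : encType) (f : E -> F) : pt L2 f -> pt (join L1 L2) f.
Proof. by apply: (pt_tag (b := false)). Qed.

Lemma P_PNP_reducibleW A B : P_PNP_reducible A B -> PNP_reducible A B.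
Proof. by case=> f [g [hf hg h]]; exists f, g; split=> //; apply: polytime_NP. Qed.

(* The forward map must be computable relative to every oracle, because in a composition it runs after another forward map that may use one. *)
Definition strong_reduction (L : language) (f : bits -> bits) (g : bits * bits -> bits) (A B : search_problem) :=
  [/\ forall O, pt O f, NP L, pt L g & forall x, instance A x -> instance B (f x) /\
    forall y, solution B (f x) y -> solution A x (g (x, y))].

Lemma strong_P_PNP L f g A B : strong_reduction L f g A B -> P_PNP_reducible A B.
Proof.
case=> hf hL hg h; exists (fun xs => f (nth [::] xs 0)), (fun xs => g (nth [::] xs 0, nth [::] xs 1)); split.
- exact: pt_export1.
- by exists L => //; apply: pt_export2.
- exact: h.
Qed.

(** To use [g], the backward map has to recompute the intermediate instance. It therefore needs the
    oracle of [f1] besides those of both backward maps. *)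
Lemma compose_reductions La L f g f1 g1 A B C : strong_reduction L f g B C ->
  NP La -> polytime_oracle La 1 f1 -> polytimeNP 2 g1 ->
  (forall x, instance A x -> instance B (f1 [:: x]) /\
    forall y, solution B (f1 [:: x]) y -> solution A x (g1 [:: x; y])) ->
  exists f' g', [/\ polytime_oracle La 1 f', polytimeNP 2 g' &
    forall x, instance A x -> instance C (f' [:: x]) /\
      forall y, solution C (f' [:: x]) y -> solution A x (g' [:: x; y])].
Proof.
case=> hf hL hg h hLa hf1 [Lb hLb hg1] h1.
have i1 := pt_import1 hf1; have j1 := pt_import2 hg1.
exists (fun xs => f (f1 [:: nth [::] xs 0])).
exists (fun xs => g1 [:: nth [::] xs 0; g (f1 [:: nth [::] xs 0], nth [::] xs 1)]); split.
- apply: (pt_export1 (f := fun x => f (f1 [:: x]))).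
  exact: (pt_comp i1 (hf La)).
- exists (join (join La Lb) L); first by do 2 apply: NP_join => //.
  have k1 : pt (join (join La Lb) L) (fun x : bits => f1 [:: x]) by do 2 apply: pt_joinl.
  have k2 : pt (join (join La Lb) L) (fun p : bits * bits => g1 [:: p.1; p.2]).
    by apply: pt_joinl; apply: pt_joinr.
  have k3 : pt (join (join La Lb) L) g by apply: pt_joinr.
  apply: (pt_export2 (f := fun p => g1 [:: p.1; g (f1 [:: p.1], p.2)])).
  apply: (pt_comp2 (f := fun x y => g1 [:: x; y]) k2); first by ptt.
  apply: (pt_comp (g := g)) => //; apply: pt_pair; last by ptt.
  by apply: (pt_comp (g := fun x => f1 [:: x])) => //; ptt.
- move=> x /h1 [hB hs]; have [hC ht] := h _ hB; split=> // y /ht hy.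
  exact: hs.
Qed.

(** * From hitting sets to range avoidance *)

Definition skip_unary k (x : seq bool) := iter k (fun s => (parse_unary s).2) x.
Definition unary_arg k x := (parse_unary (skip_unary k x)).1.
(** The length of the instance is a sufficient cap: gate positions are below the number of gates,
    and input indices are below a number written in unary. *)
Definition circuit_arg k x := (parse_circuit (size x) (skip_unary k x)).1.

Lemma unary_codes_cons k (ks : seq nat) r :
  flatten [seq unary_code k | k <- k :: ks] ++ r =
  unary_code k ++ (flatten [seq unary_code k | k <- ks] ++ r).
Proof. by rewrite catA. Qed.
Lemma unary_args (ks : seq nat) r i : i < size ks ->
  unary_arg i (flatten [seq unary_code k | k <- ks] ++ r) = nth 0 ks i.
Proof.
rewrite /unary_arg /skip_unary; elim: ks i => // k ks IH [|i] hi; rewrite unary_codes_cons; first by rewrite parse_unaryP.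
by rewrite iterSr parse_unaryP; apply: IH.
Qed.
Lemma skip_unary_args (ks : seq nat) r :
  skip_unary (size ks) (flatten [seq unary_code k | k <- ks] ++ r) = r.
Proof.
rewrite /skip_unary; elim: ks => // k ks IH.
by rewrite unary_codes_cons [size _]/= iterSr parse_unaryP.
Qed.
Lemma unary_code_inj k k' r r' : unary_code k ++ r = unary_code k' ++ r' -> k = k' /\ r = r'.
Proof. by move=> h; have := parse_unaryP k r; rewrite h parse_unaryP => -[-> ->]. Qed.

(** Solutions are stated for some reading of the instance word; injectivity identifies that reading
    with the instance at hand. *)
Lemma EMPTY_code_inj m m' C C' : EMPTY_code m C = EMPTY_code m' C' -> m = m' /\ C = C'.
Proof.
move=> /unary_code_inj[-> h]; split=> //.
by have := @bcircuit_code_inj C C' [::] [::]; rewrite !cats0 => /(_ h) [].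
Qed.
Lemma hitting_set_input_code_inj I I' : hitting_set_input_code I = hitting_set_input_code I' -> I = I'.
Proof.
case: I => n d s q r m D; case: I' => n' d' s' q' r' m' D'.
rewrite /hitting_set_input_code !unary_codes_cons.
cbn [hs_n hs_d hs_s hs_q hs_r hs_m hs_D].
do 6 (move=> /unary_code_inj[->]).
move=> h; have := @bcircuit_code_inj D D' [::] [::].
by rewrite !cats0 => /(_ h) [->].
Qed.

Lemma size_unary_code k : size (unary_code k) = k.+1.
Proof. by rewrite size_cat size_nseq addn1. Qed.

Lemma circuit_argP (ks : seq nat) m p C : bcircuit_wf m p C -> m \in ks ->
  circuit_arg (size ks) (flatten [seq unary_code k | k <- ks] ++ bcircuit_code C) = C.
Proof.
move=> wf hm; rewrite /circuit_arg skip_unary_args -[bcircuit_code C]cats0.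
have hg : size (bgates C) <= size (bcircuit_code C).
  rewrite /bcircuit_code size_cat; apply: leq_trans (leq_addr _ _).
  rewrite /list_code size_cat; apply: leq_trans (leq_addr _ _).
  by elim: (bgates C) => //= x s IH; rewrite size_cat; lia.
have hk : m < size (flatten [seq unary_code k | k <- ks]).
  elim: (ks) hm => //= k ks' IH; rewrite inE size_cat size_unary_code => /orP[/eqP->|/IH]; lia.
rewrite (parse_circuitP _ wf) //; rewrite size_cat cats0; lia.
Qed.

Section PtArgs.
Variable O : language.
Lemma pt_skip_unary (E : encType) k (x : E -> seq bool) : pt O x -> pt O (fun e => skip_unary k (x e)).
Proof.
move=> h; elim: k => //= k IH.
exact: (pt_snd (pt_parse_unary IH)).
Qed.
Lemma pt_unary_arg (E : encType) k (x : E -> seq bool) : pt O x -> pt O (fun e => unary_arg k (x e)).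
Proof. by move=> h; apply: pt_fst; apply: pt_parse_unary; apply: pt_skip_unary. Qed.
Lemma pt_circuit_arg (E : encType) k (x : E -> seq bool) : pt O x -> pt O (fun e => circuit_arg k (x e)).
Proof.
move=> h; have hs := pt_skip_unary k h.
by apply: (pt_fst (F := seq_enc bool_enc)); apply: pt_parse_circuit; ptt.
Qed.
End PtArgs.

(* The seed consists of an index [x0] into the class ([m] bits), the coordinates of a nonzero point, each at most [d] ([binlen q - 1] bits per coordinate), and a number holding in mixed radix, for each of the [r] roots, the data needed by [row_decode], and the quotient of the output by [q ^ (r * n)]. *)
Definition seed_point n q (z : seq bool) : seq nat :=
  [seq capped q (take (binlen q).-1 (drop (i * (binlen q).-1) z)) | i <- iota 0 n].
Definition seed_rows n q r (u : seq bool) : seq nat * seq nat * seq bool :=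
  let u' := tobits (size u) (val2 u %/ (q./2).-1.+1 ^ r) in
  (digits (q./2).-1.+1 r (val2 u), digits q.-1.+1 (r * n.-1) (val2 u'),
   tobits (size u') (val2 u' %/ q.-1.+1 ^ (r * n.-1))).

(** The result is to be one bit longer than the seed. It is an arbitrary word, of which the points
    are the lowest [r * n] digits in radix [q]; the part above them comes from the seed as well. *)
Definition roots_of_seed n d s q r m (D : bcircuit) (z : seq bool) : seq bool :=
  let w := beval D (take m z) in
  let a := seed_point n q (drop m z) in
  let t := seed_rows n q r (drop (n * (binlen q).-1) (drop m z)) in
  let rows := flatten [seq row_decode d (zero_at n d s q w) q a (nth 0 t.1.1 k)
     (take n.-1 (drop (k * n.-1) t.1.2)) | k <- iota 0 r] in
  tobits (r * n * binlen q).+1 (undigits q rows (val2 t.2)).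

Lemma pt_roots_of_seed O (E : encType) (n d s q r m : E -> nat) (D : E -> bcircuit) (z : E -> seq bool) :
  pt O n -> pt O d -> pt O s -> pt O q -> pt O r -> pt O m -> pt O D -> pt O z ->
  pt O (fun e => roots_of_seed (n e) (d e) (s e) (q e) (r e) (m e) (D e) (z e)).
Proof.
move=> hn hd hs hq hr hm hD hz.
pose w e := beval (D e) (take (m e) (z e)); have hw : pt O w by rewrite /w; ptt.
pose a e := seed_point (n e) (q e) (drop (m e) (z e)).
have ha : pt O a by rewrite /a /seed_point; ptt; apply: pt_capped; ptt.
pose t e := seed_rows (n e) (q e) (r e) (drop (n e * (binlen (q e)).-1) (drop (m e) (z e))).
have ht : pt O t.
  pose u e := drop (n e * (binlen (q e)).-1) (drop (m e) (z e)).
  have hu : pt O u by rewrite /u; ptt.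
  pose u' e := tobits (size (u e)) (val2 (u e) %/ ((q e)./2).-1.+1 ^ (r e)).
  have hu' : pt O u' by apply: (pt_digits_rest (q := fun e => (q e)./2)) => //; ptt.
  apply: (pt_ext (f := fun e => (digits ((q e)./2).-1.+1 (r e) (val2 (u e)),
    digits (q e).-1.+1 (r e * (n e).-1) (val2 (u' e)),
    tobits (size (u' e)) (val2 (u' e) %/ (q e).-1.+1 ^ (r e * (n e).-1))))) => //.
  apply: pt_pair; first apply: pt_pair.
  - by apply: (pt_digits (q := fun e => (q e)./2)) => //; ptt.
  - by apply: pt_digits => //; ptt.
  - by apply: pt_digits_rest => //; ptt.
apply: (pt_ext (f := fun e => tobits (r e * n e * binlen (q e)).+1 (undigits (q e)
   (flatten [seq row_decode (d e) (zero_at (n e) (d e) (s e) (q e) (w e)) (q e) (a e) (nth 0 (t e).1.1 k)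
     (take (n e).-1 (drop (k * (n e).-1) (t e).1.2)) | k <- iota 0 (r e)]) (val2 (t e).2)))) => //.
apply: pt_undigits; ptt.
apply: (pt_row_decode (Z := fun (x : E * nat) => zero_at (n x.1) (d x.1) (s x.1) (q x.1) (w x.1))); ptt.
by apply: pt_zero_at; ptt.
Qed.

(** * Compressing a list of roots *)

Lemma slice_flatten (T : Type) (w : nat) (l : seq (seq T)) r i : (forall x, List.In x l -> size x = w) ->
  i < size l -> take w (drop (i * w) (flatten l ++ r)) = nth [::] l i.
Proof.
elim: l i => // x l IH [|i] h hi; rewrite /= -catA; have hx := h x (or_introl erefl).
  by rewrite drop0 -hx take_size_cat.
rewrite drop_cat mulSn hx ltnNge leq_addr /= addKn; apply: IH => //.
by move=> y hy; apply: h; right.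
Qed.

Lemma size_flatten_const (T : Type) w (l : seq (seq T)) : (forall x, List.In x l -> size x = w) ->
  size (flatten l) = size l * w.
Proof.
elim: l => //= x l IH h; rewrite size_cat mulSn IH ?(h x) //; first by left.
by move=> y hy; apply: h; right.
Qed.
Lemma flatten_slices (T : Type) w r (l : seq T) :
  flatten [seq take w (drop (k * w) l) | k <- iota 0 r] = take (r * w) l.
Proof.
elim: r => [|r IH]; first by rewrite take0.
by rewrite mulSnr takeD -[r.+1]addn1 iotaD map_cat flatten_cat IH /= cats0.
Qed.
Lemma In_mkseq (T : Type) (f : nat -> T) n x : List.In x (mkseq f n) -> exists2 i, i < n & x = f i.
Proof.
rewrite /mkseq; have : forall i, i \in iota 0 n -> i < n by move=> i; rewrite mem_iota.
elim: (iota 0 n) => //= i s IH h [<-|]; first by exists i => //; apply: h; rewrite inE eqxx.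
by apply: IH => j hj; apply: h; rewrite inE hj orbT.
Qed.

(** The seed is made from the index [x0], the small nonroot [b] and the row data of every root. What
    has to be verified is that these fit into [r * n * binlen q] bits. *)
Lemma roots_of_seedP n d s q r m D x0 P (b : seq nat) y :
  0 < n -> 0 < q -> 2 * n * d <= q -> m + n * binlen q < r -> size x0 = m ->
  Ckt n d s P -> prefix (acircuit_code P) (beval D x0) ->
  size b = n -> all (fun t => t <= d) b -> neval P b <> 0%R ->
  size y = (r * n * binlen q).+1 ->
  (forall k, k < r -> neval P (take n (drop (k * n) (digits q (r * n) (val2 y)))) = 0%R) ->
  exists2 z, size z = r * n * binlen q & roots_of_seed n d s q r m D z = y.
Proof.
move=> n0 q0 hq hr sx hP hw sb hb nb sy zero.
set M := r * n * binlen q in sy *; set H := digits q (r * n) (val2 y) in zero.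
have [_ hdeg _] := hP; set nq := binlen q in hr M sy *.
have sH : size H = r * n by rewrite size_mkseq.
have nq0 : 0 < nq by rewrite /nq ltn_binlen.
have hqn : q < 2 ^ nq := binlen_gt q.
have dq : d < q by case: (d) hq => // d'; nia.
have hnd : n * d <= q./2 by move: hq; rewrite -mulnA; move: (n * d) => X; lia.
(* As [n > 0], already [2 * d <= q], so the coordinates of [b] need one bit less than elements of
   [S_q]. *)
have d2 : d < 2 ^ nq.-1.
  have : 2 * d <= q by apply: leq_trans hq; rewrite -mulnA leq_mul2l /= leq_pmull.
  by move: hqn; rewrite -{1}(prednK nq0) expnS; lia.
have hHq : all (fun t => t < q) H by apply: digits_lt.
pose h k := take n (drop (k * n) H).
have sh k : k < r -> size (h k) = n.
  move=> hk; rewrite size_takel // size_drop sH -mulnBl leq_pmull //; lia.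
have hhq k : all (fun t => t < q) (h k).
  by apply/allP => t /mem_take/mem_drop; apply: (allP hHq).
have ex k : exists eo : nat * seq nat, k < r -> [/\ eo.1 < n * d, size eo.2 = n.-1,
    all (fun t => t < q) eo.2 & row_decode d (fun b => neval P b == 0%R) q b eo.1 eo.2 = h k].
  case: (ltnP k r) => hk; last by exists (0, [::]).
  have [e [o ho]] := row_decodeP (fun i => hdeg (inl i)) sb (sh k hk) (hhq k) nb (zero k hk).
  by exists (e, o).
pose eo k := proj1_sig (constructive_indefinite_description _ (ex k)).
have eoP k : k < r -> [/\ (eo k).1 < n * d, size (eo k).2 = n.-1,
    all (fun t => t < q) (eo k).2 & row_decode d (fun b => neval P b == 0%R) q b (eo k).1 (eo k).2 = h k].
  exact: (proj2_sig (constructive_indefinite_description _ (ex k))).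
pose es := mkseq (fun k => (eo k).1) r.
pose ol := mkseq (fun k => (eo k).2) r.
have hol x : List.In x ol -> size x = n.-1 by move=> hx; have [i /eoP[_ hs _ _] ->] := In_mkseq hx.
have sos : size (flatten ol) = r * n.-1 by rewrite (size_flatten_const hol) size_mkseq.
have r0 : 0 < r by lia.
have q2 : 0 < q./2 by have [he _ _ _] := eoP 0 r0; lia.
have hes : all (fun t => t < q./2) es.
  apply/allP => t /mapP[k]; rewrite mem_iota => hk ->; have [he _ _ _] := eoP k hk.
  exact: leq_trans he hnd.
have hos : all (fun t => t < q) (flatten ol).
  apply/allP => t /flattenP[o /mapP[k]]; rewrite mem_iota => hk ->.
  by have [_ _ ho _] := eoP k hk; apply: (allP ho).
pose bq := val2 y %/ q ^ (r * n).
pose X := undigits q (flatten ol) bq.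
pose u := undigits q./2 es X.
pose t := M - (m + n * nq.-1).
have ses : size es = r by rewrite size_mkseq.
have nnq : n * nq.-1 + n = n * nq by rewrite -{2}(prednK nq0) mulnS addnC.
have rM : r <= M by rewrite /M -mulnA leq_pmulr // muln_gt0 n0.
(* Each root gains a factor two, since its row number is below [q./2]. Hence
   [2 ^ r * u < 2 ^ (M + 2)], one of the two extra bits being the longer output and the other the
   rounding of the quotient [bq]. On the other hand [r + t >= M + 2], from [m + n * nq < r] and
   [n > 0]. *)
have hu : u < 2 ^ t.
  have h1 : u < (q./2) ^ r * X.+1 by have := undigits_lt X hes; rewrite ses.
  have h2 : X < q ^ (r * n.-1) * bq.+1 by have := undigits_lt bq hos; rewrite sos.
  have h3 : 2 ^ r * (q./2) ^ r <= q ^ r.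
    by rewrite -expnMn; case: (r) => // r'; rewrite leq_exp2r //; lia.
  have h4 : q ^ r * q ^ (r * n.-1) = q ^ (r * n).
    by rewrite -expnD -{1}[r]muln1 -mulnDr add1n prednK.
  have h5 : q ^ (r * n) <= 2 ^ M.
    apply: leq_trans (_ : (2 ^ nq) ^ (r * n) <= _); last by rewrite -expnM mulnC.
    by case: (r * n) => // k; rewrite leq_exp2r // ltnW.
  have h6 : bq * q ^ (r * n) <= val2 y by apply: leq_trunc_div.
  have h7 : val2 y < 2 ^ M.+1 by rewrite -sy val2_lt.
  have h8 : 2 ^ r * u < 2 ^ (M + 2).
    have h9 : 2 ^ r * u < q ^ r * X.+1.
      apply: leq_trans (_ : 2 ^ r * ((q./2) ^ r * X.+1) <= _).
        by rewrite ltn_mul2l expn_gt0.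
      by rewrite mulnA leq_mul2r h3 orbT.
    apply: leq_trans h9 _.
    apply: leq_trans (_ : q ^ (r * n) * bq.+1 <= _).
      by rewrite -h4 -mulnA leq_mul2l h2 orbT.
    have e2 : 2 ^ (M + 2) = 2 ^ M.+1 + 2 ^ M + 2 ^ M by rewrite !(expnD, expnS); lia.
    rewrite mulnS e2 [_ * bq]mulnC addnC; apply: leq_add => //.
    by apply: leq_trans h6 (leq_trans (ltnW h7) (leq_addr _ _)).
  rewrite ltnNge; apply/negP => hut.
  have : 2 ^ (r + t) < 2 ^ (M + 2).
    by apply: leq_ltn_trans h8; rewrite expnD leq_mul2l hut orbT.
  by rewrite ltn_exp2l // /t; lia.
exists (x0 ++ flatten (map (tobits nq.-1) b) ++ tobits t u).
  rewrite !size_cat size_tobits (@size_flatten_const _ nq.-1) ?size_map ?sx ?sb; last first.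
    by move=> x /In_mem /mapP[c _ ->]; rewrite size_tobits.
  by rewrite /t; lia.
rewrite /roots_of_seed -/nq.
have -> : take m (x0 ++ flatten (map (tobits nq.-1) b) ++ tobits t u) = x0 by rewrite -sx take_size_cat.
have -> : drop m (x0 ++ flatten (map (tobits nq.-1) b) ++ tobits t u) =
    flatten (map (tobits nq.-1) b) ++ tobits t u by rewrite -sx drop_size_cat.
have htb x : List.In x (map (tobits nq.-1) b) -> size x = nq.-1.
  by move=> /In_mem /mapP[c _ ->]; rewrite size_tobits.
have -> : drop (n * nq.-1) (flatten (map (tobits nq.-1) b) ++ tobits t u) = tobits t u.
  by rewrite -{1}sb -(size_map (tobits nq.-1)) -(size_flatten_const htb) drop_size_cat.
have -> : seed_point n q (flatten (map (tobits nq.-1) b) ++ tobits t u) = b.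
  rewrite /seed_point -/nq -[RHS](mkseq_nth 0) sb; apply/eq_in_map => i; rewrite mem_iota /= => hi.
  rewrite (slice_flatten _ htb) ?size_map ?sb // (nth_map 0) ?sb //.
  have hbi : nth 0 b i <= d by apply: (allP hb); rewrite mem_nth ?sb.
  rewrite capped_val val2_tobits modn_small; last exact: leq_ltn_trans hbi d2.
  by apply/minn_idPr; apply: leq_trans hbi (ltnW dq).
have vu : val2 (tobits t u) = u by rewrite val2_tobits modn_small.
have [g1 g2] := digits_undigits X q2 hes; rewrite ses -/u in g1 g2.
have [g3 g4] := digits_undigits bq q0 hos; rewrite sos -/X in g3 g4.
have Xu : X <= u by rewrite -g2 leq_div.
have bX : bq <= X by rewrite -g4 leq_div.
rewrite /seed_rows vu size_tobits (prednK q2) (prednK q0) g1 g2.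
have vX : val2 (tobits t X) = X by rewrite val2_tobits modn_small // (leq_ltn_trans Xu hu).
rewrite vX size_tobits g3 g4; cbn [fst snd].
have -> : val2 (tobits t bq) = bq by rewrite val2_tobits modn_small // (leq_ltn_trans bX (leq_ltn_trans Xu hu)).
have -> : flatten [seq row_decode d (zero_at n d s q (beval D x0)) q b (nth 0 es k)
    (take n.-1 (drop (k * n.-1) (flatten ol))) | k <- iota 0 r] = H.
  rewrite -[RHS]take_size sH -flatten_slices; congr flatten.
  apply/eq_in_map => k; rewrite mem_iota /= => hk.
  have -> : take n.-1 (drop (k * n.-1) (flatten ol)) = (eo k).2.
    by rewrite -[flatten ol]cats0 (slice_flatten _ hol) ?size_mkseq // nth_mkseq.
  have [he so ho hd] := eoP k hk.
  rewrite nth_mkseq // -/(h k) -hd /row_decode.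
  (* All entries of these hybrids are below [q], so the modular zero test is exact there and the
     decoder lists the same roots in the same order. *)
  congr (_ ++ nth _ _ _ :: _); apply: eq_in_filter => c; rewrite mem_iota /= => hc.
  apply: zero_atP hP hw _; rewrite all_cat /= hc; apply/andP; split.
    by apply/allP => c' /mem_take/(allP hb) h'; apply: leq_ltn_trans h' dq.
  by apply/allP => c' /mem_drop/(allP ho).
rewrite /H /bq undigits_digits -sy; exact: tobits_val2.
Qed.

(** * Reading a word as a hitting set *)

Section Grid.
Variables (q n r : nat) (F : nat -> nat -> 'I_q).
Definition grid_tuple : r.-tuple (n.-tuple 'I_q) := [tuple [tuple F i j | j < n] | i < r].

Lemma val_tuple_of_ord (T : Type) k (f : nat -> T) : [tuple f i | i < k] = [seq f i | i <- iota 0 k] :> seq T.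
Proof. by rewrite /= -val_enum_ord -map_comp. Qed.

Lemma grid_row i : [seq Posz (nat_of_ord c) | c <- tnth grid_tuple i] =
  map Posz [seq nat_of_ord (F i j) | j <- iota 0 n].
Proof. by rewrite tnth_mktuple val_tuple_of_ord -!map_comp. Qed.

Lemma grid_code : hitting_set_code grid_tuple =
  flatten [seq nat_code c | c <- flatten [seq [seq nat_of_ord (F i j) | j <- iota 0 n] | i <- iota 0 r]].
Proof.
rewrite /hitting_set_code /grid_tuple.
rewrite (val_tuple_of_ord r (fun i => [tuple F i j | j < n])) -map_comp.
elim: (iota 0 r) => //= i s IH; rewrite map_cat flatten_cat -{}IH; congr cat.
by rewrite val_tuple_of_ord -!map_comp.
Qed.
End Grid.

(** The arguments 0 to 5 of an instance are [n], [d], [s], [q], [r], [m]; thus this is the seed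
    length, the number of inputs of the circuit whose range is to be avoided. *)
Definition output_bits x := unary_arg 4 x * unary_arg 0 x * binlen (unary_arg 3 x).

Definition hs_seed_map (p : bits * bits) : bits :=
  roots_of_seed (unary_arg 0 p.1) (unary_arg 1 p.1) (unary_arg 2 p.1) (unary_arg 3 p.1)
    (unary_arg 4 p.1) (unary_arg 5 p.1) (circuit_arg 6 p.1) p.2.

Lemma pt_hs_seed_map O : pt O hs_seed_map.
Proof.
rewrite /hs_seed_map; apply: pt_roots_of_seed; try (apply: pt_unary_arg; ptt).
  by apply: pt_circuit_arg; ptt.
by ptt.
Qed.

Definition hitting_set_of (p : bits * bits) : bits :=
  flatten [seq nat_code c | c <- digits (unary_arg 3 p.1).-1.+1 (unary_arg 4 p.1 * unary_arg 0 p.1) (val2 p.2)].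

Lemma pt_hitting_set_of O : pt O hitting_set_of.
Proof.
have h i : pt O (fun p : bits * bits => unary_arg i p.1) by apply: pt_unary_arg; ptt.
have h0 := h 0; have h3 := h 3; have h4 := h 4.
rewrite /hitting_set_of; ptt.
Qed.

Lemma hs_args I : hitting_set_input_valid I ->
  let x := hitting_set_input_code I in
  [/\ unary_arg 0 x = hs_n I, unary_arg 1 x = hs_d I, unary_arg 2 x = hs_s I &
  [/\ unary_arg 3 x = hs_q I, unary_arg 4 x = hs_r I, unary_arg 5 x = hs_m I &
     circuit_arg 6 x = hs_D I]].
Proof.
case=> _ _ _ wf x; rewrite {}/x /hitting_set_input_code.
set ks := [:: _; _; _; _; _; _].
split; [| | | split]; try by rewrite unary_args.
by rewrite (circuit_argP (ks := ks) wf) // !inE eqxx !orbT.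
Qed.

Lemma hitting_set_reduces : exists f, strong_reduction (fun _ => False) f hitting_set_of HITTINGSET_CLASSES EMPTY.
Proof.
have [G [ptG GP]] := polytime_circuits (pt_export2 (@pt_hs_seed_map (fun _ => False))).
exists (fun x => EMPTY_code (output_bits x) (G x (output_bits x) (output_bits x).+1)).
split.
- move=> O; have ho : pt O output_bits.
    have h i : pt O (fun x : bits => unary_arg i x) by apply: pt_unary_arg; ptt.
    have h0 := h 0; have h3 := h 3; have h4 := h 4.
    by rewrite /output_bits; ptt.
  rewrite /EMPTY_code; apply: pt_cat; first by ptt.
  apply: pt_bcircuit_code.
  by apply: (pt_comp3 (f := G)); ptt.
- exact: NP_none.
- exact: pt_hitting_set_of.
move=> _ [I [hI ->]]; have [a0 a1 a2 [a3 a4 a5 a6]] := hs_args hI.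
set x := hitting_set_input_code I in a0 a1 a2 a3 a4 a5 a6 *.
have [wf GE] := GP x (output_bits x) (output_bits x).+1.
split; first by exists (output_bits x), (G x (output_bits x) (output_bits x).+1).
move=> y [m [C [/EMPTY_code_inj[<- <-] sy avoid]]].
have hM : output_bits x = hs_r I * hs_n I * binlen (hs_q I) by rewrite /output_bits a0 a3 a4.
have [q0 hq hr wfD] := hI.
set n := hs_n I in hM hq hr; set q := hs_q I in hM q0 hq hr; set r := hs_r I in hM hr.
pose Hd := digits q (r * n) (val2 y).
have hlt j : nth 0 Hd j < q.
  case: (ltnP j (size Hd)) => hj; last by rewrite nth_default.
  by apply: (allP (digits_lt _ _ q0)); apply: mem_nth.
pose F i j := Ordinal (hlt (i * n + j)).
have rowE i : i < r -> [seq nat_of_ord (F i j) | j <- iota 0 n] = take n (drop (i * n) Hd).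
  move=> hi; have hs : size (take n (drop (i * n) Hd)) = n.
    by rewrite size_takel // size_drop size_mkseq -mulnBl leq_pmull //; lia.
  rewrite -[RHS](mkseq_nth 0) hs; apply/eq_in_map => j; rewrite mem_iota /= => hj.
  by rewrite nth_take // nth_drop.
exists I, (grid_tuple n r F); split => //; last first.
  rewrite /hitting_set_of; cbn [fst snd]; rewrite a0 a3 a4 (prednK q0) -/n -/r -/q -/Hd grid_code; congr (flatten (map _ _)).
  have -> : [seq [seq nat_of_ord (F i j) | j <- iota 0 n] | i <- iota 0 r] =
      [seq take n (drop (i * n) Hd) | i <- iota 0 r].
    by apply/eq_in_map => i; rewrite mem_iota => /= hi; apply: rowE.
  by rewrite flatten_slices take_oversize // size_mkseq.
move=> P [x0 hP] [a ha].
apply: NNPP => hno.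
have zero k : k < r -> neval P (take n (drop (k * n) Hd)) = 0%R.
  move=> hk; apply: NNPP => hne; apply: hno; exists (Ordinal hk).
  by rewrite grid_row rowE.
(* A word that is not a code stands for the zero polynomial, which has no nonroot. *)
case: hP => [[hC hpre]|[e _]]; last by apply: ha; rewrite e.
(* Without variables the empty point is the only one, and [r > 0] puts it into the list. The
   compression is reserved for [n > 0]. *)
have [n0|n0] := posnP n.
  apply: ha; have r0 : 0 < r by lia.
  have := zero 0 r0; rewrite /neval drop0 n0 take0 /=.
  by have -> : tval a = [::] by apply: size0nil; rewrite size_tuple.
have [_ hdeg _] := hC.
have [b sb [hb nb]] := small_nonroot (fun i => hdeg (inl i)) (size_tuple a) ha.
rewrite hM in sy avoid wf GE.
have [z sz zE] := roots_of_seedP n0 q0 hq hr (size_tuple x0) hC hpre sb hb nb sy zero.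
have hz : size z == r * n * binlen q by rewrite sz.
apply: (avoid (Tuple hz)); rewrite GE; last by rewrite /= sz.
rewrite /hs_seed_map; cbn [fst snd nth]; rewrite a0 a1 a2 a3 a4 a5 a6 zE -sy; exact: mkseq_nth.
Qed.

(** * From range avoidance to hitting sets *)

(** Gate [3 * i] is the parameter of factor [i], the next one is the factor itself, and the third
    multiplies it to the product so far, which stands at position [3 * i - 1]. Gate 0 is the
    variable. *)
Definition factor_gates i := [:: AParam i; AAdd 0 (3 * i); AMul (3 * i).-1 (3 * i).+1].
Definition prod_gates k := [:: AVar 0; AParam 0; AAdd 0 1] ++ flatten [seq factor_gates i | i <- iota 1 k].
Definition prod_circuit (hs : seq nat) :=
  ACircuit [seq (- Posz h)%R | h <- hs] (prod_gates (size hs).-1).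

Lemma prod_gatesS k : prod_gates k.+1 =
  rcons (rcons (rcons (prod_gates k) (AParam k.+1)) (AAdd 0 (3 * k.+1))) (AMul (3 * k.+1).-1 (3 * k.+1).+1).
Proof.
rewrite /prod_gates -[k.+1]addn1 iotaD map_cat flatten_cat catA [1 + k]addnC.
by rewrite -!cats1 -!catA.
Qed.
Lemma size_prod_gates k : size (prod_gates k) = 3 * k.+1.
Proof. by elim: k => // k IH; rewrite prod_gatesS !size_rcons IH; lia. Qed.

Section Slp3.
Variables (T : Type) (d : T) (step : seq T -> agate -> T).
Let V k := slp_values step (prod_gates k).
Lemma prod_gates_values k :
  [/\ nth d (V k.+1) 0 = nth d (V k) 0,
      last d (V k.+1) = step (rcons (rcons (V k) (step (V k) (AParam k.+1)))
         (step (rcons (V k) (step (V k) (AParam k.+1))) (AAdd 0 (3 * k.+1)))) (AMul (3 * k.+1).-1 (3 * k.+1).+1),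
      size (V k) = 3 * k.+1 & last d (V k) = nth d (V k) (3 * k.+1).-1].
Proof.
have sV : size (V k) = 3 * k.+1 by rewrite size_slp_values size_prod_gates.
split=> //.
- by rewrite /V /prod_gates !nth_slp_values_cat.
- by rewrite /V prod_gatesS !slp_values_rcons last_rcons.
- by rewrite -nth_last sV.
Qed.
End Slp3.

Lemma prod_eval hs a : 0 < size hs ->
  aeval (prod_circuit hs) a = (\prod_(h <- hs) (nth 0 a 0 - Posz h))%R.
Proof.
case: hs => // h0 hs _; rewrite /aeval /prod_circuit [(size _).-1]/=.
set ps := aparams _; set st := astep ps a.
have H k : k <= size hs -> nth 0%R (slp_values st (prod_gates k)) 0 = nth 0%R a 0 /\
   last 0%R (slp_values st (prod_gates k)) = (\prod_(h <- take k.+1 (h0 :: hs)) (nth 0 a 0 - Posz h))%R.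
  elim: k => [_|k IH hk]; first by rewrite /= take0 big_seq1.
  have [IH1 IH2] := IH (ltnW hk); have [e1 e2 e3 e4] := prod_gates_values 0%R st k.
  rewrite e1 e2; split=> //; rewrite (take_nth 0) // -[rcons (take _ _) _]cats1 big_cat big_seq1 -IH2.
  set V := slp_values _ _ in e3 e4 IH1 IH2 *.
  rewrite /st /=; congr (_ * _)%R.
    rewrite nth_rcons size_rcons e3 !nth_rcons e3 e4.
    have -> : (3 * k.+1).-1 < (3 * k.+1).+1 by lia.
    by have -> : (3 * k.+1).-1 < 3 * k.+1 by lia.
  rewrite nth_rcons size_rcons e3 ltnn eqxx !nth_rcons e3 ltnn eqxx muln_gt0 /= IH1.
  by rewrite /ps /= (nth_map 0).
by have [_ ->] := H (size hs) (leqnn _); rewrite take_oversize.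
Qed.

Lemma prod_degree l hs : 0 < size hs -> adegree l (prod_circuit hs) <= size hs.
Proof.
case: hs => // h0 hs _; rewrite /adegree /prod_circuit [(size _).-1]/=.
set st := degree_step l.
have H k : nth 0 (slp_values st (prod_gates k)) 0 <= 1 /\ last 0 (slp_values st (prod_gates k)) <= k.+1.
  elim: k => [|k [IH1 IH2]].
    by rewrite /st /=; case: (_ == _); case: (_ == _).
  have [e1 e2 e3 e4] := prod_gates_values 0 st k.
  rewrite e1 e2; split=> //.
  set V := slp_values _ _ in e3 e4 IH1 IH2 *.
  rewrite /st /= nth_rcons size_rcons e3 !nth_rcons e3.
  have -> : (3 * k.+1).-1 < (3 * k.+1).+1 by lia.
  have -> : (3 * k.+1).-1 < 3 * k.+1 by lia.
  rewrite -e4 size_rcons e3 !ltnn !eqxx muln_gt0 /=.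
  by case: (_ == _); move: IH1 IH2; lia.
exact: (proj2 (H (size hs))).
Qed.

Lemma prod_wf (hs : seq nat) : 0 < size hs -> slp_wf (agate_wf 1 (size hs)) (prod_gates (size hs).-1).
Proof.
case: hs => // h0 hs _; rewrite [size _]/=.
have H k : k <= size hs -> slp_wf (agate_wf 1 (size hs).+1) (prod_gates k).
  elim: k => // k IH hk; rewrite prod_gatesS !slp_wf_rcons !size_rcons size_prod_gates IH ?(ltnW hk) //=.
  by lia.
exact: H.
Qed.

(** First the [r] constants, of at most [2 * q + 2] bits each, then the [3 * r] gates, of at most
    [12 * r + 4] bits each; every list entry has one more marker bit. Bounding binary lengths by
    values is enough here. *)
Definition code_bound r q := (r * (2 * q + 3) + 1) + (3 * r * (12 * r + 5) + 1).

Lemma size_nat_code k : size (nat_code k) <= 2 * k + 1.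
Proof.
have H (l : seq bool) : size (list_code (fun b => [:: b]) l) = 2 * size l + 1.
  by rewrite /list_code size_cat; elim: l => //= b l; lia.
by rewrite /nat_code H size_mkseq; have := binlen_le k; lia.
Qed.
Lemma size_list_code_le (X : Type) (c : X -> bits) m l : (forall x, List.In x l -> size (c x) <= m) ->
  size (list_code c l) <= size l * m.+1 + 1.
Proof.
move=> h; rewrite /list_code size_cat leq_add2r; elim: l h => //= x l IH h.
rewrite size_cat mulSn; have := h x (or_introl erefl); have := IH (fun y hy => h y (or_intror hy)); lia.
Qed.

Lemma prod_code_size hs q : 0 < size hs -> all (fun h => h < q) hs ->
  size (acircuit_code (prod_circuit hs)) <= code_bound (size hs) q.
Proof.
move=> h0 hq; rewrite /acircuit_code size_cat /code_bound; apply: leq_add.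
  have -> : 2 * q + 3 = (2 * q + 2).+1 by lia.
  rewrite -(size_map (fun h : nat => (- Posz h)%R) hs); apply: size_list_code_le => z /In_mem /mapP[h /(allP hq) hh ->].
  by rewrite /int_code /= abszN /=; have := size_nat_code h; lia.
have -> : 12 * size hs + 5 = (12 * size hs + 4).+1 by lia.
have <- : size (prod_gates (size hs).-1) = 3 * size hs by rewrite size_prod_gates prednK.
rewrite -[agates _]/(prod_gates (size hs).-1); apply: size_list_code_le => g hg.
have : aargs_le (3 * size hs) g.
  have := prod_wf h0; have : size (prod_gates (size hs).-1) <= 3 * size hs by rewrite size_prod_gates prednK.
  have hg' : List.In g (prod_gates (size hs).-1) := hg.
  move: hg'; elim/last_ind: (prod_gates _) => // gs g' IH.
  rewrite slp_wf_rcons size_rcons -cats1 => /List.in_app_iff hin hs1 /andP[h1 h2].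
  case: hin => [hin|[<-|//]]; first by apply: IH => //; lia.
  by rewrite /aargs_le; case: g' h2 => //= [i|i|i j|i j]; lia.
case: g {hg} => [i|i|i j|i j] /andP[/= a1 a2]; rewrite ?(size_cat (nat_code i)).
- by have := size_nat_code i; lia.
- by have := size_nat_code i; lia.
- by have := size_nat_code i; have := size_nat_code j; lia.
- by have := size_nat_code i; have := size_nat_code j; lia.
Qed.

Lemma prod_Ckt hs q : 0 < size hs -> all (fun h => h < q) hs ->
  Ckt 1 (size hs) (code_bound (size hs) q) (prod_circuit hs).
Proof.
move=> h0 hq; split.
- by rewrite /= size_map; apply: prod_wf.
- by move=> l; apply: prod_degree.
- exact: prod_code_size.
Qed.

(** * Iterating the circuit and the resulting class of polynomials *)

Fixpoint stretch (C : bcircuit) m k (z : seq bool) : seq bool :=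
  if k is k.+1 then nth false (beval C z) m :: stretch C m k (take m (beval C z)) else z.

(** The first [m] bits of each output are fed back, and the last one is emitted; here the emitted
    bits are accumulated, which turns the recursion into an iteration. *)
Definition stretch_loop C m k (z : seq bool) :=
  iter k (fun st : seq bool * seq bool =>
    (rcons st.1 (nth false (beval C st.2) m), take m (beval C st.2))) ([::], z).
Lemma stretch_loopE C m k z : (stretch_loop C m k z).1 ++ (stretch_loop C m k z).2 = stretch C m k z.
Proof.
rewrite /stretch_loop; set F := (fun st : seq bool * seq bool => _).
suff H acc : (iter k F (acc, z)).1 ++ (iter k F (acc, z)).2 = acc ++ stretch C m k z by rewrite H.
elim: k z acc => // k IH z acc; rewrite iterSr {2 4}/F; cbn [fst snd].
by rewrite IH cat_rcons.
Qed.

Lemma int_codeN (h : nat) : int_code (- Posz h)%R = (0 < h) :: nat_code h.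
Proof. by rewrite /int_code abszN; congr cons; case: h. Qed.

Section PtStretch.
Variable O : language.
Local Notation pt := (pt O).
Lemma pt_stretch (E : encType) (C : E -> bcircuit) (m k : E -> nat) (z : E -> seq bool) :
  pt C -> pt m -> pt k -> pt z -> pt (fun e => stretch (C e) (m e) (k e) (z e)).
Proof.
move=> hC hm hk hz.
have h : pt (fun e => stretch_loop (C e) (m e) (k e) (z e)).
  apply: (pt_iter_add (step := fun e (st : seq bool * seq bool) =>
    (rcons st.1 (nth false (beval (C e) st.2) (m e)), take (m e) (beval (C e) st.2)))); ptt.
  exists (fun e => 4 * m e + 10); first by bdt.
  move=> e [a b]; rewrite !sz_pair sz_rcons.
  have h1 := sz_bits (take (m e) (beval (C e) b)).
  have h2 : size (take (m e) (beval (C e) b)) <= m e by rewrite size_take; case: ltnP.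
  have h3 := sz_bool (nth false (beval (C e) b) (m e)).
  by rewrite [(_, _).1]/= [(_, _).2]/=; lia.
apply: (pt_ext (f := fun e => (stretch_loop (C e) (m e) (k e) (z e)).1 ++ (stretch_loop (C e) (m e) (k e) (z e)).2)); last by ptt.
by move=> e; apply: stretch_loopE.
Qed.

Lemma pt_prod_code (E : encType) (hs : E -> seq nat) : pt hs ->
  pt (fun e => acircuit_code (prod_circuit (hs e))).
Proof.
move=> h; rewrite /acircuit_code /prod_circuit /prod_gates; apply: pt_cat.
  apply: (pt_ext (f := fun e => list_code (fun h : nat => (0 < h) :: nat_code h) (hs e))).
    by move=> e; rewrite /list_code -map_comp; congr (flatten _ ++ _); apply: eq_map => x /=; rewrite int_codeN.
  by apply: (pt_list_code (c := fun _ (h : nat) => (0 < h) :: nat_code h)); ptt.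
apply: (pt_list_code (X := agate_enc) (c := fun _ => agate_code)); first by ptt.
by cbn [agates]; rewrite /factor_gates; ptt.
Qed.
End PtStretch.

(** The class has [n = 1] and [d = r], whence [q = 2 * r]. The size [r] must exceed [m + binlen q],
    and [binlen q <= m + 4]. The length [l] of the stretched words leaves room for [r] digits in
    radix [q]. *)
Definition class_r m := 2 * m + 6.
Definition class_q m := 2 * class_r m.
Definition class_l m := class_r m * binlen (class_q m).

Definition hard_class (p : bits * bits) : bits :=
  acircuit_code (prod_circuit (digits (class_q (unary_arg 0 p.1)).-1.+1 (class_r (unary_arg 0 p.1))
    (val2 (stretch (circuit_arg 1 p.1) (unary_arg 0 p.1)
       (class_l (unary_arg 0 p.1) - unary_arg 0 p.1) p.2)))).

Lemma pt_hard_class O : pt O hard_class.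
Proof.
have h0 : pt O (fun p : bits * bits => unary_arg 0 p.1) by apply: pt_unary_arg; ptt.
have h1 : pt O (fun p : bits * bits => circuit_arg 1 p.1) by apply: pt_circuit_arg; ptt.
rewrite /hard_class /class_l /class_q /class_r; apply: pt_prod_code.
apply: (pt_digits (q := fun p : bits * bits => 2 * (2 * unary_arg 0 p.1 + 6))); [by ptt|by ptt|].
by apply: pt_stretch; ptt.
Qed.

(** * Inverting the circuit with an NP oracle *)

Definition bits_code (x : seq bool) := list_code (fun b : bool => [:: b]) x.

(* On a word [query x t p], [verify] tests whether the witness is a preimage of [t] under the circuit of [x] with prefix [p]. *)
Definition query (x t p : seq bool) := bits_code x ++ bits_code t ++ p.
Definition verify (p : bits * bits) : bits :=
  let x := (parse_bits p.1).1 in let r := (parse_bits p.1).2 in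
  let t := (parse_bits r).1 in let p0 := (parse_bits r).2 in
  [:: [&& size p.2 == unary_arg 0 x, take (size p0) p.2 == p0 & beval (circuit_arg 1 x) p.2 == t]].
(** The bound has the literal shape demanded of NP, with exponent 1; a preimage is short enough
    because the query contains the whole instance. *)
Definition range_lang (w : bits) := exists2 z : bits, size z <= size w ^ 1 + 1 & verify (w, z) = [:: true].

Lemma pt_verify O : pt O verify.
Proof.
pose r (p : bits * bits) := parse_bits (parse_bits p.1).2.
have hr : pt O r by rewrite /r; ptt.
pose x (p : bits * bits) := (parse_bits p.1).1.
have hx : pt O x by rewrite /x; ptt.
have h1 : pt O (fun p => unary_arg 0 (x p)) by apply: pt_unary_arg.
have h2 : pt O (fun p => circuit_arg 1 (x p)) by apply: pt_circuit_arg.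
apply: (pt_ext (f := fun p : bits * bits => [:: [&& size p.2 == unary_arg 0 (x p),
   take (size (r p).2) p.2 == (r p).2 & beval (circuit_arg 1 (x p)) p.2 == (r p).1]])) => //.
apply: pt_cons; last by ptt.
apply: pt_andb; first by apply: pt_eqn; ptt.
by apply: pt_andb; apply: pt_eqbits; ptt.
Qed.

Lemma NP_range : NP range_lang.
Proof.
exists (fun xs => verify (nth [::] xs 0, nth [::] xs 1)), 1; split; last by [].
exact: pt_export2 (@pt_verify _).
Qed.

Lemma size_bits_code x : size (bits_code x) = 2 * size x + 1.
Proof. by rewrite /bits_code /list_code size_cat; elim: x => //= b l; lia. Qed.

Lemma range_langP x t p : unary_arg 0 x <= size x ->
  range_lang (query x t p) <-> exists z, [/\ size z = unary_arg 0 x, take (size p) z = p &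
    beval (circuit_arg 1 x) z = t].
Proof.
move=> hm; rewrite /range_lang /verify /query /bits_code; cbn [fst snd].
have e1 z : parse_bits (bits_code x ++ z) = (x, z) by apply: parse_bitsP.
have e2 z : parse_bits (bits_code t ++ z) = (t, z) by apply: parse_bitsP.
rewrite -!/(bits_code _) e1; cbn [fst snd]; rewrite e2; cbn [fst snd].
split=> [[z _ [/and3P[/eqP h1 /eqP h2 /eqP h3]]]|[z [h1 h2 h3]]]; first by exists z.
exists z; last by rewrite h1 h2 h3 !eqxx.
by rewrite h1 size_cat size_bits_code expn1; lia.
Qed.

(** Prefix search for the lexicographically first preimage, [false] being tried first at each
    position. If there is no preimage, the result is a meaningless word of the right length, so it
    has to be checked afterwards. *)
Definition search (L : language) (x t : seq bool) : seq bool :=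
  iter (unary_arg 0 x) (fun p => rcons p (~~ ask L (query x t (rcons p false)))) [::].

Lemma searchP x t : unary_arg 0 x <= size x ->
  size (search range_lang x t) = unary_arg 0 x /\
  ((exists2 z, size z = unary_arg 0 x & beval (circuit_arg 1 x) z = t) ->
   beval (circuit_arg 1 x) (search range_lang x t) = t).
Proof.
move=> hm; rewrite /search; set F := (fun p : seq bool => _).
have hs k : size (iter k F [::]) = k by elim: k => //= k IH; rewrite size_rcons IH.
split=> // -[z hz hC].
have H k : k <= unary_arg 0 x -> exists z, [/\ size z = unary_arg 0 x,
    take k z = iter k F [::] & beval (circuit_arg 1 x) z = t].
  elim: k => [_|k IH hk]; first by exists z; rewrite take0.
  have [z1 [h1 h2 h3]] := IH (ltnW hk).
  rewrite iterS {1}/F; case: askP => [/(range_langP _ _ hm)|hno] /=.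
    by move=> [z2 [g1 g2 g3]]; exists z2; split=> //; move: g2; rewrite size_rcons hs.
  exists z1; split=> //; rewrite (take_nth false) ?h1 // h2; congr rcons.
  case e: (nth false z1 k) => //; case: hno; apply/(range_langP _ _ hm).
  exists z1; split=> //; rewrite size_rcons hs (take_nth false) ?h1 // h2 e //.
have [z2 [h1 h2 h3]] := H _ (leqnn _).
by rewrite -h2 take_oversize ?h1.
Qed.

(* Undoes [stretch] round by round: the first round whose output has no preimage yields a string outside the range of the circuit. *)
Definition climb_step (L : language) (x : seq bool) (b : bool) (st : seq bool * seq bool) :=
  if st.1 is _ :: _ then st else
  if beval (circuit_arg 1 x) (search L x (rcons st.2 b)) == rcons st.2 b
  then ([::], search L x (rcons st.2 b)) else (rcons st.2 b, [::]).
Definition climb L x (out u : seq bool) := foldr (climb_step L x) ([::], u) out.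

(** The rounds are undone from the last one on, because [foldr] starts at the end of [out]. A
    nonempty first component signals success. Otherwise the second is a seed whose stretching
    reproduces everything processed so far. *)
Lemma climbP x m C out u : unary_arg 0 x = m -> circuit_arg 1 x = C -> m <= size x ->
  size u = m ->
  let st := climb range_lang x out u in
  if st.1 is [::] then size st.2 = m /\ stretch C m (size out) st.2 = out ++ u
  else size st.1 = m.+1 /\ forall z, size z = m -> beval C z <> st.1.
Proof.
move=> hm hC hs hu; elim: out => //= b out; rewrite -/(climb range_lang x out u).
case: (climb _ _ _ _) => [[|c l] v] /=; last by [].
move=> [hv IH]; rewrite /climb_step /= hC.
have hm' : unary_arg 0 x <= size x by rewrite hm.
have [s1 s2] := searchP (rcons v b) hm'; rewrite hm hC in s1 s2.
case: eqP => [e|ne] /=.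
  split=> //; rewrite e nth_rcons hv ltnn eqxx -cats1 take_cat hv ltnn subnn take0 cats0.
  by rewrite IH.
case E: (rcons v b) => [|b' v']; first by case: (v) E.
rewrite -E size_rcons hv; split=> // z hz hbz; apply: ne; apply: s2.
by exists z.
Qed.

Definition parse_many k cap (y : seq bool) : seq nat :=
  (iter k (fun st : seq nat * seq bool =>
     (rcons st.1 (parse_nat cap st.2).1, (parse_nat cap st.2).2)) ([::], y)).1.

Lemma parse_manyP cap hs : all (fun h => h <= cap) hs ->
  parse_many (size hs) cap (flatten [seq nat_code h | h <- hs]) = hs.
Proof.
rewrite /parse_many; set F := (fun st : seq nat * seq bool => _) => hq.
suff H acc : iter (size hs) F (acc, flatten [seq nat_code h | h <- hs]) = (acc ++ hs, [::]) by rewrite H.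
elim: hs hq acc => [_ acc|h hs IH /andP[hh hq] acc]; first by rewrite cats0.
rewrite [size _]/= iterSr [F _]/F; cbn [fst snd].
by rewrite -[flatten _]/(nat_code h ++ flatten [seq nat_code h | h <- hs]) parse_natP //= IH // cat_rcons.
Qed.

Definition point_values x y := parse_many (class_r (unary_arg 0 x)) (class_q (unary_arg 0 x)) y.
(** The word whose digits in radix [q] are the given points, with zero above them; it is a preimage
    of the points under the reading used in [hard_class]. *)
Definition point_bits x y := tobits (class_l (unary_arg 0 x)) (undigits (class_q (unary_arg 0 x)) (point_values x y) (val2 [::])).
Definition avoided (p : bits * bits) : bits :=
  (climb range_lang p.1 (take (class_l (unary_arg 0 p.1) - unary_arg 0 p.1) (point_bits p.1 p.2))
     (drop (class_l (unary_arg 0 p.1) - unary_arg 0 p.1) (point_bits p.1 p.2))).1.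

Section PtBack.
Local Notation pt := (pt range_lang).

Lemma pt_query (E : encType) (x t p : E -> seq bool) : pt x -> pt t -> pt p ->
  pt (fun e => query (x e) (t e) (p e)).
Proof. by move=> hx ht hp; rewrite /query /bits_code; ptt. Qed.

Lemma size_search x t : size (search range_lang x t) = unary_arg 0 x.
Proof. by rewrite /search; elim: (unary_arg 0 x) => //= k IH; rewrite size_rcons IH. Qed.

Lemma pt_search (E : encType) (x t : E -> seq bool) : pt x -> pt t ->
  pt (fun e => search range_lang (x e) (t e)).
Proof.
move=> hx ht; have hm : pt (fun e => unary_arg 0 (x e)) by apply: pt_unary_arg.
apply: (pt_iter_add (step := fun e p => rcons p (~~ ask range_lang (query (x e) (t e) (rcons p false))))); ptt.
  apply: (pt_comp (g := ask range_lang) _ (@pt_ask range_lang)).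
  by apply: pt_query; ptt.
exists (fun _ => 4); first by bdt.
by move=> e s; rewrite sz_rcons; have := sz_bool (~~ ask range_lang (query (x e) (t e) (rcons s false))); lia.
Qed.

Lemma pt_climb (E : encType) (x out u : E -> seq bool) : pt x -> pt out -> pt u ->
  pt (fun e => climb range_lang (x e) (out e) (u e)).
Proof.
move=> hx ho hu.
apply: (pt_foldr_bd (step := fun e => climb_step range_lang (x e))); ptt.
  have hs : pt (fun q : (E * (seq bool * seq bool)) * bool => search range_lang (x q.1.1) (rcons q.1.2.2 q.2)).
    by apply: pt_search; ptt.
  have hc : pt (fun q : (E * (seq bool * seq bool)) * bool => circuit_arg 1 (x q.1.1)).
    by apply: pt_circuit_arg; ptt.
  have he : pt (fun q : (E * (seq bool * seq bool)) * bool =>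
      beval (circuit_arg 1 (x q.1.1)) (search range_lang (x q.1.1) (rcons q.1.2.2 q.2)) == rcons q.1.2.2 q.2).
    by apply: pt_eqbits; ptt.
  by rewrite /climb_step; ptt.
have hm : pt (fun e => unary_arg 0 (x e)) by apply: pt_unary_arg.
pose N e := (size (u e) + unary_arg 0 (x e)).+1.
exists (fun e => (4 * N e + 1 + (4 * N e + 1)).+1); first by rewrite /N; bdt.
move=> e k; rewrite -/(climb _ _ _ _).
have H l : size (climb range_lang (x e) l (u e)).1 <= N e /\ size (climb range_lang (x e) l (u e)).2 < N e.
  elim: l => [|b l]; first by rewrite /N /=; lia.
  rewrite [climb _ _ (b :: l) _]/= -/(climb range_lang (x e) l (u e)).
  case: (climb _ _ _ _) => [[|c a] v]; rewrite /climb_step; cbn [fst snd]; last by [].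
  case: ifP => _; cbn [fst snd]; rewrite ?size_rcons ?size_search => -[h1 h2]; split; rewrite /N //=; lia.
move: (H (drop k (out e))); case: (climb _ _ _ _) => a v /= [h1 h2].
by rewrite sz_pair; have := sz_bits a; have := sz_bits v; lia.
Qed.

Lemma pt_parse_many (E : encType) (k cap : E -> nat) (y : E -> seq bool) : pt k -> pt cap -> pt y ->
  pt (fun e => parse_many (k e) (cap e) (y e)).
Proof.
move=> hk hc hy; apply: pt_fst.
apply: (pt_iter_bd (step := fun e (st : seq nat * seq bool) =>
     (rcons st.1 (parse_nat (cap e) st.2).1, (parse_nat (cap e) st.2).2))); ptt.
exists (fun e => (k e * (2 * cap e + 2) + 1 + (4 * size (y e) + 1)).+1); first by bdt.
move=> e n hn; set F := (fun st : seq nat * seq bool => _).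
suff : sz (iter n F ([::], y e)).1 <= n * (2 * cap e + 2) + 1 /\ size (iter n F ([::], y e)).2 <= size (y e).
  case: (iter n F _) => a b /= [h1 h2]; rewrite sz_pair; have := sz_bits b.
  have : n * (2 * cap e + 2) <= k e * (2 * cap e + 2) by rewrite leq_mul2r hn orbT.
  lia.
elim: n {hn} => [|n [h1 h2]]; first by rewrite sz_nil.
rewrite iterS {1 3}/F; cbn [fst snd]; split; last exact: leq_trans (parse_nat_size _ _) h2.
rewrite sz_rcons sz_nat mulSn.
have hle c s : (parse_nat c s).1 <= c by rewrite [(_, _).1]/= capped_val geq_minl.
have := hle (cap e) (iter n F ([::], y e)).2.
by lia.
Qed.

Lemma pt_avoided : pt avoided.
Proof.
have h0 : pt (fun p : bits * bits => unary_arg 0 p.1) by apply: pt_unary_arg; ptt.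
have hv : pt (fun p : bits * bits => point_values p.1 p.2).
  by rewrite /point_values /class_q /class_r; apply: pt_parse_many; ptt.
have hb : pt (fun p : bits * bits => point_bits p.1 p.2).
  rewrite /point_bits /class_l /class_q /class_r; apply: pt_undigits; ptt.
by rewrite /avoided /class_l /class_q /class_r; apply: pt_fst; apply: pt_climb; ptt.
Qed.
End PtBack.

(** * The reduction from range avoidance *)

Definition class_input m D := HittingSetInput 1 (class_r m) (code_bound (class_r m) (class_q m))
  (class_q m) (class_r m) m D.

Lemma class_binlen m : binlen (class_q m) <= m + 4.
Proof.
apply: binlen_leq; rewrite /class_q /class_r expnD; have := ltn_expl m (isT : 1 < 2); lia.
Qed.

Lemma pt_input_code O (E : encType) (m : E -> nat) (D : E -> bcircuit) : pt O m -> pt O D ->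
  pt O (fun e => hitting_set_input_code (class_input (m e) (D e))).
Proof.
move=> hm hD; rewrite /hitting_set_input_code /class_input; cbn [hs_n hs_d hs_s hs_q hs_r hs_m hs_D].
by rewrite /code_bound /class_q /class_r; ptt.
Qed.

Lemma empty_reduces : exists f, strong_reduction range_lang f avoided EMPTY HITTINGSET_CLASSES.
Proof.
have [G [ptG GP]] := polytime_circuits (pt_export2 (@pt_hard_class (fun _ => False))).
pose s m := code_bound (class_r m) (class_q m).
exists (fun x => hitting_set_input_code (class_input (unary_arg 0 x)
   (G x (unary_arg 0 x) (s (unary_arg 0 x))))).
split.
- move=> O; have h0 : pt O (fun x : bits => unary_arg 0 x) by apply: pt_unary_arg; ptt.
  apply: (pt_input_code (D := fun x => G x (unary_arg 0 x) (s (unary_arg 0 x)))) => //.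
  by apply: (pt_comp3 (f := G)); rewrite /s /code_bound /class_q /class_r; ptt.
- exact: NP_range.
- exact: pt_avoided.
move=> _ [m [C [wf ->]]].
set x := EMPTY_code m C.
have ex : x = flatten [seq unary_code k | k <- [:: m]] ++ bcircuit_code C.
  by rewrite unary_codes_cons.
have em : unary_arg 0 x = m by rewrite ex unary_args.
have eC : circuit_arg 1 x = C by rewrite ex (circuit_argP (ks := [:: m]) wf) // inE.
have hmx : m <= size x by rewrite /x size_cat size_unary_code; lia.
rewrite em; set r := class_r m; set q := class_q m; set l := class_l m.
have [wfD GE] := GP x m (s m).
have bq : binlen q <= m + 4 := class_binlen m.
have q0 : 0 < q by rewrite /q /class_q /class_r; lia.
have r0 : 0 < r by rewrite /r /class_r; lia.
have bq0 : 0 < binlen q by rewrite ltn_binlen.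
have ml : m <= l by rewrite /l /class_l -/q -/r; apply: leq_trans (leq_pmulr _ bq0); rewrite /r /class_r; lia.
set I := class_input m _; split.
  exists I; split=> //; split=> //=.
  by rewrite -/q /class_r; lia.
move=> Y [I' [H [/hitting_set_input_code_inj e HH eY]]]; subst I'.
rewrite /= -/r -/q in H HH eY.
pose hs := flatten [seq map (@nat_of_ord q) (tval h) | h <- tval H].
have shs : size hs = r.
  rewrite (@size_flatten_const _ 1) ?size_map ?size_tuple ?muln1 //.
  by move=> z /In_mem /mapP[h _ ->]; rewrite size_map size_tuple.
have hsq : all (fun h => h < q) hs.
  by apply/allP => v /flattenP[z /mapP[h _ ->] /mapP[c _ ->]].
have eYhs : Y = flatten [seq nat_code h | h <- hs].
  rewrite eY /hitting_set_code /hs; elim: (tval H) => //= h t IH.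
  by rewrite map_cat flatten_cat -IH -map_comp.
have ev : point_values x Y = hs.
  rewrite /point_values em -/r -/q -shs eYhs; apply: parse_manyP.
  by apply: sub_all hsq => h; apply: ltnW.
pose y := point_bits x Y.
have sy : size y = l by rewrite /y /point_bits em size_tobits.
have vy : val2 y = undigits q hs 0.
  rewrite /y /point_bits em ev -/q -/l /= val2_tobits modn_small //.
  have := undigits_lt 0 hsq; rewrite muln1 shs => h; apply: leq_trans h _.
  rewrite /l /class_l -/q -/r; apply: leq_trans (_ : (2 ^ binlen q) ^ r <= _); last by rewrite -expnM mulnC.
  by case: (r) => // r'; rewrite leq_exp2r // ltnW // binlen_gt.
have ed : digits q.-1.+1 r (val2 y) = hs.
  by rewrite vy prednK // -shs; have [-> _] := digits_undigits 0 q0 hsq.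
rewrite /avoided; cbn [fst snd]; rewrite em -/l -/y.
have sd : size (drop (l - m) y) = m by rewrite size_drop sy subKn.
have := climbP (take (l - m) y) em eC hmx sd.
set res := climb _ _ _ _; case: res => [[|c t] u] /=; last first.
  move=> [h1 h2]; exists m, C; split=> // z; apply: h2; exact: size_tuple.
(* If all rounds could be undone, the seed [u] would be the index of a circuit of the class with all
   points of the hitting set as roots. *)
move=> [hu hst]; exfalso.
rewrite cat_take_drop size_takel ?sy ?leq_subr // in hst.
have hP : Ckt 1 r (s m) (prod_circuit hs) by rewrite /s -/r -/q -shs; apply: prod_Ckt; rewrite ?shs.
have hcl : described_class 1 r (s m) m (G x m (s m)) (prod_circuit hs).
  have hu' : size u == m by rewrite hu.
  exists (Tuple hu'); left; split=> //=.
  rewrite GE // /hard_class; cbn [fst snd nth]; rewrite em eC -/l -/q -/r hst ed.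
  have [_ _ hsz] := hP; move: hsz; move: (acircuit_code _) => w hw.
  (* The generated circuit pads its output with zeros up to length [s m], which is why words are
     only required to begin with a code. *)
  apply/prefixP; exists (nseq (s m - size w) false).
  apply: (@eq_from_nth _ false); first by rewrite size_mkseq size_cat size_nseq subnKC.
  move=> i; rewrite size_mkseq => hi; rewrite nth_mkseq // nth_cat; case: ltnP => // h.
  by rewrite nth_nseq nth_default //; case: ifP.
have [|i hi] := HH _ hcl.
  (* All roots are below [q], so [q] itself is a nonroot. *)
  exists [tuple (Posz q)]; rewrite prod_eval ?shs //=; apply/eqP; rewrite prodf_seq_neq0.
  by apply/allP => h /(allP hsq) hh; rewrite /=; lia.
apply: hi; rewrite prod_eval ?shs //.
have : [seq Posz (nat_of_ord h) | h <- tnth H i] = map Posz (map (@nat_of_ord q) (tnth H i)) by rewrite -map_comp.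
move=> ->; set w := map (@nat_of_ord q) _.
have hz : w \in [seq map (@nat_of_ord q) (tval h) | h <- tval H].
  by apply/mapP; exists (tnth H i) => //; apply: mem_tnth.
have sz1 : size w = 1 by rewrite size_map size_tuple.
have hv : nth 0 w 0 \in hs by apply/flattenP; exists w => //; rewrite mem_nth ?sz1.
apply/eqP; rewrite (nth_map 0) ?sz1 // prodf_seq_eq0; apply/hasP; exists (nth 0 w 0) => //=.
by rewrite subrr.
Qed.

(** * Totality and completeness *)

Lemma EMPTY_total : Defs.total EMPTY.
Proof.
move=> _ [m [C [wf ->]]].
have /and3P[_ /eqP so _] := wf.
have sb (z : m.-tuple bool) : size (beval C z) == m.+1 by rewrite size_map so.
pose F (z : m.-tuple bool) : m.+1.-tuple bool := Tuple (sb z).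
have [y hy] : exists y : m.+1.-tuple bool, y \notin codom F.
  apply/existsP; rewrite -negb_forall; apply/negP => /forallP h.
  have := leq_image_card F predT; rewrite card_tuple card_bool.
  have -> : #|image F predT| = #|{: m.+1.-tuple bool}| by apply: eq_card => y; rewrite h.
  by rewrite card_tuple card_bool leq_exp2l // ltnn.
exists y, m, C; split=> //; first by rewrite size_tuple.
move=> z hz; case/negP: hy; have -> : y = F z by apply: val_inj.
exact: codom_f.
Qed.

Lemma strong_total L f g A B : strong_reduction L f g A B -> Defs.total B -> Defs.total A.
Proof.
by case=> _ _ _ h tB x /h [/tB [y hy] hs]; exists (g (x, y)); apply: hs.
Qed.

Theorem theorem5p4 :
  complete_for PNP_reducible (APEPP PNP_reducible) HITTINGSET_CLASSES /\
  complete_for P_PNP_reducible (APEPP P_PNP_reducible) HITTINGSET_CLASSES.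
Proof.
have [f hf] := hitting_set_reduces; have [g hg] := empty_reduces.
have tot := strong_total hf EMPTY_total.
have red := strong_P_PNP hf.
split; (split; first split=> //).
- exact: P_PNP_reducibleW.
- move=> B [_ [f1 [g1 [[La hLa hf1] hg1 h1]]]].
  have [f' [g' [hf' hg' h]]] := compose_reductions hg hLa hf1 hg1 h1.
  by exists f', g'; split=> //; exists La.
- move=> B [_ [f1 [g1 [hf1 hg1 h1]]]].
  (* Polynomial time is polynomial time relative to the empty language, so the same composition
     yields a forward map without an oracle. *)
  have [f' [g' [hf' hg' h]]] := compose_reductions hg NP_none hf1 hg1 h1.
  by exists f', g'.
Qed.
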